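(* Let $f:M\to N$ be a $(\pm)$-holomorphic map between almost contact metric manifolds. (1) If $M\in\mathcal A_1\cup\mathcal A_2\cup\mathcal A_3\cup\mathcal A_6$ and $N\in\mathcal B_3$, then $f$ is harmonic if and only if it is constant. (2) Let $M\in\mathcal A_1\cup\mathcal A_6\cup\mathcal A_7$ and $N\in\mathcal A_3$. (i) $f$ is harmonic if and only if it is constant along $D^M$ (that is, $f_*X=0$ for all $X\in\Gamma(D^M)$). (ii) If $f$ is further weakly conformal or horizontally weakly conformal, then $f$ is harmonic if and only if it is constant.
   Context: Manifolds and maps are smooth; $\nabla$ denotes Levi-Civita connections. An almost contact metric manifold $M=(M^{2m+1};\varphi,\xi,\eta,g)$ is a $(2m+1)$-dimensional Riemannian manifold with a $(1,1)$-tensor $\varphi$, a vector field $\xi$ and a 1-form $\eta$ such that $\varphi^2X=-X+\eta(X)\xi$, $\eta(\xi)=1$, $g(\varphi X,\varphi Y)=g(X,Y)-\eta(X)\eta(Y)$. Put $D^M=\varphi(TM)=\ker\eta$, $\Omega(X,Y)=g(X,\varphi Y)$, $P(X,Y)=(\nabla_X\varphi)Y+(\nabla_{\varphi X}\varphi)\varphi Y$, $Q(X,Y)=(\nabla_X\varphi)Y+(\nabla_Y\varphi)X$, $W_X=\nabla_XX+\nabla_{\varphi X}(\varphi X)$, $2\mathfrak h=\mathcal L_\xi\varphi$. Conventions: $2d\eta(X,Y)=X\eta(Y)-Y\eta(X)-\eta([X,Y])$; $d\Omega(X,Y,Z)$ is the cyclic sum of $(\nabla_X\Omega)(Y,Z)$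 and $(\eta\wedge\Omega)(X,Y,Z)$ the cyclic sum of $\eta(X)\Omega(Y,Z)$; $\{e_i;\varphi e_i;\xi\}_{1\le i\le m}$ is any local orthonormal frame; $\delta\eta=\eta(\sum_iW_{e_i})=-\operatorname{div}\xi$; $\delta\Omega(X)=g(-\varphi(\nabla_\xi\xi)+\sum_iP(e_i,e_i),X)$. $M$ is normal if $[\varphi,\varphi]+2d\eta\otimes\xi=0$, where $[\varphi,\varphi](X,Y)=\varphi^2[X,Y]+[\varphi X,\varphi Y]-\varphi[\varphi X,Y]-\varphi[X,\varphi Y]$. Classes. $\mathcal A_1$: $\alpha$-contact metric manifolds ($d\eta=\alpha\Omega$, $\alpha\neq0$ a real constant); quasi-contact metric manifolds ($P(X,Y)=2g(X,Y)\xi-\eta(Y)\{X+\eta(X)\xi+\mathfrak hX\}$); quasi-$\mathcal K$-Sasakian manifolds ($P(X,Y)=2g(X,Y)\xi-2\eta(Y)X+\eta(Y)\nabla_{\varphi X}\xi$); strongly pseudoconvex CR-manifolds ($d\eta=\Omega$ and $(\nabla_X\varphi)Y=g(X+\mathfrak hX,Y)\xi-\eta(Y)(X+\mathfrak hX)$); $\alpha$-Sasakian manifolds ($d\eta=\alpha\Omega$, $\alpha\neq0$ constant, and normal). $\mathcal A_2$: nearly trans-Sasakian manifolds of type $(\wp,\theta)$: $Q(X,Y)=\wp\{2g(X,Y)\xi-\eta(X)Y-\eta(Y)X\}-\theta\{\eta(X)\varphi Y+\eta(Y)\varphi X\}$ with nowhere vanishing functions $\wp,\theta$. $\mathcal A_3$: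 trans-Sasakian manifolds of type $(\wp,\theta)$: normal with $(\nabla_X\varphi)Y=\wp\{g(X,Y)\xi-\eta(Y)X\}+\theta\{g(\varphi X,Y)\xi-\eta(Y)\varphi X\}$, where $2m\wp=\delta\Omega(\xi)$, $2m\theta=-\delta\eta$ and $\wp,\theta$ vanish nowhere. $\mathcal A_6$: nearly $\alpha$-Sasakian manifolds ($Q(X,Y)=\alpha\{2g(X,Y)\xi-\eta(Y)X-\eta(X)Y\}$, $\alpha\ne0$ constant). $\mathcal A_7$: semi-Sasakian manifolds (normal and $\delta\Omega=2m\eta$). $\mathcal B_3$: almost $\beta$-Kenmotsu manifolds ($d\Omega=2\beta\,\eta\wedge\Omega$, $d\eta=0$, $d\beta\wedge\eta=0$ for a nowhere vanishing smooth function $\beta$), including the $\beta$-Kenmotsu (normal) and the CR-integrable ($(\nabla_X\varphi)Y=g(\mathfrak hX,Y)\xi-\eta(Y)\mathfrak hX+\beta\{g(\varphi X,Y)\xi-\eta(Y)\varphi X\}$) ones. The target is written $N=(N^{2n+1};\phi,\gamma,\sigma,h)$, with the same notions for $(\phi,\gamma,\sigma,h,n)$. $f$ is $(\pm)$-holomorphic if $f_*\varphi=\phi f_*$ or $f_*\varphi=-\phi f_*$; harmonic if its tension field vanishes. $f$ is weakly conformal if $h(f_*X,f_*Y)=\mu^2g(X,Y)$ for all $X,Y$ and some function $\mu\ge0$. $f$ is horizontally weakly conformal if for some function $\mu\ge0$, $h(f_*X,f_*Y)=\mu(p)^2g(X,Y)$ for all $p$ and $X,Y\in\mathcal H_p=(\ker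 f_{*p})^\perp$, and $f_{*p}:\mathcal H_p\to T_{f(p)}N$ is surjective where $\mu(p)>0$.
   Formalization: M is assumed connected and of dimension 2m+1 with m ≥ 1: for disconnected M locally constant maps are harmonic but need not be constant, and for m = 0 the class conditions on a curve are void and geodesics along γ, or their reparametrizations, contradict (1) and (2). *)

(* Defs.v *)
From HB Require Import structures.
From mathcomp Require Import all_boot all_order all_algebra.
From mathcomp Require Import all_classical all_reals all_analysis.
Set Implicit Arguments.
Unset Strict Implicit.
Unset Printing Implicit Defensive.
Import Order.TTheory GRing.Theory Num.Theory.
Import numFieldNormedType.Exports.
Local Open Scope classical_set_scope.
Local Open Scope ring_scope.

(* Tensor fields on a manifold are given by their components in each chart,   *)
(* subject to the usual transformation laws. Points and tangent vectors in a  *)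
(* chart are column vectors. The dimension of a manifold is written d.+1, so  *)
(* that 'cV[R]_d.+1 is a normed module; below d = 2m.                         *)

(* C^k in the Frechet sense. In finite dimension, being C^k for every k means *)
(* that all the iterated partial derivatives exist and are continuous.        *)
Fixpoint smooth_upto (R : realType) (V W : normedModType R) (k : nat)
    (U : set V) (f : V -> W) : Prop :=
  (forall x, U x -> differentiable f x) /\
  (if k is k'.+1 then forall v, smooth_upto k' U ('D_v f) else True).

(* meant for open U *)
Definition smooth_on (R : realType) (V W : normedModType R)
    (U : set V) (f : V -> W) : Prop :=
  forall k, smooth_upto k U f.

Record manifold (R : realType) (d : nat) := Manifold {
  points :> topologicalType;
  points_hausdorff : hausdorff_space points;
  points_second_countable : @second_countable points;
  chart : Type;
  cdom : chart -> set points;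
  cimg : chart -> set 'cV[R]_d.+1;
  coord : chart -> points -> 'cV[R]_d.+1;
  param : chart -> 'cV[R]_d.+1 -> points;
  cdom_open : forall i, open (cdom i);
  cimg_open : forall i, open (cimg i);
  coord_img : forall i p, cdom i p -> cimg i (coord i p);
  param_dom : forall i x, cimg i x -> cdom i (param i x);
  coordK : forall i p, cdom i p -> param i (coord i p) = p;
  paramK : forall i x, cimg i x -> coord i (param i x) = x;
  coord_continuous : forall i p, cdom i p -> {for p, continuous (coord i)};
  param_continuous : forall i x, cimg i x -> {for x, continuous (param i)};
  chart_cover : forall p, exists i, cdom i p;
  transition_smooth : forall i j,
    smooth_on [set x | cimg i x /\ cdom j (param i x)] (coord j \o param i)
}.
Arguments cdom {R d m} : rename.
Arguments cimg {R d m} : rename.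
Arguments coord {R d m} : rename.
Arguments param {R d m} : rename.

Definition bform (R : realType) (d : nat) (A : 'M[R]_d) (u v : 'cV[R]_d) : R :=
  (u^T *m A *m v) 0 0.

(* components of (varphi, xi, eta, g) in a chart *)
Record acdata (R : realType) (d : nat) := Acdata {
  dphi : 'cV[R]_d.+1 -> 'M[R]_d.+1;
  dxi : 'cV[R]_d.+1 -> 'cV[R]_d.+1;
  deta : 'cV[R]_d.+1 -> 'rV[R]_d.+1;
  dmet : 'cV[R]_d.+1 -> 'M[R]_d.+1
}.

Section LocalCalculus.
Context {R : realType} {d : nat} (S : acdata R d).
Local Notation E := 'cV[R]_d.+1.
Implicit Types (X Y Z : E -> E) (x u v : E).

Definition dbase (k : 'I_d.+1) : E := delta_mx k 0.

Definition phi X : E -> E := fun x => dphi S x *m X x.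
Definition xi : E -> E := dxi S.
Definition eta X : E -> R := fun x => (deta S x *m X x) 0 0.
Definition met X Y : E -> R := fun x => bform (dmet S x) (X x) (Y x).

Definition bracket X Y : E -> E := fun x => 'D_(X x) Y x - 'D_(Y x) X x.

(* u^i v^j Gamma^k_ij *)
Definition christoffel x u v : E :=
  invmx (dmet S x) *m
  \col_k (2^-1 * (bform ('D_u (dmet S) x) v (dbase k)
                + bform ('D_v (dmet S) x) u (dbase k)
                - bform ('D_(dbase k) (dmet S) x) u v)).

Definition nabla X Y : E -> E := fun x => 'D_(X x) Y x + christoffel x (X x) (Y x).

(* (nabla_X varphi) Y *)
Definition nabla_phi X Y : E -> E := fun x => nabla X (phi Y) x - phi (nabla X Y) x.

Definition Omega X Y : E -> R := met X (phi Y).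

Definition opP X Y : E -> E := fun x => nabla_phi X Y x + nabla_phi (phi X) (phi Y) x.
Definition opQ X Y : E -> E := fun x => nabla_phi X Y x + nabla_phi Y X x.

(* 2 hh X = (L_xi varphi) X *)
Definition hh X : E -> E :=
  fun x => 2^-1 *: (bracket xi (phi X) x - phi (bracket xi X) x).

Definition d_eta X Y : E -> R := fun x =>
  2^-1 * ('D_(X x) (eta Y) x - 'D_(Y x) (eta X) x - eta (bracket X Y) x).

(* (nabla_X Omega)(Y, Z) *)
Definition nabla_Omega X Y Z : E -> R := fun x =>
  'D_(X x) (Omega Y Z) x - Omega (nabla X Y) Z x - Omega Y (nabla X Z) x.

Definition d_Omega X Y Z : E -> R := fun x =>
  nabla_Omega X Y Z x + nabla_Omega Y Z X x + nabla_Omega Z X Y x.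

Definition eta_wedge_Omega X Y Z : E -> R := fun x =>
  eta X x * Omega Y Z x + eta Y x * Omega Z X x + eta Z x * Omega X Y x.

Definition nijenhuis X Y : E -> E := fun x =>
  phi (phi (bracket X Y)) x + bracket (phi X) (phi Y) x
  - phi (bracket (phi X) Y) x - phi (bracket X (phi Y)) x.

(* delta eta = - div xi, the divergence being the trace of nabla xi *)
Definition delta_eta : E -> R := fun x =>
  - \sum_k nabla (fun=> dbase k) xi x k 0.

(* {e_i; varphi e_i; xi} is orthonormal at x. The codifferential of Omega at *)
(* x only depends on the values of the e_i at x, P being a tensor, so that    *)
(* nothing is required away from x.                                           *)
Definition adapted_frame_at m (e : 'I_m -> E -> E) x : Prop :=
  [/\ met xi xi x = 1,
      forall i, met (e i) xi x = 0 /\ met (phi (e i)) xi x = 0,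
      forall i j, met (e i) (e j) x = (i == j)%:R,
      forall i j, met (phi (e i)) (phi (e j)) x = (i == j)%:R
    & forall i j, met (e i) (phi (e j)) x = 0].

(* delta Omega computed with e_1, ..., e_m *)
Definition delta_Omega m (e : 'I_m -> E -> E) X : E -> R := fun x =>
  bform (dmet S x)
    (- phi (nabla xi xi) x + \sum_(i < m) opP (e i) (e i) x) (X x).

End LocalCalculus.

Record acmanifold (R : realType) (m : nat) := Acmanifold {
  acbase :> manifold R m.*2;
  acs : chart acbase -> acdata R m.*2;
  acs_smooth : forall i,
    [/\ smooth_on (cimg i) (dphi (acs i)), smooth_on (cimg i) (dxi (acs i)),
        smooth_on (cimg i) (deta (acs i)) & smooth_on (cimg i) (dmet (acs i))];
  acs_transition : forall i j x, cimg i x -> cdom j (param i x) ->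
    let t := coord j \o param i in
    [/\ forall u, 'D_(dphi (acs i) x *m u) t x = dphi (acs j) (t x) *m 'D_u t x,
        'D_(dxi (acs i) x) t x = dxi (acs j) (t x),
        forall u, (deta (acs i) x *m u) 0 0 = (deta (acs j) (t x) *m 'D_u t x) 0 0
      & forall u v, bform (dmet (acs i) x) u v
                  = bform (dmet (acs j) (t x)) ('D_u t x) ('D_v t x)];
  met_sym : forall i x u v, cimg i x ->
    bform (dmet (acs i) x) u v = bform (dmet (acs i) x) v u;
  met_pos : forall i x u, cimg i x -> u != 0 -> 0 < bform (dmet (acs i) x) u u;
  phi_sqr : forall i x u, cimg i x ->
    dphi (acs i) x *m (dphi (acs i) x *m u)
    = - u + (deta (acs i) x *m u) 0 0 *: dxi (acs i) x;
  eta_xi : forall i x, cimg i x -> (deta (acs i) x *m dxi (acs i) x) 0 0 = 1;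
  met_phi : forall i x u v, cimg i x ->
    bform (dmet (acs i) x) (dphi (acs i) x *m u) (dphi (acs i) x *m v)
    = bform (dmet (acs i) x) u v
      - (deta (acs i) x *m u) 0 0 * (deta (acs i) x *m v) 0 0
}.
Arguments acs {R m a} : rename.

Section Classes.
Context {R : realType} {m : nat} (M : acmanifold R m).
Local Notation E := ('cV[R]_(m.*2).+1).

Definition smooth_function (a : M -> R) : Prop :=
  forall i : chart M, smooth_on (cimg i) (a \o param i).

(* a pointwise identity holding for all local smooth vector fields X, Y;      *)
(* p is the point of M with coordinates x                                     *)
Definition for_fields
    (A : acdata R m.*2 -> (E -> E) -> (E -> E) -> M -> E -> Prop) : Prop :=
  forall (i : chart M) X Y x,
    smooth_on (cimg i) X -> smooth_on (cimg i) Y -> cimg i x ->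
    A (acs i) X Y (param i x) x.

Definition normal : Prop :=
  for_fields (fun S X Y p x =>
    nijenhuis S X Y x + (2 * d_eta S X Y x) *: xi S x = 0).

Definition alpha_contact_metric (alpha : R) : Prop :=
  alpha != 0 /\ for_fields (fun S X Y p x => d_eta S X Y x = alpha * Omega S X Y x).

Definition quasi_contact_metric : Prop :=
  for_fields (fun S X Y p x =>
    opP S X Y x = (2 * met S X Y x) *: xi S x
      - eta S Y x *: (X x + eta S X x *: xi S x + hh S X x)).

Definition quasi_K_Sasakian : Prop :=
  for_fields (fun S X Y p x =>
    opP S X Y x = (2 * met S X Y x) *: xi S x - (2 * eta S Y x) *: X x
      + eta S Y x *: nabla S (phi S X) (xi S) x).

Definition strongly_pseudoconvex_CR : Prop :=
  for_fields (fun S X Y p x => d_eta S X Y x = Omega S X Y x) /\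
  for_fields (fun S X Y p x =>
    nabla_phi S X Y x
    = bform (dmet S x) (X x + hh S X x) (Y x) *: xi S x
      - eta S Y x *: (X x + hh S X x)).

Definition alpha_Sasakian (alpha : R) : Prop :=
  alpha_contact_metric alpha /\ normal.

Definition class_A1 : Prop :=
  (exists alpha, alpha_contact_metric alpha) \/ quasi_contact_metric \/
  quasi_K_Sasakian \/ strongly_pseudoconvex_CR \/
  (exists alpha, alpha_Sasakian alpha).

Definition nearly_trans_Sasakian (wp theta : M -> R) : Prop :=
  for_fields (fun S X Y p x =>
    opQ S X Y x
    = wp p *: ((2 * met S X Y x) *: xi S x - eta S X x *: Y x - eta S Y x *: X x)
      - theta p *: (eta S X x *: phi S Y x + eta S Y x *: phi S X x)).

Definition class_A2 : Prop :=
  exists wp theta : M -> R,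
    [/\ smooth_function wp, smooth_function theta,
        forall p, wp p != 0 /\ theta p != 0 & nearly_trans_Sasakian wp theta].

Definition trans_Sasakian (wp theta : M -> R) : Prop :=
  [/\ normal,
      for_fields (fun S X Y p x =>
        nabla_phi S X Y x
        = wp p *: (met S X Y x *: xi S x - eta S Y x *: X x)
          + theta p *: (met S (phi S X) Y x *: xi S x - eta S Y x *: phi S X x)),
      (forall (i : chart M) (e : 'I_m -> E -> E) x,
        (forall k, smooth_on (cimg i) (e k)) -> cimg i x ->
        adapted_frame_at (acs i) e x ->
        (2 * m)%:R * wp (param i x) = delta_Omega (acs i) e (xi (acs i)) x)
    & (forall (i : chart M) x, cimg i x ->
        (2 * m)%:R * theta (param i x) = - delta_eta (acs i) x)].

Definition class_A3 : Prop :=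
  exists wp theta : M -> R,
    [/\ smooth_function wp, smooth_function theta,
        forall p, wp p != 0 /\ theta p != 0 & trans_Sasakian wp theta].

Definition nearly_alpha_Sasakian (alpha : R) : Prop :=
  alpha != 0 /\
  for_fields (fun S X Y p x =>
    opQ S X Y x
    = alpha *: ((2 * met S X Y x) *: xi S x - eta S Y x *: X x - eta S X x *: Y x)).

Definition class_A6 : Prop := exists alpha, nearly_alpha_Sasakian alpha.

Definition semi_Sasakian : Prop :=
  normal /\
  (forall (i : chart M) (e : 'I_m -> E -> E) X x,
    (forall k, smooth_on (cimg i) (e k)) -> smooth_on (cimg i) X -> cimg i x ->
    adapted_frame_at (acs i) e x ->
    delta_Omega (acs i) e X x = (2 * m)%:R * eta (acs i) X x).

Definition class_A7 : Prop := semi_Sasakian.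

Definition almost_beta_Kenmotsu (beta : M -> R) : Prop :=
  [/\ smooth_function beta, forall p, beta p != 0,
      (forall (i : chart M) X Y Z x,
        smooth_on (cimg i) X -> smooth_on (cimg i) Y -> smooth_on (cimg i) Z ->
        cimg i x ->
        d_Omega (acs i) X Y Z x
        = 2 * beta (param i x) * eta_wedge_Omega (acs i) X Y Z x),
      for_fields (fun S X Y p x => d_eta S X Y x = 0)
    & (forall (i : chart M) X Y x,
        smooth_on (cimg i) X -> smooth_on (cimg i) Y -> cimg i x ->
        'D_(X x) (beta \o param i) x * eta (acs i) Y x
        - 'D_(Y x) (beta \o param i) x * eta (acs i) X x = 0)].

(* The beta-Kenmotsu and the CR-integrable almost beta-Kenmotsu manifolds are *)
(* by definition almost beta-Kenmotsu.                                        *)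
Definition class_B3 : Prop := exists beta, almost_beta_Kenmotsu beta.

End Classes.

Section Maps.
Context {R : realType} {m n : nat} {M : acmanifold R m} {N : acmanifold R n}.
Implicit Types (f : M -> N) (i : chart M) (j : chart N).

(* The differential f_* of f in charts is v |-> 'D_v (rep f i j) x. *)
Definition rep f i j : 'cV[R]_(m.*2).+1 -> 'cV[R]_(n.*2).+1 :=
  fun x => coord j (f (param i x)).

Definition rep_dom f i j : set 'cV[R]_(m.*2).+1 :=
  [set x | cimg i x /\ cdom j (f (param i x))].

Definition smooth_map f : Prop :=
  continuous f /\ forall i j, smooth_on (rep_dom f i j) (rep f i j).

Definition holomorphic_up_to (s : R) f : Prop :=
  forall i j x v, rep_dom f i j x ->
    'D_(dphi (acs i) x *m v) (rep f i j) x
    = s *: (dphi (acs j) (rep f i j x) *m 'D_v (rep f i j) x).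

Definition pm_holomorphic f : Prop :=
  holomorphic_up_to 1 f \/ holomorphic_up_to (-1) f.

(* the trace of the second fundamental form                                   *)
(*   D_u D_v F - dF (Gamma_M (u, v)) + Gamma_N (dF u, dF v), F := rep f i j   *)
Definition tension f i j (x : 'cV[R]_(m.*2).+1) : 'cV[R]_(n.*2).+1 :=
  \sum_k \sum_l invmx (dmet (acs i) x) k l *:
    ('D_(dbase k) ('D_(dbase l) (rep f i j)) x
     - 'D_(christoffel (acs i) x (dbase k) (dbase l)) (rep f i j) x
     + christoffel (acs j) (rep f i j x)
         ('D_(dbase k) (rep f i j) x) ('D_(dbase l) (rep f i j) x)).

Definition harmonic_map f : Prop :=
  forall i j x, rep_dom f i j x -> tension f i j x = 0.

Definition constant_map f : Prop := forall p q, f p = f q.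

Definition constant_along_D f : Prop :=
  forall i j (X : 'cV[R]_(m.*2).+1 -> 'cV[R]_(m.*2).+1),
    smooth_on (cimg i) X -> (forall x, cimg i x -> eta (acs i) X x = 0) ->
    forall x, rep_dom f i j x -> 'D_(X x) (rep f i j) x = 0.

Definition weakly_conformal f : Prop :=
  exists2 mu : M -> R, (forall p, 0 <= mu p) &
  forall i j x u v, rep_dom f i j x ->
    bform (dmet (acs j) (rep f i j x)) ('D_u (rep f i j) x) ('D_v (rep f i j) x)
    = mu (param i x) ^+ 2 * bform (dmet (acs i) x) u v.

(* u is orthogonal to the kernel of f_* at x *)
Definition horizontal f i j (x u : 'cV[R]_(m.*2).+1) : Prop :=
  forall v, 'D_v (rep f i j) x = 0 -> bform (dmet (acs i) x) u v = 0.

Definition horizontally_weakly_conformal f : Prop :=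
  exists2 mu : M -> R, (forall p, 0 <= mu p) &
  forall i j x, rep_dom f i j x ->
    (forall u v, horizontal f i j x u -> horizontal f i j x v ->
       bform (dmet (acs j) (rep f i j x)) ('D_u (rep f i j) x) ('D_v (rep f i j) x)
       = mu (param i x) ^+ 2 * bform (dmet (acs i) x) u v) /\
    (0 < mu (param i x) ->
       forall w, exists2 u, horizontal f i j x u & 'D_u (rep f i j) x = w).

End Maps.

(* Main.v *)
Require Import Defs.
From mathcomp Require Import all_boot all_order all_algebra.
From mathcomp Require Import all_classical all_reals all_analysis.
From mathcomp Require Import ring lra.
Set Implicit Arguments.
Unset Strict Implicit.
Unset Printing Implicit Defensive.
Import Order.TTheory GRing.Theory Num.Theory.
Import numFieldNormedType.Exports.
Local Open Scope classical_set_scope.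
Local Open Scope ring_scope.

(* Write J for the structure tensor of N, (gamma, sigma) for its vector field and
   1-form, D for ker eta. Since J f_* xi = +/- f_* phi xi = 0 and f_* D lies in
   the image of J, f_* xi = a gamma and f^* sigma = a eta for a function a.
   Differentiating f_* twice, the sigma-component of the second fundamental form is
     sigma(B(X, Y)) = X(a) eta(Y) + a (nabla_X eta) Y - (nabla_{f_*X} sigma) (f_*Y),
   which is symmetric in X and Y. On D x D its antisymmetric part reads
   a d eta = f^* d sigma, and its trace is
     sigma(tau) = xi(a) + a div xi - tr f^* nabla sigma.
   In all the classes of M, d eta is nonzero somewhere on D at each point.
   (1) On N, d sigma = 0, so a = 0; and d Omega = 2 beta sigma /\ Omega gives
   (nabla_v sigma) v + (nabla_{Jv} sigma) Jv = 2 beta |v|^2 for v in ker sigma.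
   Hence sigma(tau) = -2 beta sum |f_* e_i|^2, and f_* = 0 when tau = 0.
   (2) Here nabla_xi xi = 0 and div xi = 0 (for semi-Sasakian M, because
   delta eta is a multiple of delta^2 Omega = 0). Symmetry of B(xi, X) gives X(a) = 0
   for X in D, whence da = 0 since d eta does not vanish on D; then
   sigma(tau) = -2 theta sum |f_* e_i|^2. So tau = 0 forces f_* to vanish on D,
   then a d eta = 0 gives a = 0: harmonic maps, and maps constant along D, are
   constant. *)

(** * Differential calculus *)

(** Only the sigma-component of the tension field is used, because sigma o f_* is known up to the
    single function a. In its trace over {e_i, phi e_i, xi} the sign of holomorphy enters squared,
    and the target contributes (nabla_v sigma) v + (nabla_{Jv} sigma) Jv with v = f_* e_i. In both
    target classes this is a nowhere zero multiple of |v|^2: evaluating d Omega on (v, Jv, gamma)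
    gives 2 beta, and the symmetric part of nabla sigma gives 2 theta. The argument is therefore
    pointwise, without any integration. The classes of M constrain different objects (nabla phi, d
    eta or the codifferential of Omega). They are all reduced to d eta being nonzero on D and, for
    the second part, to xi being geodesic and divergence free. Three steps are of second order: d(d
    eta) = 0 closes Omega when d eta = alpha Omega, delta^2 Omega = 0 serves the semi-Sasakian case,
    and da = xi(a) eta is differentiated again. Each is carried out in a chart from the symmetry of
    mixed derivatives. The condition m > 0 makes D nonzero, and connectedness turns f_* = 0 into
    constancy. *)

Lemma nbhs_open_on (T : topologicalType) (U : set T) (P : T -> Prop) x :
  open U -> U x -> (forall y, U y -> P y) -> \near x, P x.
Proof. by move=> Uo Ux H; apply: filterS H _; exact: open_nbhs_nbhs. Qed.

Section DirectionalDerivatives.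
Context {R : realType} {V W : normedModType R}.
Implicit Types (f g : V -> W) (x u v : V).

(** The first order expansion of [f] is also one of [g], and [diff_unique] identifies the
    differential. Structure identities hold only on the open image of a chart, so functions can be
    exchanged only near a point. *)
Lemma near_eq_differentiable f g x :
  (\near x, f x = g x) -> differentiable f x -> differentiable g x.
Proof.
move=> fg dfx; apply/diff_locallyP.
have E : g \o shift x = cst (g x) + 'd f x +o_ 0 id.
  apply/eqaddoP => e e0.
  have /eqaddoP/(_ e e0) := diff_locally dfx.
  have fgx : f x = g x := nbhs_singleton fg.
  move: fg; rewrite (near_shift 0) subr0 => fg H.
  by apply: filterS2 fg H => y fgy; rewrite !fctE /= fgx -fgy.
have c : continuous ('d f x) by exact: diff_continuous.
by rewrite (diff_unique c E).
Qed.

Lemma deriveDv f x u v : differentiable f x ->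
  'D_(u + v) f x = 'D_u f x + 'D_v f x.
Proof. by move=> df; rewrite !deriveE // linearD. Qed.

Lemma deriveZv f x (c : R) u : differentiable f x ->
  'D_(c *: u) f x = c *: 'D_u f x.
Proof. by move=> df; rewrite !deriveE // linearZ. Qed.

Lemma deriveNv f x u : differentiable f x -> 'D_(- u) f x = - 'D_u f x.
Proof. by move=> df; rewrite !deriveE // linearN. Qed.

Lemma derive_sumv f x (I : Type) (r : seq I) (P : pred I) (F : I -> V) :
  differentiable f x ->
  'D_(\sum_(i <- r | P i) F i) f x = \sum_(i <- r | P i) 'D_(F i) f x.
Proof.
by move=> df; rewrite deriveE // linear_sum; apply: eq_bigr => i _; rewrite deriveE.
Qed.

Lemma derive_cstD f (c : W) x v : differentiable f x ->
  'D_v (fun y => c + f y) x = 'D_v f x.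
Proof.
move=> df; have := deriveD (derivable_cst c x v) (diff_derivable df).
by rewrite derive_cst add0r.
Qed.

Lemma derive_fopp f x v : differentiable f x ->
  'D_v (fun y => - f y) x = - 'D_v f x.
Proof. by move=> df; exact: (deriveN (diff_derivable df)). Qed.

Lemma derive_chain (Z : normedModType R) f (g : W -> Z) x u :
  differentiable f x -> differentiable g (f x) ->
  'D_u (g \o f) x = 'D_('D_u f x) g (f x).
Proof.
move=> df dg; rewrite !deriveE //; last exact: differentiable_comp.
by rewrite diff_comp.
Qed.

End DirectionalDerivatives.

(** * Symmetry of second derivatives *)

Section Young.
Context {R : realType} {V : normedModType R}.
Implicit Types (f : V -> R) (x u v : V).

(** The mean value theorem in the direction [v] turns the second difference into t times a
    difference of two values of ['D_v f]. Both values are then expanded to first order at [x]. *)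
Lemma second_difference_cvg f x v w :
  (\forall y \near x, differentiable f y) -> differentiable ('D_v f) x ->
  forall e : R, 0 < e -> exists2 d : R, 0 < d & forall t : R, 0 < t < d ->
  `|f (x + t *: v + t *: w) - f (x + t *: v) - (f (x + t *: w) - f x)
     - t ^+ 2 * 'D_w ('D_v f) x| <= e * t ^+ 2.
Proof.
move=> ndf ddf e e0.
(* For s, r in [0, t] the norm of s v + r w is at most t C, and the summand 1 keeps [C] positive.
   The tolerance e / (2 C) is spent once at each of the two points where ['D_v f] is expanded. *)
pose C : R := `|v| + `|w| + 1.
have C0 : 0 < C by rewrite /C addrC ltr_wpDr // addr_ge0.
pose e' := e / (2 * C).
have e'0 : 0 < e' by rewrite divr_gt0 // mulr_gt0.
have /eqaddoP/(_ e' e'0) H := diff_locally ddf.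
have {}ndf : \forall y \near 0, differentiable f (y + x).
  by move: ndf; rewrite (near_shift 0) subr0.
have /nbhs_ballP [d d0 dP] : \forall y \near (0 : V), differentiable f (y + x) /\
    `|('D_v f \o shift x - (cst ('D_v f x) + 'd ('D_v f) x)) y| <= e' * `|id y|.
  by near=> y; split; near: y.
exists (d / C); first by rewrite divr_gt0.
move=> t /andP[t0 td].
have tC : t * C < d by rewrite -ltr_pdivlMr.
have small s r : s \in `[0, t] -> r \in `[0, t] -> `|s *: v + r *: w| <= t * C.
  rewrite !in_itv /= => /andP[s0 st] /andP[r0 rt].
  apply: (le_trans (ler_normD _ _)); rewrite !normrZ !ger0_norm //.
  rewrite /C !mulrDr mulr1 -addrA lerD //; first exact: ler_wpM2r.
  apply: (@le_trans _ _ (t * `|w|)); first exact: ler_wpM2r.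
  by rewrite lerDl ltW.
have t_in : t \in `[0, t] by rewrite in_itv /= lexx ltW.
have o_in : 0 \in `[0, t] by rewrite in_itv /= lexx ltW.
have inball s r : s \in `[0, t] -> r \in `[0, t] -> ball 0 d (s *: v + r *: w).
  move=> hs hr; rewrite -ball_normE /= add0r normrN.
  exact: le_lt_trans (small _ _ hs hr) tC.
have dfsr s r : s \in `[0, t] -> r \in `[0, t] ->
    is_derive s 1 (fun s : R => f (x + s *: v + r *: w)) ('D_v f (x + s *: v + r *: w)).
  move=> hs hr.
  have [dd _] := dP _ (inball _ _ hs hr).
  have dfy : differentiable f (x + s *: v + r *: w) by rewrite -addrA addrC.
  pose k := fun s : R => x + s *: v + r *: w.
  have kE : k = cst (x + r *: w) + *:%R^~ v.
    by apply/funext => z; rewrite /k !fctE /= addrAC.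
  have dk : is_diff s k (0 + *:%R^~ v) by rewrite kE; apply: is_diffD.
  have Dk : 'D_1 k s = v.
    by rewrite deriveE // diff_val !fctE /= scale1r add0r.
  have c : 'D_1 (f \o k) s = 'D_v f (k s).
    by rewrite derive_chain // Dk.
  apply: DeriveDef; last exact: c.
  by apply/derivable1_diffP; exact: differentiable_comp.
(* The increment of [ph] over [0, t] is the second difference; [0 *: w] is kept so that [dfsr]
   covers both terms. *)
pose ph := fun s : R => f (x + s *: v + t *: w) - f (x + s *: v + 0 *: w).
have phd s : s \in `[0, t] ->
  is_derive s 1 ph ('D_v f (x + s *: v + t *: w) - 'D_v f (x + s *: v + 0 *: w)).
  by move=> hs; apply: is_deriveB; exact: dfsr.
have cph : {within `[0, t], continuous ph}.
  apply: derivable_within_continuous => s hs.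
  by have [] := phd s hs.
pose dph := fun s : R => 'D_v f (x + s *: v + t *: w) - 'D_v f (x + s *: v + 0 *: w).
have phdo s : s \in `]0, t[ -> is_derive s 1 ph (dph s).
  by move=> /subset_itv_oo_cc; exact: phd.
have [c hc phE] := MVT_segment (ltW t0) phdo cph.
have {phE} -> : f (x + t *: v + t *: w) - f (x + t *: v) - (f (x + t *: w) - f x)
  = ('D_v f (x + c *: v + t *: w) - 'D_v f (x + c *: v)) * t.
  by move: phE; rewrite /ph /dph subr0 !scale0r !addr0.
have [_ h1] := dP _ (inball _ _ hc t_in).
have [_ h2] := dP _ (inball _ _ hc o_in).
move: h1 h2; rewrite !fctE /= scale0r addr0 => h1 h2.
have s1 := small _ _ hc t_in.
have s2 := small _ _ hc o_in.
rewrite scale0r addr0 in s2.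
rewrite (_ : 'D_v f (x + c *: v + t *: w) = 'D_v f (c *: v + t *: w + x)); last first.
  by rewrite addrC addrA addrC addrA.
rewrite (_ : 'D_v f (x + c *: v) = 'D_v f (c *: v + x)); last by rewrite addrC.
set L := 'd ('D_v f) x in h1 h2 *.
have Lw : 'D_w ('D_v f) x = L w by rewrite deriveE.
have LD : L (c *: v + t *: w) = L (c *: v) + t * L w.
  by rewrite linearD [X in _ + X]linearZ.
rewrite Lw; rewrite LD in h1.
move: h1 h2; set p := 'D_v f (c *: v + t *: w + x); set q := 'D_v f (c *: v + x).
set z := 'D_v f x; set lv := L (c *: v); set lw := L w.
move=> h1 h2.
have -> : (p - q) * t - t ^+ 2 * lw = t * ((p - (z + (lv + t * lw))) - (q - (z + lv))).
  by ring.
have {}h1 : `|p - (z + (lv + t * lw))| <= e' * (t * C).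
  by apply: (le_trans h1); rewrite ler_wpM2l // ltW.
have {}h2 : `|q - (z + lv)| <= e' * (t * C).
  by apply: (le_trans h2); rewrite ler_wpM2l // ltW.
rewrite normrM (ger0_norm (ltW t0)).
have -> : e * t ^+ 2 = t * (e' * (t * C) + e' * (t * C)).
  by rewrite /e'; field; rewrite gt_eqF.
apply: ler_wpM2l; first exact: ltW.
by rewrite (le_trans (ler_normB _ _)) // lerD.
Unshelve. all: by end_near. Qed.

(* Young's form of the symmetry of second derivatives: no continuity of the
   second derivatives is required. *)
Lemma derive_comm_real f x v w :
  (\forall y \near x, differentiable f y) ->
  differentiable ('D_v f) x -> differentiable ('D_w f) x ->
  'D_w ('D_v f) x = 'D_v ('D_w f) x.
Proof.
move=> ndf dv dw.
apply/eqP; rewrite -subr_eq0 -normr_le0; apply/ler_addgt0Pl => e e0.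
rewrite addr0.
have e20 : 0 < e / 2 by rewrite divr_gt0.
have [d1 d10 H1] := second_difference_cvg w ndf dv e20.
have [d2 d20 H2] := second_difference_cvg v ndf dw e20.
(* One step size below both thresholds: the second difference is symmetric in [v] and [w], so it
   approximates t^2 times either mixed derivative. *)
pose t := Num.min d1 d2 / 2.
have m0 : 0 < Num.min d1 d2 by rewrite lt_min d10.
have t0 : 0 < t by rewrite divr_gt0.
have tm : t < Num.min d1 d2 by rewrite /t ltr_pdivrMr // ltr_pMr // ltr1n.
have td1 : t < d1 by apply: (lt_le_trans tm); rewrite ge_min lexx.
have td2 : t < d2 by apply: (lt_le_trans tm); rewrite ge_min lexx orbT.
have {}H1 := H1 t; have {}H2 := H2 t.
rewrite t0 td1 in H1; rewrite t0 td2 in H2.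
move: (H1 isT) (H2 isT); rewrite (addrAC x (t *: w)).
set a := 'D_w _ _; set b := 'D_v _ _.
set p := f _; set q := f _; set r := f (x + t *: w); set s := f x => {}H1 {}H2.
have t20 : 0 < t ^+ 2 by rewrite exprn_gt0.
rewrite -(ler_pM2r t20) -{1}(ger0_norm (ltW t20)) -normrM.
have -> : (a - b) * t ^+ 2 = (p - r - (q - s) - t ^+ 2 * b) - (p - q - (r - s) - t ^+ 2 * a).
  by ring.
rewrite (le_trans (ler_normB _ _)) //.
have -> : e * t ^+ 2 = e / 2 * t ^+ 2 + e / 2 * t ^+ 2 by field.
exact: lerD H2 H1.
Qed.

End Young.

(** * Calculus of matrix-valued functions *)

Section MatrixCalculus.
Context {R : realType} {V : normedModType R}.
Implicit Types (x v : V).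

Lemma differentiable_entry m n (A : V -> 'M[R]_(m, n)) x i j :
  differentiable A x -> differentiable (fun y => A y i j) x.
Proof.
by move=> dA; apply: (differentiable_comp dA (differentiable_coord _ _ _)).
Qed.

Lemma differentiable_mx m n (A : V -> 'M[R]_(m, n)) x :
  (forall i j, differentiable (fun y => A y i j) x) -> differentiable A x.
Proof.
move=> dA.
have -> : A = \sum_(i < m) \sum_(j < n) (fun y => A y i j *: delta_mx i j).
  apply/funext => y; rewrite fct_sumE [LHS]matrix_sum_delta.
  by apply: eq_bigr => i _; rewrite fct_sumE.
apply: differentiable_sum => i; apply: differentiable_sum => j.
exact: differentiableZl.
Qed.

Lemma derive_entry m n (A : V -> 'M[R]_(m, n)) x v i j :
  differentiable A x -> 'D_v (fun y => A y i j) x = 'D_v A x i j.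
Proof. by move=> dA; rewrite derive_mx ?mxE //; exact: diff_derivable. Qed.

Lemma derive_fsum (I : finType) (W : normedModType R) (F : I -> V -> W) x v :
  (forall i, differentiable (F i) x) ->
  'D_v (fun y => \sum_i F i y) x = \sum_i 'D_v (F i) x.
Proof.
move=> dF; rewrite big_enum_val /=.
have -> : (fun y => \sum_i F i y) = \sum_(i < #|I|) F (enum_val i).
  by apply/funext => y; rewrite fct_sumE big_enum_val.
by rewrite derive_sum // => i; exact: diff_derivable.
Qed.

Lemma differentiable_fsum (I : finType) (W : normedModType R) (F : I -> V -> W) x :
  (forall i, differentiable (F i) x) ->
  differentiable (fun y => \sum_i F i y) x.
Proof.
move=> dF.
have -> : (fun y => \sum_i F i y) = \sum_(i < #|I|) F (enum_val i).
  by apply/funext => y; rewrite fct_sumE big_enum_val.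
exact: differentiable_sum.
Qed.

Lemma differentiable_mulmx m n p (A : V -> 'M[R]_(m, n)) (B : V -> 'M[R]_(n, p)) x :
  differentiable A x -> differentiable B x ->
  differentiable (fun y => A y *m B y) x.
Proof.
move=> dA dB; apply: differentiable_mx => i j.
under eq_fun do rewrite mxE.
apply: differentiable_fsum => k.
by apply: differentiableM; exact: differentiable_entry.
Qed.

Lemma derive_mulmx m n p (A : V -> 'M[R]_(m, n)) (B : V -> 'M[R]_(n, p)) x v :
  differentiable A x -> differentiable B x ->
  'D_v (fun y => A y *m B y) x = 'D_v A x *m B x + A x *m 'D_v B x.
Proof.
move=> dA dB; apply/matrixP => i j.
rewrite -derive_entry; last exact: differentiable_mulmx.
under eq_fun do rewrite mxE.
rewrite derive_fsum; last first.
  by move=> k; apply: differentiableM; exact: differentiable_entry.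
rewrite !mxE -big_split; apply: eq_bigr => k _.
rewrite deriveM; [|exact/diff_derivable/differentiable_entry..].
by rewrite !derive_entry //= addrC; congr (_ + _); rewrite mulrC.
Qed.

Lemma differentiable_trmx m n (A : V -> 'M[R]_(m, n)) x :
  differentiable A x -> differentiable (fun y => (A y)^T) x.
Proof.
move=> dA; apply: differentiable_mx => i j.
by under eq_fun do rewrite mxE; exact: differentiable_entry.
Qed.

Lemma derive_trmx m n (A : V -> 'M[R]_(m, n)) x v :
  differentiable A x -> 'D_v (fun y => (A y)^T) x = ('D_v A x)^T.
Proof.
move=> dA; apply/matrixP => i j.
rewrite -derive_entry; last exact: differentiable_trmx.
by under eq_fun do rewrite mxE; rewrite derive_entry // mxE.
Qed.

Lemma differentiable_mxtrace n (A : V -> 'M[R]_n) x :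
  differentiable A x -> differentiable (fun y => \tr (A y)) x.
Proof.
by move=> dA; apply: differentiable_fsum => i; exact: differentiable_entry.
Qed.

Lemma derive_mxtrace n (A : V -> 'M[R]_n) x v :
  differentiable A x -> 'D_v (fun y => \tr (A y)) x = \tr ('D_v A x).
Proof.
move=> dA; rewrite derive_fsum; last by move=> i; exact: differentiable_entry.
by apply: eq_bigr => i _; rewrite derive_entry.
Qed.

Lemma differentiable_fprod (I : finType) (F : I -> V -> R) x :
  (forall i, differentiable (F i) x) ->
  differentiable (fun y => \prod_i F i y) x.
Proof.
move=> dF; elim: (index_enum I) => [|i r IH].
  under eq_fun do rewrite big_nil.
  exact: differentiable_cst.
under eq_fun do rewrite big_cons.
exact: (differentiableM (dF i) IH).
Qed.

Lemma differentiable_det n (A : V -> 'M[R]_n) x :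
  differentiable A x -> differentiable (fun y => \det (A y)) x.
Proof.
move=> dA; apply: differentiable_fsum => s.
apply: differentiableM; first exact: differentiable_cst.
by apply: differentiable_fprod => i; exact: differentiable_entry.
Qed.

(** By Cramer's formula the inverse is a quotient of polynomials in the entries. Invertibility is
    required near [x] because [invmx] returns its argument on singular matrices. *)
Lemma differentiable_invmx n (A : V -> 'M[R]_n) x :
  (\near x, A x \in unitmx) -> differentiable A x ->
  differentiable (fun y => invmx (A y)) x.
Proof.
move=> uA dA.
apply: (@near_eq_differentiable _ _ _ (fun y => (\det (A y))^-1 *: \adj (A y))).
  by near=> y; rewrite /invmx ifT //; near: y.
have dx : \det (A x) != 0.
  by have := nbhs_singleton uA; rewrite unitmxE unitfE.
apply: differentiable_mx => i j.
under eq_fun do rewrite !mxE.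
apply: differentiableM.
  by apply: differentiableV => //; exact: differentiable_det.
apply: differentiableM; first exact: differentiable_cst.
apply: differentiable_det; apply: differentiable_mx => k l.
by under eq_fun do rewrite !mxE; exact: differentiable_entry.
Unshelve. all: by end_near. Qed.

Lemma derive_invmx n (A : V -> 'M[R]_n) x v :
  (\near x, A x \in unitmx) -> differentiable A x ->
  'D_v (fun y => invmx (A y)) x = - (invmx (A x) *m 'D_v A x *m invmx (A x)).
Proof.
move=> uA dA.
have dI := differentiable_invmx uA dA.
have ux := nbhs_singleton uA.
have : 'D_v (fun y => A y *m invmx (A y)) x = 'D_v (cst 1%:M) x.
  by apply: near_eq_derive; near=> y; rewrite mulmxV //; near: y.
rewrite derive_mulmx // derive_cst => /eqP; rewrite addrC addr_eq0 => /eqP E.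
by rewrite -[LHS](mulKmx ux) E mulmxN mulmxA.
Unshelve. all: by end_near. Qed.

Lemma derive_comm_mx m n (A : V -> 'M[R]_(m, n)) x v w :
  (\forall y \near x, differentiable A y) ->
  differentiable ('D_v A) x -> differentiable ('D_w A) x ->
  'D_w ('D_v A) x = 'D_v ('D_w A) x.
Proof.
move=> ndA dv dw; apply/matrixP => i j.
have E u : \forall y \near x, 'D_u A y i j = 'D_u (fun y => A y i j) y.
  by near=> y; rewrite derive_entry //; near: y.
have D u : differentiable ('D_u A) x -> differentiable ('D_u (fun y => A y i j)) x.
  move=> du; apply: near_eq_differentiable (E u) _.
  exact: (differentiable_entry i j du).
have L u z : differentiable ('D_u A) x ->
    'D_z ('D_u A) x i j = 'D_z ('D_u (fun y => A y i j)) x.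
  move=> du; apply: etrans (esym (derive_entry z i j du)) _.
  exact: near_eq_derive (E u).
apply: etrans (L _ _ dv) (etrans _ (esym (L _ _ dw))).
apply: derive_comm_real; [|exact: D dv|exact: D dw].
by near=> y; apply: differentiable_entry; near: y.
Unshelve. all: by end_near. Qed.

End MatrixCalculus.

(** * Levi-Civita connection in a chart *)

Lemma mulcV_ext (R : realType) m n (A B : 'M[R]_(m, n)) :
  (forall u : 'cV_n, A *m u = B *m u) -> A = B.
Proof.
move=> H; apply/matrixP => i j.
have := congr1 (fun M : 'cV_m => M i 0) (H (delta_mx j 0)).
by rewrite -!colE !mxE.
Qed.

Lemma unitmx_mulcV_inj (R : realType) n (A : 'M[R]_n) :
  (forall u : 'cV_n, A *m u = 0 -> u = 0) -> A \in unitmx.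
Proof.
move=> H; rewrite -unitmx_tr -row_free_unit; apply: inj_row_free => v.
move=> /(congr1 trmx); rewrite trmx_mul trmxK trmx0 => /H.
by move=> /(congr1 trmx); rewrite trmxK trmx0.
Qed.

Lemma cV_delta_sum (R : pzSemiRingType) n (u : 'cV[R]_n) :
  u = \sum_i u i 0 *: delta_mx i 0.
Proof.
rewrite [LHS]matrix_sum_delta; apply: eq_bigr => i _.
by rewrite big_ord_recl big_ord0 addr0.
Qed.

Section BilinearForms.
Context {R : realType} {d : nat}.
Implicit Types (A B : 'M[R]_d) (u v w : 'cV[R]_d).

Lemma bformDl A u v w : bform A (u + v) w = bform A u w + bform A v w.
Proof. by rewrite /bform raddfD /= !mulmxDl mxE. Qed.
Lemma bformDr A u v w : bform A w (u + v) = bform A w u + bform A w v.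
Proof. by rewrite /bform mulmxDr mxE. Qed.
Lemma bformZl A (c : R) u w : bform A (c *: u) w = c * bform A u w.
Proof. by rewrite /bform linearZ /= -!scalemxAl mxE. Qed.
Lemma bformZr A (c : R) u w : bform A w (c *: u) = c * bform A w u.
Proof. by rewrite /bform -scalemxAr mxE. Qed.
Lemma bformNl A u w : bform A (- u) w = - bform A u w.
Proof. by rewrite -scaleN1r bformZl mulN1r. Qed.
Lemma bformNr A u w : bform A w (- u) = - bform A w u.
Proof. by rewrite -scaleN1r bformZr mulN1r. Qed.
Lemma bform0l A w : bform A 0 w = 0.
Proof. by rewrite -(scale0r 0) bformZl mul0r. Qed.
Lemma bform0r A w : bform A w 0 = 0.
Proof. by rewrite -(scale0r 0) bformZr mul0r. Qed.
Lemma bform_suml A (I : Type) (r : seq I) (P : pred I) (F : I -> 'cV[R]_d) w :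
  bform A (\sum_(i <- r | P i) F i) w = \sum_(i <- r | P i) bform A (F i) w.
Proof.
by apply: (big_morph (bform A ^~ w) (fun u v => bformDl A u v w) (bform0l A w)).
Qed.
Lemma bform_sumr A (I : Type) (r : seq I) (P : pred I) (F : I -> 'cV[R]_d) w :
  bform A w (\sum_(i <- r | P i) F i) = \sum_(i <- r | P i) bform A w (F i).
Proof.
by apply: (big_morph (bform A w) (fun u v => bformDr A u v w) (bform0r A w)).
Qed.

Definition bformE := (bformDl, bformDr, bformNl, bformNr, bformZl, bformZr,
  bform0l, bform0r).

Lemma bform_tr A u v : bform A^T u v = bform A v u.
Proof.
have E : u^T *m A^T *m v = (v^T *m A *m u)^T by rewrite !trmx_mul trmxK mulmxA.
by rewrite /bform E mxE.
Qed.

Lemma bform_mulmxr A B u v : bform A u (B *m v) = bform (A *m B) u v.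
Proof. by rewrite /bform !mulmxA. Qed.
Lemma bform_mulmxl A B u v : bform A (B *m u) v = bform (B^T *m A) u v.
Proof. by rewrite /bform trmx_mul !mulmxA. Qed.

Lemma bform_addmx A B u v : bform (A + B) u v = bform A u v + bform B u v.
Proof. by rewrite /bform mulmxDr mulmxDl mxE. Qed.
Lemma bform_oppmx A u v : bform (- A) u v = - bform A u v.
Proof. by rewrite /bform mulmxN mulNmx mxE. Qed.
Lemma bform_scalemx (c : R) A u v : bform (c *: A) u v = c * bform A u v.
Proof. by rewrite /bform -scalemxAr -scalemxAl mxE. Qed.

Lemma bform_mxE A u v : bform A u v = (u^T *m A *m v) 0 0.
Proof. by []. Qed.

Lemma bform_ext A B : (forall u v, bform A u v = bform B u v) -> A = B.
Proof.
move=> H; apply/matrixP => i j; have := H (delta_mx i 0) (delta_mx j 0).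
by rewrite !bform_mxE !trmx_delta -!rowE -!colE !mxE.
Qed.

Lemma pairD m (e : 'M[R]_(1, m)) (u v : 'cV_m) :
  (e *m (u + v)) 0 0 = (e *m u) 0 0 + (e *m v) 0 0.
Proof. by rewrite mulmxDr mxE. Qed.
Lemma pairZ m (e : 'M[R]_(1, m)) (c : R) (u : 'cV_m) :
  (e *m (c *: u)) 0 0 = c * (e *m u) 0 0.
Proof. by rewrite -scalemxAr mxE. Qed.
Lemma pairN m (e : 'M[R]_(1, m)) (u : 'cV_m) : (e *m (- u)) 0 0 = - (e *m u) 0 0.
Proof. by rewrite mulmxN mxE. Qed.
Lemma pair0 m (e : 'M[R]_(1, m)) : (e *m (0 : 'cV_m)) 0 0 = 0.
Proof. by rewrite mulmx0 mxE. Qed.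

Lemma mx11_scale (m : nat) (a : 'cV[R]_m) (c : 'M[R]_1) : a *m c = c 0 0 *: a.
Proof. by rewrite [c]mx11_scalar mul_mx_scalar mxE eqxx mulr1n. Qed.

End BilinearForms.

(* Unification of bilinear expressions is slow: [ring] and [lra] are only
   called once these expressions are turned into variables. *)
Ltac scalars :=
  repeat match goal with
  | |- context [@bform ?R ?d ?A ?u ?v] => generalize (@bform R d A u v)
  | |- context [@fun_of_matrix ?R ?m ?n ?A ?i ?j] =>
      generalize (@fun_of_matrix R m n A i j)
  end; intros.

(* [koszul g D u v] is [u^i v^j Gamma^k_ij] for a metric [g] with derivative [D]
   in the direction [u]; keeping [D] abstract keeps unification fast. *)
Section Koszul.
Context {R : realType} {n : nat}.
Implicit Types (u v w : 'cV[R]_n).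

Definition koszul (g : 'M[R]_n) (D : 'cV[R]_n -> 'M[R]_n) u v : 'cV[R]_n :=
  invmx g *m
  \col_k (2^-1 * (bform (D u) v (delta_mx k 0) + bform (D v) u (delta_mx k 0)
                - bform (D (delta_mx k 0)) u v)).

Variables (g : 'M[R]_n) (D : 'cV[R]_n -> 'M[R]_n).
Hypotheses (g_unit : g \in unitmx) (g_tr : g^T = g).
Hypothesis D_linear : forall (c : R) u v, D (c *: u + v) = c *: D u + D v.
Hypothesis D_sym : forall v u w, bform (D v) u w = bform (D v) w u.

Let DD u v : D (u + v) = D u + D v.
Proof. by rewrite -[u]scale1r D_linear !scale1r. Qed.

Let D0 : D 0 = 0.
Proof. by have /eqP := DD 0 0; rewrite addr0 -subr_eq0 opprD addrA subrr sub0r oppr_eq0 => /eqP. Qed.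

Let DZ (c : R) u : D (c *: u) = c *: D u.
Proof. by rewrite -[c *: u]addr0 D_linear D0 addr0. Qed.

(** The definition tests only against basis vectors; linearity of [D] extends the formula to every
    [w]. *)
Lemma koszulP u v w :
  bform g (koszul g D u v) w
  = 2^-1 * (bform (D u) v w + bform (D v) u w - bform (D w) u v).
Proof.
rewrite /koszul; set c := \col__ _.
have cE i : c i 0 = 2^-1 * (bform (D u) v (delta_mx i 0)
    + bform (D v) u (delta_mx i 0) - bform (D (delta_mx i 0)) u v).
  by rewrite mxE.
clearbody c.
rewrite bform_mulmxl trmx_inv g_tr mulVmx //.
have wE := cV_delta_sum w.
have E1 : bform (D w) u v = \sum_i w i 0 * bform (D (delta_mx i 0)) u v.
  rewrite {1}wE (big_morph D DD D0) bform_mxE mulmx_sumr mulmx_suml summxE.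
  by apply: eq_bigr => i _; rewrite DZ bform_mxE -scalemxAr -scalemxAl mxE.
have E2 A z : bform A z w = \sum_i w i 0 * bform A z (delta_mx i 0).
  by rewrite {1}wE bform_sumr; apply: eq_bigr => i _; rewrite bformZr.
have -> : bform 1%:M c w = \sum_i c i 0 * w i 0.
  by rewrite bform_mxE mulmx1 mxE; apply: eq_bigr => i _; rewrite mxE.
rewrite E1 (E2 _ v) (E2 _ u).
rewrite -big_split -sumrB mulr_sumr /=; apply: eq_bigr => i _.
by rewrite cE; scalars; ring.
Qed.

Lemma koszul_sym u v : koszul g D u v = koszul g D v u.
Proof.
congr (_ *m _); apply/colP => i; rewrite !mxE.
by rewrite (D_sym _ u v) (addrC (bform (D u) _ _)).
Qed.

Lemma koszul_met u v w :
  bform g (koszul g D u v) w + bform g v (koszul g D u w) = bform (D u) v w.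
Proof.
rewrite -(bform_tr g _ v) g_tr !koszulP (D_sym u w v).
by scalars; field.
Qed.

Let met_ext u v : (forall w, bform g u w = bform g v w) -> u = v.
Proof.
move=> H; have E : u^T *m g = v^T *m g.
  apply/rowP => i; have := H (delta_mx i 0).
  by rewrite !bform_mxE -!colE !mxE.
by apply: trmx_inj; rewrite -[u^T](mulmxK g_unit) E mulmxK.
Qed.

Lemma koszul_linear w (c : R) u v :
  koszul g D w (c *: u + v) = c *: koszul g D w u + koszul g D w v.
Proof.
apply: met_ext => z; rewrite !(bformDl, bformZl) !koszulP.
rewrite D_linear bform_addmx bform_scalemx !(bformDl, bformZl, bformDr, bformZr).
by scalars; ring.
Qed.

End Koszul.

Section LocalStructure.
Context {R : realType} {d : nat}.
Local Notation E := 'cV[R]_d.+1.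

Definition twice_differentiable_on (W : normedModType R) (U : set E) (F : E -> W) :=
  forall x, U x -> differentiable F x /\ forall v, differentiable ('D_v F) x.

Record almost_contact_on (S : acdata R d) (U : set E) : Prop := AlmostContactOn {
  ac_open : open U;
  ac_dphi : twice_differentiable_on U (dphi S);
  ac_dxi : twice_differentiable_on U (dxi S);
  ac_deta : twice_differentiable_on U (deta S);
  ac_dmet : twice_differentiable_on U (dmet S);
  ac_sym : forall x u v, U x -> bform (dmet S x) u v = bform (dmet S x) v u;
  ac_pos : forall x u, U x -> u != 0 -> 0 < bform (dmet S x) u u;
  ac_sqr : forall x u, U x ->
    dphi S x *m (dphi S x *m u) = - u + (deta S x *m u) 0 0 *: dxi S x;
  ac_eta_xi : forall x, U x -> (deta S x *m dxi S x) 0 0 = 1;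
  ac_met_phi : forall x u v, U x ->
    bform (dmet S x) (dphi S x *m u) (dphi S x *m v)
    = bform (dmet S x) u v - (deta S x *m u) 0 0 * (deta S x *m v) 0 0
}.

Variables (S : acdata R d) (U : set E).
Hypothesis acU : almost_contact_on S U.
Implicit Types x u v w : E.

Local Notation G x := (bform (dmet S x)).
Local Notation J x u := (dphi S x *m u).
Local Notation et x u := ((deta S x *m u) 0 0).
Local Notation k x := (dxi S x).
Local Notation Gam := (christoffel S).

(** From phi^2 xi = 0 follows 0 = phi^2 (phi xi) = - phi xi + c xi with c = eta (phi xi). So phi xi
    = c xi, and applying phi once more gives c^2 xi = 0. *)
Lemma ac_phi_xi x : U x -> J x (k x) = 0.
Proof.
move=> Ux.
have k2 : J x (J x (k x)) = 0 by rewrite (ac_sqr acU) // (ac_eta_xi acU) // scale1r addNr.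
have k3 := ac_sqr acU (J x (k x)) Ux.
rewrite k2 mulmx0 in k3.
have kE : J x (k x) = et x (J x (k x)) *: k x.
  by move/eqP: k3; rewrite eq_sym addrC subr_eq0 => /eqP.
have : et x (J x (k x)) *: (et x (J x (k x)) *: k x) = 0.
  by rewrite -kE -k2 [in RHS]kE -scalemxAr.
move=> /(congr1 (fun u => et x u)); rewrite !pairZ (ac_eta_xi acU) // mulr1 pair0.
by move/eqP; rewrite mulf_eq0 orbb => /eqP e0; rewrite kE e0 scale0r.
Qed.

(** Compare phi^2 (phi u) with phi (phi^2 u): they differ by eta (phi u) xi, since phi xi = 0. *)
Lemma ac_eta_phi x u : U x -> et x (J x u) = 0.
Proof.
move=> Ux; have := ac_sqr acU (J x u) Ux.
rewrite (ac_sqr acU u) // mulmxDr mulmxN -scalemxAr ac_phi_xi // scaler0 addr0.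
move=> /(congr1 (fun w => w + J x u)); rewrite addNr addrAC addNr add0r.
move=> /(congr1 (fun u => et x u)); rewrite pairZ (ac_eta_xi acU) // mulr1 => <-.
exact: pair0.
Qed.

Lemma ac_met_xi x u : U x -> G x u (k x) = et x u.
Proof.
move=> Ux; have := ac_met_phi acU u (k x) Ux.
by rewrite ac_phi_xi // bform0r (ac_eta_xi acU) // mulr1 => /esym/eqP; rewrite subr_eq0 => /eqP.
Qed.

Lemma ac_met_xil x u : U x -> G x (k x) u = et x u.
Proof. by move=> Ux; rewrite (ac_sym acU) // ac_met_xi. Qed.

Lemma ac_skew x u v : U x -> G x (J x u) v = - G x u (J x v).
Proof.
move=> Ux; have := ac_met_phi acU u (J x v) Ux.
rewrite (ac_sqr acU) // ac_eta_phi // mulr0 subr0 => <-.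
by rewrite !bformE ac_met_xi // ac_eta_phi // mulr0 addr0 opprK.
Qed.

Lemma ac_met_ge0 x u : U x -> 0 <= G x u u.
Proof.
move=> Ux; have [->|u0] := eqVneq u 0; first by rewrite bform0l.
by apply: ltW; exact: (ac_pos acU).
Qed.

Lemma ac_met_eq0 x u : U x -> G x u u = 0 -> u = 0.
Proof.
move=> Ux H; apply/eqP; apply: contraT => u0.
by have := ac_pos acU Ux u0; rewrite H ltxx.
Qed.

Lemma ac_unit x : U x -> dmet S x \in unitmx.
Proof.
move=> Ux; apply: unitmx_mulcV_inj => u gu0.
by apply: (ac_met_eq0 Ux); rewrite bform_mxE -mulmxA gu0 mulmx0 mxE.
Qed.

Lemma ac_met_trmx x : U x -> (dmet S x)^T = dmet S x.
Proof.
by move=> Ux; apply: bform_ext => u v; rewrite bform_tr (ac_sym acU).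
Qed.

Lemma ac_dmet_sym x v u w : U x ->
  bform ('D_v (dmet S) x) u w = bform ('D_v (dmet S) x) w u.
Proof.
move=> Ux; have [dm _] := ac_dmet acU Ux.
have : 'D_v (fun y => (dmet S y)^T) x = 'D_v (dmet S) x.
  apply: near_eq_derive; apply: (nbhs_open_on (ac_open acU) Ux) => y.
  exact: ac_met_trmx.
by rewrite derive_trmx // => H; rewrite -{1}H bform_tr.
Qed.

Lemma dmet_linear x (c : R) u v : U x ->
  'D_(c *: u + v) (dmet S) x = c *: 'D_u (dmet S) x + 'D_v (dmet S) x.
Proof.
by move=> Ux; have [dm _] := ac_dmet acU Ux; rewrite deriveDv // deriveZv.
Qed.

Lemma christoffel_sym x u v : U x -> Gam x u v = Gam x v u.
Proof. by move=> Ux; apply: koszul_sym => *; exact: ac_dmet_sym. Qed.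

Lemma christoffel_met x u v w : U x ->
  G x (Gam x u v) w + G x v (Gam x u w) = bform ('D_u (dmet S) x) v w.
Proof.
move=> Ux; apply: (koszul_met (ac_unit Ux) (ac_met_trmx Ux)) => *.
  exact: dmet_linear.
exact: ac_dmet_sym.
Qed.

Lemma christoffel_linear x w (c : R) u v : U x ->
  Gam x w (c *: u + v) = c *: Gam x w u + Gam x w v.
Proof.
move=> Ux; apply: (koszul_linear (ac_unit Ux) (ac_met_trmx Ux)) => *.
exact: dmet_linear.
Qed.

Lemma christoffelD x u v w : U x -> Gam x w (u + v) = Gam x w u + Gam x w v.
Proof. by move=> Ux; rewrite -[u]scale1r christoffel_linear // !scale1r. Qed.

Lemma christoffel0 x w : U x -> Gam x w 0 = 0.
Proof.
move=> Ux; have /eqP := christoffelD 0 0 w Ux.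
by rewrite addr0 -subr_eq0 opprD addrA subrr sub0r oppr_eq0 => /eqP.
Qed.

Lemma christoffelZ x (c : R) u w : U x -> Gam x w (c *: u) = c *: Gam x w u.
Proof. by move=> Ux; rewrite -[c *: u]addr0 christoffel_linear // christoffel0 // addr0. Qed.

Lemma ac_met_ext x u v : U x -> (forall w, G x u w = G x v w) -> u = v.
Proof.
move=> Ux H; apply/eqP; rewrite -subr_eq0; apply/eqP/(ac_met_eq0 Ux).
by rewrite bformDl bformNl H subrr.
Qed.

Lemma christoffelDl x u v w : U x -> Gam x (u + v) w = Gam x u w + Gam x v w.
Proof. by move=> Ux; rewrite !(christoffel_sym _ w) // christoffelD. Qed.

Lemma christoffelZl x (c : R) u w : U x -> Gam x (c *: u) w = c *: Gam x u w.
Proof. by move=> Ux; rewrite !(christoffel_sym _ w) // christoffelZ. Qed.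

End LocalStructure.

(* The covariant derivatives of the structure tensors at a point, in abstract
   form: [T u v], [N u v] and [X u] stand for (nabla_u phi) v, (nabla_u eta) v
   and nabla_u xi. *)
Record ac_point (R : realType) (V : lmodType R) (G : V -> V -> R) (J : V -> V)
    (et : V -> R) (k : V) (T : V -> V -> V) (N : V -> V -> R) (X : V -> V) :
    Prop := ACPoint {
  pt_GDl : forall u v w, G (u + v) w = G u w + G v w;
  pt_GZl : forall (c : R) u w, G (c *: u) w = c * G u w;
  pt_Gsym : forall u v, G u v = G v u;
  pt_Geq0 : forall u, G u u = 0 -> u = 0;
  pt_JD : forall u v, J (u + v) = J u + J v;
  pt_JZ : forall (c : R) u, J (c *: u) = c *: J u;
  pt_JJ : forall u, J (J u) = - u + et u *: k;
  pt_etk : et k = 1;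
  pt_Jk : J k = 0;
  pt_etJ : forall u, et (J u) = 0;
  pt_Gk : forall u, G u k = et u;
  pt_skew : forall u v, G (J u) v = - G u (J v);
  pt_TZr : forall (c : R) u v, T u (c *: v) = c *: T u v;
  pt_XD : forall u v, X (u + v) = X u + X v;
  pt_XZ : forall (c : R) u, X (c *: u) = c *: X u;
  pt_Tskew : forall u v w, G (T u v) w = - G v (T u w);
  pt_etT : forall u v, et (T u v) = - N u (J v);
  pt_Tk : forall u, T u k = - J (X u);
  pt_NX : forall u v, N u v = G (X u) v;
  pt_Nk : forall u, N u k = 0;
  pt_TJ : forall u v, T u (J v) + J (T u v) = N u v *: k + et v *: X u
}.

Section CovariantDerivatives.
Context {R : realType} {d : nat} (S : acdata R d).
Local Notation E := 'cV[R]_d.+1.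
Implicit Types x u v w : E.

Definition nabla_xi x u : E := 'D_u (dxi S) x + christoffel S x u (dxi S x).
Definition nabla_eta x u v : R :=
  ('D_u (deta S) x *m v) 0 0 - (deta S x *m christoffel S x u v) 0 0.
Definition nabla_tphi x u v : E :=
  'D_u (dphi S) x *m v + christoffel S x u (dphi S x *m v)
  - dphi S x *m christoffel S x u v.
End CovariantDerivatives.

(** * From Leibniz identities in a chart to covariant derivatives *)

Section AbstractPoint.
Context {R : realType} {n : nat}.
Local Notation E := 'cV[R]_n.
Variables (g Dg p Dp : 'M[R]_n) (k Dk : E) (e De : 'rV[R]_n) (Gam : E -> E).
Implicit Types u v w : E.
Hypothesis g_sym : forall u v, bform g u v = bform g v u.
Hypothesis GamD : forall v w, Gam (v + w) = Gam v + Gam w.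
Hypothesis GamZ : forall (c : R) v, Gam (c *: v) = c *: Gam v.
Hypothesis Gam_met : forall v w, bform g (Gam v) w + bform g v (Gam w) = bform Dg v w.
Hypothesis p_sqr : forall u, p *m (p *m u) = - u + (e *m u) 0 0 *: k.
Hypothesis e_k : (e *m k) 0 0 = 1.
Hypothesis p_k : p *m k = 0.
Hypothesis e_p : forall u, (e *m (p *m u)) 0 0 = 0.
Hypothesis g_k : forall u, bform g u k = (e *m u) 0 0.
Hypothesis p_skew : forall u v, bform g (p *m u) v = - bform g u (p *m v).
Hypothesis D_sqr : forall u, Dp *m (p *m u) + p *m (Dp *m u)
  = (e *m u) 0 0 *: Dk + (De *m u) 0 0 *: k.
Hypothesis D_ep : forall u, (De *m (p *m u)) 0 0 + (e *m (Dp *m u)) 0 0 = 0.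
Hypothesis D_pk : Dp *m k + p *m Dk = 0.
Hypothesis D_ek : (De *m k) 0 0 + (e *m Dk) 0 0 = 0.
Hypothesis D_gk : forall u, (De *m u) 0 0 = bform g u Dk + bform Dg u k.
Hypothesis D_skew : forall u v, bform g (Dp *m u) v + bform g u (Dp *m v)
  + bform Dg (p *m u) v + bform Dg u (p *m v) = 0.

Let X := Dk + Gam k.
Let N v := (De *m v) 0 0 - (e *m Gam v) 0 0.
Let T v := Dp *m v + Gam (p *m v) - p *m Gam v.

Lemma abs_Tskew v w : bform g (T v) w = - bform g v (T w).
Proof.
rewrite /T !bformE p_skew.
have := Gam_met v (p *m w); have := Gam_met (p *m v) w; have := D_skew v w.
rewrite p_skew; scalars; lra.
Qed.

Lemma abs_etT v : (e *m T v) 0 0 = - N (p *m v).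
Proof.
rewrite /T /N !(pairD, pairN) e_p.
by have := D_ep v; scalars; lra.
Qed.

Lemma abs_Tk : T k = - (p *m X).
Proof.
rewrite /T /X p_k mulmxDr opprD; congr (_ - _).
have -> : Gam 0 = 0 by rewrite -(scale0r 0) GamZ !scale0r.
by rewrite addr0; apply/eqP; rewrite -addr_eq0 D_pk.
Qed.

Lemma abs_NX v : N v = bform g X v.
Proof.
rewrite /N /X D_gk bformDl -(Gam_met v k) g_k (g_sym Dk) (g_sym (Gam k)).
by scalars; ring.
Qed.

(** This is g (nabla_u xi, xi) = 0. By [abs_NX] the left side is the eta-component of nabla_u xi,
    which is its own opposite after differentiating eta (xi) = 1. *)
Lemma abs_Nk : N k = 0.
Proof.
have : N k = - N k; last by scalars; lra.
rewrite {1}abs_NX g_k /X /N pairD.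
by have := D_ek; scalars; lra.
Qed.

Lemma abs_TJ v : T (p *m v) + p *m T v = N v *: k + (e *m v) 0 0 *: X.
Proof.
rewrite /T !(mulmxDr, mulmxN) !p_sqr GamD GamZ.
have -> : Gam (- v) = - Gam v by rewrite -scaleN1r GamZ scaleN1r.
have := D_sqr v; set a := _ *m _; set b := p *m (Dp *m v) => H.
have -> : a = (e *m v) 0 0 *: Dk + (De *m v) 0 0 *: k - b by rewrite -H addrK.
rewrite /N /X scalerDr scalerBl.
set c := p *m Gam (p *m v); set z := Gam v; set s := _ *: Gam k.
set s1 := _ *: Dk; set s2 := (De *m v) 0 0 *: k; set s3 := _ *: k.
clearbody a b c z s s1 s2 s3.

apply/matrixP => i j; rewrite !mxE.
move: (a i j) (b i j) (c i j) (z i j) (s i j) (s1 i j) (s2 i j) (s3 i j) => *.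
by ring.
Qed.

End AbstractPoint.

Lemma bform_Dskew (R : realType) n (g Dg p Dp : 'M[R]_n) :
  Dp^T *m g + p^T *m Dg = - (Dg *m p + g *m Dp) ->
  forall v w, bform g (Dp *m v) w + bform g v (Dp *m w)
    + bform Dg (p *m v) w + bform Dg v (p *m w) = 0.
Proof.
move=> H v w; rewrite !bform_mulmxl !bform_mulmxr.
have := congr1 (fun A : 'M[R]_n => bform A v w) H.
by rewrite /= bform_oppmx !bform_addmx; scalars; lra.
Qed.

(** * The structure identities differentiated in a chart *)

Section LocalPoint.
Context {R : realType} {d : nat} (S : acdata R d) (U : set 'cV[R]_d.+1).
Local Notation E := 'cV[R]_d.+1.
Hypothesis acU : almost_contact_on S U.
Implicit Types x u v w : E.

Lemma near_on (P : E -> Prop) x : U x -> (forall y, U y -> P y) -> \near x, P x.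
Proof. exact: (nbhs_open_on (ac_open acU)). Qed.

Lemma derive_on (W : normedModType R) (f h : E -> W) x u : U x ->
  (forall y, U y -> f y = h y) -> 'D_u f x = 'D_u h x.
Proof. by move=> Ux H; apply: near_eq_derive; exact: near_on. Qed.

Lemma ac_Dsqr x u : U x ->
  'D_u (dphi S) x *m dphi S x + dphi S x *m 'D_u (dphi S) x
  = 'D_u (dxi S) x *m deta S x + dxi S x *m 'D_u (deta S) x.
Proof.
move=> Ux; have [dp _] := ac_dphi acU Ux.
have [dk _] := ac_dxi acU Ux; have [de _] := ac_deta acU Ux.
have H y : U y -> dphi S y *m dphi S y = - 1%:M + dxi S y *m deta S y.
  move=> Uy; apply: mulcV_ext => v; rewrite -mulmxA (ac_sqr acU) //.
  by rewrite mulmxDl mulNmx mul1mx -mulmxA mx11_scale.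
apply: etrans (esym (derive_mulmx u dp dp)) _.
apply: etrans (derive_on u Ux H) _.
apply: etrans (derive_cstD _ _ (differentiable_mulmx dk de)) _.
exact: derive_mulmx.
Qed.

Lemma ac_Dep x u : U x ->
  'D_u (deta S) x *m dphi S x + deta S x *m 'D_u (dphi S) x = 0.
Proof.
move=> Ux; have [dp _] := ac_dphi acU Ux; have [de _] := ac_deta acU Ux.
apply: etrans (esym (derive_mulmx u de dp)) (etrans _ (derive_cst (0 : 'rV_d.+1) x u)).
apply: derive_on => // y Uy; apply: mulcV_ext => v; rewrite mul0mx.
by rewrite [LHS]mx11_scalar -mulmxA (ac_eta_phi acU) // raddf0.
Qed.

Lemma ac_Dpk x u : U x ->
  'D_u (dphi S) x *m dxi S x + dphi S x *m 'D_u (dxi S) x = 0.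
Proof.
move=> Ux; have [dp _] := ac_dphi acU Ux; have [dk _] := ac_dxi acU Ux.
apply: etrans (esym (derive_mulmx u dp dk)) (etrans _ (derive_cst (0 : E) x u)).
by apply: derive_on => // y Uy; apply: (ac_phi_xi acU).
Qed.

Lemma ac_Dek x u : U x ->
  'D_u (deta S) x *m dxi S x + deta S x *m 'D_u (dxi S) x = 0.
Proof.
move=> Ux; have [de _] := ac_deta acU Ux; have [dk _] := ac_dxi acU Ux.
apply: etrans (esym (derive_mulmx u de dk)) (etrans _ (derive_cst (1%:M : 'M[R]_1) x u)).
by apply: derive_on => // y Uy; rewrite [LHS]mx11_scalar (ac_eta_xi acU).
Qed.

Lemma ac_eta_met x : U x -> deta S x = (dxi S x)^T *m dmet S x.
Proof.
move=> Ux; apply: mulcV_ext => v; rewrite [LHS]mx11_scalar -(ac_met_xil acU) //.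
by rewrite bform_mxE -mx11_scalar.
Qed.

Lemma ac_Dgk x u : U x ->
  'D_u (deta S) x = ('D_u (dxi S) x)^T *m dmet S x + (dxi S x)^T *m 'D_u (dmet S) x.
Proof.
move=> Ux; have [dm _] := ac_dmet acU Ux; have [dk _] := ac_dxi acU Ux.
apply: etrans (derive_on u Ux ac_eta_met) _.
apply: etrans (derive_mulmx u (differentiable_trmx dk) dm) _.
by rewrite (derive_trmx u dk).
Qed.

Lemma ac_skew_mx x : U x ->
  (dphi S x)^T *m dmet S x = - (dmet S x *m dphi S x).
Proof.
move=> Ux; apply: bform_ext => v w.
by rewrite bform_oppmx -bform_mulmxl -bform_mulmxr (ac_skew acU).
Qed.

Lemma ac_Dskew x u : U x ->
  ('D_u (dphi S) x)^T *m dmet S x + (dphi S x)^T *m 'D_u (dmet S) x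
  = - ('D_u (dmet S) x *m dphi S x + dmet S x *m 'D_u (dphi S) x).
Proof.
move=> Ux; have [dm _] := ac_dmet acU Ux; have [dp _] := ac_dphi acU Ux.
rewrite -(derive_trmx u dp).
apply: etrans (esym (derive_mulmx u (differentiable_trmx dp) dm)) _.
apply: etrans (derive_on u Ux ac_skew_mx) _.
apply: etrans (derive_fopp _ (differentiable_mulmx dm dp)) _.
by rewrite (derive_mulmx u dm dp).
Qed.

Lemma ac_point_at x : U x ->
  ac_point (bform (dmet S x)) (mulmx (dphi S x)) (fun u => (deta S x *m u) 0 0)
    (dxi S x) (nabla_tphi S x) (nabla_eta S x) (nabla_xi S x).
Proof.
move=> Ux.
have [dm _] := ac_dmet acU Ux; have [dp _] := ac_dphi acU Ux.
have [dk _] := ac_dxi acU Ux; have [de _] := ac_deta acU Ux.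
have Gsym u v := ac_sym acU u v Ux.
have Jk := ac_phi_xi acU Ux.
have etJ u := ac_eta_phi acU u Ux.
have Gk u := ac_met_xi acU u Ux.
have skew u v := ac_skew acU u v Ux.
have Gm u v w := christoffel_met acU u v w Ux.
have GD u v w := christoffelD acU v w u Ux.
have GZ u (c : R) v := christoffelZ acU c v u Ux.
have dsqr u v : 'D_u (dphi S) x *m (dphi S x *m v) + dphi S x *m ('D_u (dphi S) x *m v)
  = (deta S x *m v) 0 0 *: 'D_u (dxi S) x + ('D_u (deta S) x *m v) 0 0 *: dxi S x.
  by rewrite !mulmxA -mulmxDl ac_Dsqr // mulmxDl -!mulmxA !mx11_scale.
have dep u v : ('D_u (deta S) x *m (dphi S x *m v)) 0 0
    + (deta S x *m ('D_u (dphi S) x *m v)) 0 0 = 0.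
  have := congr1 (fun A : 'rV[R]_d.+1 => (A *m v) 0 0) (ac_Dep u Ux).
  by rewrite /= mulmxDl mul0mx [X in X = _ -> _]mxE [X in _ = X -> _]mxE -!mulmxA.
have dek u : ('D_u (deta S) x *m dxi S x) 0 0 + (deta S x *m 'D_u (dxi S) x) 0 0 = 0.
  by have := congr1 (fun A : 'M[R]_1 => A 0 0) (ac_Dek u Ux); rewrite /= [X in X = _ -> _]mxE [X in _ = X -> _]mxE.
have dgk u v : ('D_u (deta S) x *m v) 0 0
    = bform (dmet S x) v ('D_u (dxi S) x) + bform ('D_u (dmet S) x) v (dxi S x).
  rewrite ac_Dgk // mulmxDl mxE Gsym (ac_dmet_sym acU u v (dxi S x) Ux).
  by rewrite !bform_mxE.
have dskew u := bform_Dskew (ac_Dskew u Ux).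
split.
- by move=> u v w; rewrite bformDl.
- by move=> c u w; rewrite bformZl.
- exact: Gsym.
- by move=> u; exact: (ac_met_eq0 acU).
- by move=> u v; rewrite mulmxDr.
- by move=> c u; rewrite scalemxAr.
- by move=> u; exact: (ac_sqr acU).
- exact: (ac_eta_xi acU).
- exact: Jk.
- exact: etJ.
- exact: Gk.
- exact: skew.
- move=> c u v; rewrite /nabla_tphi -!scalemxAr !GZ -scalemxAr.
  by rewrite -scalerDr -scalerBr.
- move=> u v; rewrite /nabla_xi deriveDv // (christoffelDl acU) //.
  exact: addrACA.
- by move=> c u; rewrite /nabla_xi deriveZv // (christoffelZl acU) // scalerDr.
- move=> u; exact: (abs_Tskew (Gm u) skew (dskew u)).
- move=> u; exact: (abs_etT (christoffel S x u) etJ (dep u)).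
- move=> u; apply: (abs_Tk (GZ u) Jk); exact: ac_Dpk.
- move=> u; exact: (abs_NX Gsym (Gm u) Gk (dgk u)).
- move=> u; exact: (abs_Nk Gsym (Gm u) Gk (dek u) (dgk u)).
- move=> u; exact: (abs_TJ (GD u) (GZ u) (fun v => ac_sqr acU v Ux) (dsqr u)).
Qed.

End LocalPoint.

(** * Pointwise algebra *)

Section PointAlgebra.
Context {R : realType} {V : lmodType R} {G : V -> V -> R} {J : V -> V}
  {et : V -> R} {k : V} {T : V -> V -> V} {N : V -> V -> R} {X : V -> V}.
Hypothesis P : ac_point G J et k T N X.
Implicit Types u v w : V.

Lemma pt_GDr u v w : G w (u + v) = G w u + G w v.
Proof. by rewrite !(pt_Gsym P w) (pt_GDl P). Qed.
Lemma pt_GZr (c : R) u w : G w (c *: u) = c * G w u.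
Proof. by rewrite !(pt_Gsym P w) (pt_GZl P). Qed.
Lemma pt_GNr u w : G w (- u) = - G w u.
Proof. by rewrite -scaleN1r pt_GZr mulN1r. Qed.
Lemma pt_GNl u w : G (- u) w = - G u w.
Proof. by rewrite -scaleN1r (pt_GZl P) mulN1r. Qed.
Lemma pt_G0l w : G 0 w = 0.
Proof. by rewrite -(scale0r 0) (pt_GZl P) mul0r. Qed.

Lemma pt_etD u v : et (u + v) = et u + et v.
Proof. by rewrite -!(pt_Gk P) (pt_GDl P). Qed.
Lemma pt_etZ (c : R) u : et (c *: u) = c * et u.
Proof. by rewrite -!(pt_Gk P) (pt_GZl P). Qed.
Lemma pt_JN u : J (- u) = - J u.
Proof. by rewrite -scaleN1r (pt_JZ P) scaleN1r. Qed.

Lemma pt_NDr u v w : N w (u + v) = N w u + N w v.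
Proof. by rewrite !(pt_NX P) pt_GDr. Qed.
Lemma pt_NZr (c : R) u w : N w (c *: u) = c * N w u.
Proof. by rewrite !(pt_NX P) pt_GZr. Qed.
Lemma pt_NNr u w : N w (- u) = - N w u.
Proof. by rewrite !(pt_NX P) pt_GNr. Qed.
Lemma pt_NDl u v w : N (u + v) w = N u w + N v w.
Proof. by rewrite !(pt_NX P) (pt_XD P) (pt_GDl P). Qed.
Lemma pt_NZl (c : R) u w : N (c *: u) w = c * N u w.
Proof. by rewrite !(pt_NX P) (pt_XZ P) (pt_GZl P). Qed.
Lemma pt_GJ0 u : G u (J u) = 0.
Proof.
by have := pt_skew P u u; rewrite (pt_Gsym P (J u)); move: (G u _) => a ?; lra.
Qed.

Lemma pt_GJJ u v : G (J u) (J v) = G u v - et u * et v.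
Proof.
rewrite (pt_skew P) (pt_JJ P) pt_GDr pt_GNr pt_GZr (pt_Gk P).
by ring.
Qed.

Lemma pt_NJJ u v : N u (J (J v)) = - N u v.
Proof. by rewrite (pt_JJ P) pt_NDr pt_NNr pt_NZr (pt_Nk P) mulr0 addr0. Qed.

Lemma pt_etX u : et (X u) = 0.
Proof. by rewrite -(pt_Gk P) -(pt_NX P) (pt_Nk P). Qed.

Lemma pt_JXeq0 u : J (X u) = 0 -> X u = 0.
Proof.
move=> H; have := pt_JJ P (X u); rewrite H pt_etX scale0r addr0.
by rewrite -(scale0r 0) (pt_JZ P) !scale0r => /eqP; rewrite eq_sym oppr_eq0 => /eqP.
Qed.

(** The right side is 2 d eta (phi u, u). This is the bridge from conditions on nabla phi to the
    nonvanishing of d eta. *)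
Lemma pt_etP u : et (T u u + T (J u) (J u)) = N (J u) u - N u (J u).
Proof.
by rewrite pt_etD !(pt_etT P) pt_NJJ opprK addrC.
Qed.

(** nabla_xi phi is skew and, by [pt_TJ], anticommutes with phi up to terms orthogonal to [v]. Both
    facts express the two pairings through g (phi v, (nabla_xi phi) v), which must then vanish. *)
Lemma pt_GTk v : et v = 0 -> G v (T k (J v)) = 0.
Proof.
move=> ev; have H1 := pt_Tskew P k (J v) v.
have := congr1 (G v) (pt_TJ P k v).
rewrite pt_GDr pt_GDr !pt_GZr (pt_Gk P) ev mulr0 mul0r addr0.
have := pt_skew P v (T k v); rewrite (pt_Gsym P v (T k (J v))) H1.
move: (G (J v) _) (G v _) => a b *; lra.
Qed.

(** The left side is d Omega (v, phi v, xi). Thus d Omega controls the trace of nabla eta on each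
    plane spanned by v and phi v; this serves contact sources and almost Kenmotsu targets alike. *)
Lemma pt_dOmega v : et v = 0 ->
  G (J v) (T v k) + G k (T (J v) v) + G v (T k (J v)) = - (N v v + N (J v) (J v)).
Proof.
move=> ev; rewrite pt_GTk // (pt_Tk P) pt_GNr pt_GJJ ev mul0r subr0.
by rewrite (pt_Gsym P k) (pt_Gk P) (pt_etT P) (pt_NX P v v) (pt_Gsym P v); ring.
Qed.

(** It reads 2 d eta (phi u, u) = c |u|^2 on D, the form in which the first-part source classes give
    a nonzero d eta. *)
Definition contact_at := exists2 c : R, c != 0 &
  forall u, et u = 0 -> N (J u) u - N u (J u) = c * G u u.

Lemma contact_atP : contact_at ->
  forall u, et u = 0 -> u != 0 -> N (J u) u != N u (J u).
Proof.
move=> [c c0 H] u eu u0; rewrite -subr_eq0 H // mulf_neq0 //.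
by apply: contraNneq u0 => /(pt_Geq0 P) ->.
Qed.

Lemma contact_at_contact (a : R) : a != 0 ->
  (forall u v, N u v - N v u = 2 * (a * G u (J v))) -> contact_at.
Proof.
move=> a0 H; exists (2 * a); first by rewrite mulf_neq0 // pnatr_eq0.
by move=> u eu; rewrite H pt_GJJ eu; ring.
Qed.

Lemma contact_at_opP :
  (forall u, et u = 0 -> T u u + T (J u) (J u) = (2 * G u u) *: k) -> contact_at.
Proof.
move=> H; exists 2; first by rewrite pnatr_eq0.
by move=> u eu; rewrite -pt_etP H // pt_etZ (pt_etk P) mulr1.
Qed.

Lemma contact_at_etT (a : R) : a != 0 ->
  (forall u, et u = 0 -> et (T u u) = a * G u u) -> contact_at.
Proof.
move=> a0 H; exists (2 * a); first by rewrite mulf_neq0 // pnatr_eq0.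
move=> u eu; rewrite -pt_etP pt_etD !H ?(pt_etJ P) // pt_GJJ eu.
by ring.
Qed.

(** The first clause is nabla_xi xi = 0. The second, summed over an adapted frame, makes xi
    divergence free; it is stated plane by plane because the classes treated here give it in that
    form. *)
Definition coclosed_at :=
  (forall u, N k u = 0) /\ (forall u, et u = 0 -> N u u + N (J u) (J u) = 0).

(** Omega (xi, .) = 0 and (nabla_u eta) xi = 0 give the first clause; [pt_dOmega] with Omega closed
    gives the second. *)
Lemma coclosed_at_contact (a : R) :
  (forall u v, N u v - N v u = 2 * (a * G u (J v))) ->
  (forall u v w, G v (T u w) + G w (T v u) + G u (T w v) = 0) -> coclosed_at.
Proof.
move=> H dO; split=> u.
  have := H k u; rewrite (pt_Nk P) (pt_Gsym P) (pt_Gk P) (pt_etJ P).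
  by rewrite !mulr0 subr0.
by move=> eu; apply/eqP; rewrite -oppr_eq0 -pt_dOmega // dO.
Qed.

(** Taking v = xi gives phi (nabla_u xi) = u + hh u on D, hence (nabla_u eta) u = g (hh u, phi u).
    The contributions of u and phi u cancel because hh anticommutes with phi modulo xi. *)
Lemma coclosed_at_quasi_contact (h : V -> V) :
  (forall u, h u = 2^-1 *: (T k u - X (J u) + J (X u))) ->
  (forall u v, T u v + T (J u) (J v)
    = (2 * G u v) *: k - et v *: (u + et u *: k + h u)) -> coclosed_at.
Proof.
move=> hE H.
have J0 : J 0 = 0 by rewrite -(scale0r 0) (pt_JZ P) !scale0r.
have X0 : X 0 = 0 by rewrite -(scale0r 0) (pt_XZ P) !scale0r.
have T0 u : T u 0 = 0 by rewrite -(scale0r 0) (pt_TZr P) !scale0r.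
have HX u : - J (X u) = (2 * et u) *: k - (u + et u *: k + h u).
  have := H u k; rewrite (pt_Jk P) T0 addr0 (pt_Tk P) => ->.
  by rewrite (pt_Gk P) (pt_etk P) scale1r.
split=> u.
  have hk : h k = 0.
    rewrite hE (pt_Jk P) X0 subr0 (pt_Tk P) addNr.
    by rewrite scaler0.
  have := HX k; rewrite hk (pt_etk P) addr0 mulr1 scale1r scaler_nat mulr2n.
  rewrite subrr => /eqP.
  by rewrite oppr_eq0 => /eqP/pt_JXeq0; rewrite (pt_NX P) => ->; rewrite pt_G0l.
move=> eu.
have NE v : et v = 0 -> N v v = G (h v) (J v).
  move=> ev; have := congr1 (G ^~ (J v)) (HX v).
  rewrite /= ev mulr0 !scale0r addr0 sub0r !pt_GNl (pt_GDl P).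
  rewrite pt_GJJ ev mulr0 subr0 -(pt_NX P) => /oppr_inj ->.
  rewrite pt_GJ0.
  by rewrite add0r.
rewrite !NE ?(pt_etJ P) // (pt_JJ P) eu scale0r addr0 pt_GNr.
have -> : G (h u) (J u) = - G (J (h u)) u by rewrite (pt_skew P) opprK.
rewrite -opprD -(pt_GDl P); apply/eqP; rewrite oppr_eq0; apply/eqP.
(* Anticommutation comes from phi^2 = -1 + eta xi differentiated along xi; the remainder is a
   multiple of xi, orthogonal to u. *)
have -> : J (h u) + h (J u) = 2^-1 *: (N k u *: k).
  rewrite !hE (pt_JZ P) -scalerDr; congr (_ *: _).
  rewrite !(pt_JD P) pt_JN !(pt_JJ P) pt_etX eu !scale0r !addr0.
  have := pt_TJ P k u; rewrite eu scale0r addr0 => <-.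
  have -> : X (- u) = - X u by rewrite -scaleN1r (pt_XZ P) scaleN1r.
  rewrite opprK; set a := J (T k u); set b := J (X _); set c := T k _; set e := X u.
  rewrite [c + e + b]addrC [c + e]addrC (addrA b) (addrA _ (b + e)).
  by rewrite -(addrA a) -opprD subrK addrC.
by rewrite !(pt_GZl P) (pt_Gsym P) (pt_Gk P) eu !mulr0.
Qed.

(** Take v = xi and pair with phi u: the left side becomes - (nabla_u eta) u and the term nabla_{phi
    u} xi becomes (nabla_{phi u} eta) (phi u). *)
Lemma coclosed_at_quasi_K :
  (forall u v, T u v + T (J u) (J v)
    = (2 * G u v) *: k - (2 * et v) *: u + et v *: X (J u)) -> coclosed_at.
Proof.
move=> H.
have X0 : X 0 = 0 by rewrite -(scale0r 0) (pt_XZ P) !scale0r.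
have T0 u : T u 0 = 0 by rewrite -(scale0r 0) (pt_TZr P) !scale0r.
have HX u : - J (X u) = (2 * et u) *: k - 2 *: u + X (J u).
  have := H u k; rewrite (pt_Jk P) T0 addr0 (pt_Tk P) => ->.
  by rewrite (pt_Gk P) (pt_etk P) scale1r mulr1.
split=> u.
  have := HX k; rewrite (pt_Jk P) X0 (pt_etk P) mulr1 subrr addr0 => /eqP.
  by rewrite oppr_eq0 => /eqP/pt_JXeq0; rewrite (pt_NX P) => ->; rewrite pt_G0l.
move=> eu; have := congr1 (G ^~ (J u)) (HX u).
rewrite /= eu mulr0 !scale0r sub0r (pt_GDl P) !pt_GNl (pt_GZl P) pt_GJJ.
rewrite eu mulr0 subr0 -!(pt_NX P).
rewrite pt_GJ0.
by move: (N u u) (N _ _) => a b H'; lra.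
Qed.

(** Q (xi, xi) = 0 gives nabla_xi xi = 0. Pairing Q (v, xi) with phi v and using [pt_GTk] gives
    (nabla_v eta) v = 0 for each v in D, more than the sum over v and phi v. *)
Lemma coclosed_at_nearly_Sasakian (a : R) :
  (forall u v, T u v + T v u
    = a *: ((2 * G u v) *: k - et v *: u - et u *: v)) -> coclosed_at.
Proof.
move=> H; split=> u.
  have := H k k; rewrite (pt_Gk P) (pt_etk P) mulr1 !scale1r.
  rewrite scaler_nat mulr2n addrK subrr scaler0 (pt_Tk P).
  rewrite -opprD -mulr2n => /eqP; rewrite oppr_eq0 -scaler_nat scaler_eq0 pnatr_eq0.
  by move=> /= /eqP/pt_JXeq0; rewrite (pt_NX P) => ->; rewrite pt_G0l.
have NE v : et v = 0 -> N v v = 0.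
  move=> ev; have := congr1 (G ^~ (J v)) (H v k).
  rewrite /= (pt_Tk P) (pt_Gk P) (pt_etk P) ev mulr0 !scale0r subr0 sub0r scale1r.
  rewrite (pt_GDl P) pt_GNl pt_GJJ ev mulr0 subr0 -(pt_NX P) (pt_GZl P) pt_GNl.
  rewrite (pt_Tskew P) pt_GTk // oppr0 addr0.
  rewrite pt_GJ0.
  by rewrite oppr0 mulr0 => /eqP; rewrite oppr_eq0 => /eqP.
by move=> eu; rewrite !NE ?(pt_etJ P) // addr0.
Qed.

End PointAlgebra.

Section SmoothOn.
Context {R : realType} {V W : normedModType R}.

Lemma smooth_on_cst (U : set V) (c : W) : smooth_on U (fun=> c).
Proof.
move=> q; elim: q c => [|q IH] c; split => //; try by move=> x _; exact: differentiable_cst.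
move=> v; have -> : 'D_v (fun=> c) = (fun=> 0) :> (V -> W); last exact: IH.
by apply/funext => x; exact: derive_cst.
Qed.
End SmoothOn.

Lemma smooth_on_twice (R : realType) d (W : normedModType R) (U : set 'cV[R]_d.+1)
  (f : 'cV[R]_d.+1 -> W) : smooth_on U f -> twice_differentiable_on U f.
Proof.
move=> /(_ 1%N) [df ddf] x Ux; split; first exact: df.
by move=> v; have [H _] := ddf v; exact: H.
Qed.

(* The expressions are tensorial, so that constant fields suffice. *)
Section ConstantFields.
Context {R : realType} {d : nat} (S : acdata R d) (U : set 'cV[R]_d.+1).
Local Notation E := 'cV[R]_d.+1.
Hypothesis acU : almost_contact_on S U.
Implicit Types (x u v w : E) (A B : E -> E).

Local Notation J x := (mulmx (dphi S x)).
Local Notation T x := (nabla_tphi S x).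
Local Notation N x := (nabla_eta S x).

(** The terms containing a derivative of [B] cancel. [B] may vary because P has the field phi Y as
    an argument, which is not constant even for constant Y. *)
Lemma nabla_phiE A B x : U x -> differentiable B x ->
  nabla_phi S A B x = T x (A x) (B x).
Proof.
move=> Ux dB; have [dp _] := ac_dphi acU Ux.
have E1 : 'D_(A x) (phi S B) x = _ := derive_mulmx (A x) dp dB.
rewrite /nabla_phi /nabla E1 /nabla_tphi /phi mulmxDr.
set a := 'D_(A x) (dphi S) x *m B x; set b := dphi S x *m 'D_(A x) B x.
set c := christoffel _ _ _ _; set e := dphi S x *m christoffel _ _ _ _.
by rewrite opprD (addrAC a b c) addrA addrK.
Qed.

Lemma differentiable_phi B x : U x -> differentiable B x ->
  differentiable (phi S B) x.
Proof.
by move=> Ux dB; have [dp _] := ac_dphi acU Ux; exact: differentiable_mulmx.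
Qed.

Lemma opPE x u v : U x ->
  opP S (fun=> u) (fun=> v) x = T x u v + T x (J x u) (J x v).
Proof.
move=> Ux; have dc w := differentiable_cst w x.
rewrite /opP (nabla_phiE _ Ux (dc v)).
by rewrite (nabla_phiE _ Ux (differentiable_phi Ux (dc v))).
Qed.

Lemma opQE x u v : U x -> opQ S (fun=> u) (fun=> v) x = T x u v + T x v u.
Proof.
move=> Ux; have dc w := differentiable_cst w x.
by rewrite /opQ (nabla_phiE _ Ux (dc v)) (nabla_phiE _ Ux (dc u)).
Qed.

Lemma derive_eta x u v : U x ->
  'D_u (eta S (fun=> v)) x = ('D_u (deta S) x *m v) 0 0.
Proof.
move=> Ux; have [de _] := ac_deta acU Ux.
have dev : differentiable (fun y => deta S y *m v) x.
  exact: (differentiable_mulmx de (differentiable_cst v x)).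
apply: etrans (derive_entry u 0 0 dev) _.
have := derive_mulmx u de (differentiable_cst v x).
by rewrite derive_cst mulmx0 addr0 => <-.
Qed.

Lemma bracket_cst x u v : bracket (fun=> u) (fun=> v) x = 0 :> E.
Proof. by rewrite /bracket !derive_cst subrr. Qed.

Lemma d_etaE x u v : U x ->
  d_eta S (fun=> u) (fun=> v) x = 2^-1 * (N x u v - N x v u).
Proof.
move=> Ux; rewrite /d_eta !derive_eta // /eta bracket_cst pair0 subr0.
rewrite /nabla_eta (christoffel_sym acU v u Ux); congr (_ * _).
by scalars; ring.
Qed.

Lemma derive_phi x u v : U x ->
  'D_u (phi S (fun=> v)) x = 'D_u (dphi S) x *m v.
Proof.
move=> Ux; have [dp _] := ac_dphi acU Ux.
apply: etrans (derive_mulmx u dp (differentiable_cst v x)) _.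
by rewrite derive_cst mulmx0 addr0.
Qed.

(** Torsion-freeness: the brackets in the Lie derivative are replaced by nabla, the symmetric
    Christoffel terms cancelling. *)
Lemma hhE x u : U x -> hh S (fun=> u) x
  = 2^-1 *: (T x (dxi S x) u - nabla_xi S x (J x u) + J x (nabla_xi S x u)).
Proof.
move=> Ux; congr (_ *: _); rewrite /bracket /phi derive_cst sub0r.
rewrite /nabla_tphi /nabla_xi /xi mulmxN opprK mulmxDr.
rewrite (derive_phi _ _ Ux) (christoffel_sym acU (J x u) (dxi S x) Ux).
rewrite (christoffel_sym acU u (dxi S x) Ux).
set a := 'D__ _ _ *m u; set b := 'D_(dphi S x *m u) _ x; set c := christoffel _ _ _ _.
set q := dphi S x *m christoffel _ _ _ _; set p := dphi S x *m 'D_u _ x.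
clearbody a b c q p; apply/matrixP => i j; rewrite !mxE.
move: (a i j) (b i j) (c i j) (q i j) (p i j) => *.
by ring.
Qed.

Lemma derive_met x u (A B : E -> E) : U x -> differentiable A x -> differentiable B x ->
  'D_u (fun y => bform (dmet S y) (A y) (B y)) x =
  bform ('D_u (dmet S) x) (A x) (B x) + bform (dmet S x) ('D_u A x) (B x)
   + bform (dmet S x) (A x) ('D_u B x).
Proof.
move=> Ux dA dB; have [dm _] := ac_dmet acU Ux.
have d1 := differentiable_mulmx (differentiable_trmx dA) dm.
have d2 := differentiable_mulmx d1 dB.
apply: etrans (derive_entry u 0 0 d2) _.
have E1 := derive_mulmx u (differentiable_trmx dA) dm.
have E2 := derive_mulmx u d1 dB.
rewrite E2 E1 (derive_trmx u dA) mulmxDl mxE [X in X + _ = _]mxE.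
rewrite -!bform_mxE; congr (_ + _); exact: addrC.
Qed.

Lemma nabla_OmegaE x u v w : U x ->
  nabla_Omega S (fun=> u) (fun=> v) (fun=> w) x = bform (dmet S x) v (T x u w).
Proof.
move=> Ux; have dc (z : E) := differentiable_cst z x.
have D := derive_met u Ux (dc v) (differentiable_phi Ux (dc w)).
rewrite /nabla_Omega; apply: etrans (congr1 (fun a => a - _ - _) D) _.
rewrite derive_cst bform0l addr0 (derive_phi _ _ Ux) /Omega /met /nabla !derive_cst !add0r.
rewrite /phi derive_cst add0r /nabla_tphi.
have := christoffel_met acU u v (dphi S x *m w) Ux.
by rewrite !bformE /cst; scalars; lra.
Qed.

Lemma d_OmegaE x u v w : U x ->
  d_Omega S (fun=> u) (fun=> v) (fun=> w) x =
  bform (dmet S x) v (T x u w) + bform (dmet S x) w (T x v u)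
  + bform (dmet S x) u (T x w v).
Proof. by move=> Ux; rewrite /d_Omega !nabla_OmegaE. Qed.

(** xi is extended from [x] as a constant field, so phi of it vanishes at [x] only. What remains of
    the bracket is - (D_{phi v} phi) xi, killed by eta after differentiating eta o phi = 0 and using
    phi xi = 0. *)
Lemma eta_nijenhuis_xi x v : U x ->
  (deta S x *m nijenhuis S (fun=> dxi S x) (fun=> v) x) 0 0 = 0.
Proof.
move=> Ux.
have ep Z : (deta S x *m phi S Z x) 0 0 = 0 := ac_eta_phi acU (Z x) Ux.
have aux (a b c e : E) : a = 0 -> (deta S x *m b) 0 0 = 0 ->
    (deta S x *m c) 0 0 = 0 -> (deta S x *m e) 0 0 = 0 ->
    (deta S x *m (a + b - c - e)) 0 0 = 0.
  by move=> -> hb hc he; rewrite add0r !pairD !pairN hb hc he !oppr0 !addr0.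
apply: aux; [by rewrite /phi bracket_cst !mulmx0| |exact: ep|exact: ep].
have -> : bracket (phi S (fun=> dxi S x)) (phi S (fun=> v)) x
    = - ('D_(dphi S x *m v) (dphi S) x *m dxi S x).
  have pk : phi S (fun=> dxi S x) x = 0 := ac_phi_xi acU Ux.
  rewrite /bracket pk (derive0 (phi S (fun=> v)) x) sub0r; congr (- _).
  exact: derive_phi.
rewrite pairN.
have := congr1 (fun A : 'rV[R]_d.+1 => (A *m dxi S x) 0 0)
  (ac_Dep acU (dphi S x *m v) Ux).
rewrite /= mulmxDl mul0mx -!mulmxA (ac_phi_xi acU Ux) mulmx0 add0r => ->.
by rewrite mxE oppr0.
Qed.

End ConstantFields.

(** * Adapted frames *)

Section OrthonormalFamilies.
Context {R : realType} {n : nat} (g : 'M[R]_n) (I : finType) (h : I -> 'cV[R]_n).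
Implicit Types u v : 'cV[R]_n.

Let B : 'M[R]_(n, #|I|) := \matrix_(a, i) (g *m h (enum_val i)) a 0.

Let uB u i : (u^T *m B) 0 (enum_rank i) = bform g u (h i).
Proof.
rewrite bform_mxE -mulmxA !mxE; apply: eq_bigr => a _.
by rewrite [B _ _]mxE enum_rankK.
Qed.

Let uB0 u : u^T *m B = 0 <-> forall i, bform g u (h i) = 0.
Proof.
split=> [H i|H]; first by rewrite -uB H mxE.
by apply/rowP => j; rewrite -[j]enum_valK uB H mxE.
Qed.

Lemma exists_orthogonal : (#|I| < n)%N ->
  exists2 u, u != 0 & forall i, bform g u (h i) = 0.
Proof.
move=> cI.
have : kermx B != 0.
  by rewrite -mxrank_eq0 mxrank_ker -lt0n subn_gt0 (leq_ltn_trans (rank_leq_col _)).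
move=> /rowV0Pn[v /sub_kermxP vB v0]; exists v^T; first by rewrite trmx_eq0.
by apply/uB0; rewrite trmxK.
Qed.

Hypothesis h_orthonormal : forall i j, bform g (h i) (h j) = (i == j)%:R.
Hypothesis card_I : #|I| = n.
Hypothesis g_unit : g \in unitmx.

(** Orthonormality makes the matrix [C] of the family a left inverse of [B]; having n members, the
    family forces [B] to have full rank. *)
Lemma orthonormal_complete u : (forall i, bform g u (h i) = 0) -> u = 0.
Proof.
move=> /uB0 H; apply: trmx_inj; rewrite trmx0.
suff rB : row_free B by apply/eqP; rewrite -(mulmx_free_eq0 _ rB) H.
pose C : 'M[R]_(#|I|, n) := \matrix_(i, a) h (enum_val i) a 0.
have CB : C *m B = 1%:M.
  apply/matrixP => i j.
  have -> : (C *m B) i j = ((h (enum_val i))^T *m B) 0 j.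
    by rewrite !mxE; apply: eq_bigr => a _; rewrite !mxE.
  by rewrite -[j]enum_valK uB h_orthonormal mxE enum_valK (inj_eq enum_val_inj).
have := mxrankM_maxr C B; rewrite CB mxrank1 => r1.
by rewrite /row_free eqn_leq rank_leq_row -{1}card_I r1.
Qed.

Lemma orthonormal_expansion u : u = \sum_i bform g u (h i) *: h i.
Proof.
apply/eqP; rewrite -subr_eq0; apply/eqP/orthonormal_complete => j.
rewrite bformDl bformNl bform_suml (bigD1 j) //= big1 => [|i /negPf ij].
  by rewrite bformZl h_orthonormal eqxx mulr1 addr0 subrr.
by rewrite bformZl h_orthonormal ij mulr0.
Qed.

Lemma invmx_orthonormal : g^T = g -> invmx g = \sum_i h i *m (h i)^T.
Proof.
move=> gT; have KG : (\sum_i h i *m (h i)^T) *m g = 1%:M.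
  apply: mulcV_ext => u; rewrite mul1mx [RHS]orthonormal_expansion.
  rewrite !mulmx_suml; apply: eq_bigr => i _.
  rewrite -!mulmxA mx11_scale mulmxA -bform_mxE -[in LHS]gT bform_tr.
  by [].
by rewrite -[LHS]mul1mx -KG mulmxK.
Qed.

(** Since g^-1 is the sum of the h_i h_i^T, the coordinate contraction by which [tension] is defined
    becomes a sum over the frame. *)
Lemma trace_orthonormal (W : lmodType R) (b : 'cV[R]_n -> 'cV[R]_n -> W) :
  g^T = g ->
  (forall u v w, b (u + v) w = b u w + b v w) ->
  (forall u v w, b w (u + v) = b w u + b w v) ->
  (forall (c : R) u v, b (c *: u) v = c *: b u v) ->
  (forall (c : R) u v, b v (c *: u) = c *: b v u) ->
  \sum_k \sum_l invmx g k l *: b (delta_mx k 0) (delta_mx l 0) = \sum_i b (h i) (h i).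
Proof.
move=> gT bDl bDr bZl bZr.
have b0l v : b 0 v = 0 by rewrite -(scale0r 0) bZl scale0r.
have b0r v : b v 0 = 0 by rewrite -(scale0r 0) bZr scale0r.
have bE u : b u u = \sum_k \sum_l (u k 0 * u l 0) *: b (delta_mx k 0) (delta_mx l 0).
  have bl v : b u v = \sum_k u k 0 *: b (delta_mx k 0) v.
    rewrite {1}[u]cV_delta_sum (big_morph (b ^~ v) (fun x y => bDl x y v) (b0l v)).
    by apply: eq_bigr => k _; rewrite bZl.
  have br v : b v u = \sum_k u k 0 *: b v (delta_mx k 0).
    rewrite {1}[u]cV_delta_sum (big_morph (b v) (fun x y => bDr x y v) (b0r v)).
    by apply: eq_bigr => k _; rewrite bZr.
  rewrite bl; apply: eq_bigr => k _; rewrite br scaler_sumr.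
  by apply: eq_bigr => l _; rewrite scalerA.
under [RHS]eq_bigr do rewrite bE.
rewrite [RHS]exchange_big /=; apply: eq_bigr => k _.
rewrite [RHS]exchange_big /=; apply: eq_bigr => l _.
rewrite -scaler_suml; congr (_ *: _).
rewrite invmx_orthonormal // summxE; apply: eq_bigr => i _.
by rewrite !mxE big_ord1 !mxE.
Qed.

End OrthonormalFamilies.

Section AdaptedFrames.
Context {R : realType} {d : nat} (S : acdata R d) (U : set 'cV[R]_d.+1).
Hypothesis acU : almost_contact_on S U.
Variable x : 'cV[R]_d.+1.
Hypothesis Ux : U x.
Local Notation E := 'cV[R]_d.+1.
Local Notation G := (bform (dmet S x)).
Local Notation J := (mulmx (dphi S x)).
Local Notation et := (fun u : E => (deta S x *m u) 0 0).
Let P := ac_point_at acU Ux.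

Definition adapted q (f : 'I_q -> E) := [/\ forall i, et (f i) = 0,
  forall i j, G (f i) (f j) = (i == j)%:R & forall i j, G (f i) (J (f j)) = 0].

Definition full_frame q (f : 'I_q -> E) (a : 'I_1 + ('I_q + 'I_q)) : E :=
  match a with
  | inl _ => dxi S x
  | inr (inl i) => f i
  | inr (inr i) => J (f i)
  end.

Lemma full_frame_orthonormal q (f : 'I_q -> E) : adapted f ->
  forall a b, G (full_frame f a) (full_frame f b) = (a == b)%:R.
Proof.
move=> [ef ff fJ] [a|[a|a]] [b|[b|b]] /=.
- by rewrite !ord1 eqxx (pt_Gk P) (pt_etk P).
- by rewrite (pt_Gsym P) (pt_Gk P) ef.
- by rewrite (pt_Gsym P) (pt_Gk P) (pt_etJ P).
- by rewrite (pt_Gk P) ef.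
- by rewrite ff.
- by rewrite fJ.
- by rewrite (pt_Gk P) (pt_etJ P).
- by rewrite (pt_Gsym P) fJ.
- by rewrite (pt_GJJ P) !ef ff mul0r subr0.
Qed.

Lemma card_full_frame q : #|{: 'I_1 + ('I_q + 'I_q)}| = q.*2.+1.
Proof. by rewrite !card_sum !card_ord addnn. Qed.

(** A unit vector w orthogonal to xi, to the f_i and to the phi f_i suffices: skewness of phi makes
    phi w orthogonal to w and to every f_i. *)
Lemma adapted_extend q (f : 'I_q -> E) : (q.*2.+1 < d.+1)%N -> adapted f ->
  exists f' : 'I_q.+1 -> E, adapted f'.
Proof.
move=> qd [ef ff fJ].
have [|u u0 Hu] := @exists_orthogonal R d.+1 (dmet S x) _ (full_frame f).
  by rewrite card_full_frame.
have eu : et u = 0 by have := Hu (inl ord0); rewrite /= (pt_Gk P).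
have fu i : G u (f i) = 0 := Hu (inr (inl i)).
have Jfu i : G u (J (f i)) = 0 := Hu (inr (inr i)).
have Gu : 0 < G u u by exact: (ac_pos acU).
pose s := (Num.sqrt (G u u))^-1; pose w := s *: u.
have ew : et w = 0 by rewrite /w (pt_etZ P) eu mulr0.
have fw i : G w (f i) = 0 by rewrite /w (pt_GZl P) fu mulr0.
have Jfw i : G w (J (f i)) = 0 by rewrite /w (pt_GZl P) Jfu mulr0.
have ww : G w w = 1.
  rewrite /w (pt_GZl P) (pt_GZr P) mulrA /s -invfM -expr2 sqr_sqrtr ?ltW //.
  by rewrite mulVf // gt_eqF.
exists (fun i => if unlift ord_max i is Some j then f j else w); split.
- by move=> i; case: (unlift _ i).
- move=> i j; case: (unliftP ord_max i) => [i'|] ->; case: (unliftP ord_max j) => [j'|] ->.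
  + by rewrite ff (inj_eq lift_inj).
  + by rewrite (pt_Gsym P) fw eq_sym (negPf (neq_lift _ _)).
  + by rewrite fw (negPf (neq_lift _ _)).
  + by rewrite ww eqxx.
- move=> i j; case: (unlift _ i) => [i'|]; case: (unlift _ j) => [j'|].
  + exact: fJ.
  + by rewrite (pt_Gsym P) (pt_skew P) Jfw oppr0.
  + exact: Jfw.
  + exact: (pt_GJ0 P).
Qed.

Lemma adapted_exists m : d = m.*2 -> exists f : 'I_m -> E, adapted f.
Proof.
move=> dm; have : (m.*2 <= d)%N by rewrite dm.
elim: m {dm} => [|m IH] md.
  by exists (fun=> 0); split=> [[]|[]|[]].
have [|f /adapted_extend H] := IH; first by rewrite (leq_trans _ md) // leq_double.
by apply: H; rewrite ltnS; rewrite doubleS in md; exact: ltnW.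
Qed.

Section FullFrame.
Variables (m : nat) (f : 'I_m -> E).
Hypotheses (dm : d = m.*2) (f_adapted : adapted f).

Let ortho := full_frame_orthonormal f_adapted.
Let card : #|{: 'I_1 + ('I_m + 'I_m)}| = d.+1.
Proof. by rewrite card_full_frame dm. Qed.

Lemma trace_frame (W : lmodType R) (b : E -> E -> W) :
  (forall u v w, b (u + v) w = b u w + b v w) ->
  (forall u v w, b w (u + v) = b w u + b w v) ->
  (forall (c : R) u v, b (c *: u) v = c *: b u v) ->
  (forall (c : R) u v, b v (c *: u) = c *: b v u) ->
  \sum_k \sum_l invmx (dmet S x) k l *: b (dbase k) (dbase l)
  = b (dxi S x) (dxi S x) + \sum_i (b (f i) (f i) + b (J (f i)) (J (f i))).
Proof.
move=> bDl bDr bZl bZr.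
rewrite (trace_orthonormal ortho card (ac_unit acU Ux) (ac_met_trmx acU Ux)) //.
by rewrite !big_sumType big_ord1 big_split.
Qed.

Lemma linear_frame_eq0 (W : lmodType R) (L : E -> W) :
  (forall u v, L (u + v) = L u + L v) -> (forall (c : R) u, L (c *: u) = c *: L u) ->
  L (dxi S x) = 0 -> (forall i, L (f i) = 0 /\ L (J (f i)) = 0) -> forall u, L u = 0.
Proof.
move=> LD LZ Lk Lf u; rewrite [u](orthonormal_expansion ortho card).
have L0 : L 0 = 0 by rewrite -(scale0r 0) LZ scale0r.
rewrite (big_morph L LD L0) big1 // => a _.
by rewrite LZ; case: a => [a|[a|a]] /=; rewrite ?Lk ?(Lf a).1 ?(Lf a).2 scaler0.
Qed.

End FullFrame.
End AdaptedFrames.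

(** * The codifferential of Omega *)

Section AntisymmetricSums.
Context {R : realType} {n : nat}.

Lemma sum_antisym (F : 'I_n -> 'I_n -> R) :
  (forall i j, F i j = - F j i) -> \sum_i \sum_j F i j = 0.
Proof.
move=> H; set s := \sum_i _.
have : s = - s; last by lra.
rewrite {1}/s exchange_big -sumrN; apply: eq_bigr => i _.
by rewrite -sumrN; apply: eq_bigr => j _.
Qed.

Lemma antisym_entry (A : 'M[R]_n) i j : A^T = - A -> A i j = - A j i.
Proof. by move=> /matrixP/(_ j i); rewrite !mxE. Qed.

Lemma mxtrace_swap (A B C : 'M[R]_n) :
  \tr (A *m B *m A *m C) = \tr (A *m C *m A *m B).
Proof. by rewrite -mulmxA mxtrace_mulC !mulmxA. Qed.
End AntisymmetricSums.

(* In coordinates, with [psi = phi g^-1] and [omega_k = Gamma^j_jk], the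
   codifferential of Omega is [d_k psi^ik + psi^ik omega_k]; its divergence
   vanishes because psi is antisymmetric while second derivatives and
   [d_i omega_k] are symmetric. *)
Section Codifferential.
Context {R : realType} {d : nat} (S : acdata R d) (U : set 'cV[R]_d.+1).
Hypothesis acU : almost_contact_on S U.
Local Notation E := 'cV[R]_d.+1.
Implicit Types (x y u v w : E) (i k l : 'I_d.+1).
Local Notation e_ k := (delta_mx k 0 : E).
Local Notation A x u := ('D_u (dmet S) x).

Definition imet x := invmx (dmet S x).
Definition psi x : 'M[R]_d.+1 := dphi S x *m imet x.
Definition omega x : E := \col_k (2^-1 * \tr (imet x *m A x (e_ k))).

Lemma differentiable_imet x : U x -> differentiable imet x.
Proof.
move=> Ux; have [dm _] := ac_dmet acU Ux.
by apply: differentiable_invmx => //; apply: (near_on acU Ux) => y; exact: ac_unit.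
Qed.

Lemma derive_imet x u : U x -> 'D_u imet x = - (imet x *m A x u *m imet x).
Proof.
move=> Ux; have [dm _] := ac_dmet acU Ux.
by apply: derive_invmx => //; apply: (near_on acU Ux) => y; exact: ac_unit.
Qed.

Lemma differentiable_psi x : U x -> differentiable psi x.
Proof.
move=> Ux; have [dp _] := ac_dphi acU Ux.
exact: differentiable_mulmx dp (differentiable_imet Ux).
Qed.

Lemma derive_psi x u : U x -> 'D_u psi x
  = 'D_u (dphi S) x *m imet x - psi x *m (A x u *m imet x).
Proof.
move=> Ux; have [dp _] := ac_dphi acU Ux.
apply: etrans (derive_mulmx u dp (differentiable_imet Ux)) _.
by rewrite derive_imet // mulmxN !mulmxA.
Qed.

Lemma differentiable_derive_psi x u : U x -> differentiable ('D_u psi) x.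
Proof.
move=> Ux; have [dp ddp] := ac_dphi acU Ux; have [dm ddm] := ac_dmet acU Ux.
have di := differentiable_imet Ux.
apply: near_eq_differentiable (near_on acU Ux (fun y Uy => esym (derive_psi u Uy))) _.
apply: differentiableB; first exact: differentiable_mulmx.
by apply: differentiable_mulmx (differentiable_psi Ux) _; exact: differentiable_mulmx.
Qed.

Lemma psi_tr x : U x -> (psi x)^T = - psi x.
Proof.
move=> Ux; rewrite /psi trmx_mul /imet trmx_inv (ac_met_trmx acU Ux).
have H := ac_skew_mx acU Ux; have gU := ac_unit acU Ux.
have -> : (dphi S x)^T = - (dmet S x *m dphi S x) *m invmx (dmet S x).
  by rewrite -H mulmxK.
by rewrite mulNmx mulmxN -mulmxA mulKmx.
Qed.

Lemma derive_psi_tr x u : U x -> ('D_u psi x)^T = - 'D_u psi x.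
Proof.
move=> Ux; rewrite -(derive_trmx u (differentiable_psi Ux)).
apply: etrans (derive_on acU u Ux (fun y Uy => psi_tr Uy)) _.
exact: derive_fopp (differentiable_psi Ux).
Qed.

Lemma derive2_psi_tr x u v : U x ->
  ('D_v ('D_u psi) x)^T = - 'D_v ('D_u psi) x.
Proof.
move=> Ux; have dd := differentiable_derive_psi u Ux.
rewrite -(derive_trmx v dd).
apply: etrans (derive_on acU v Ux (fun y Uy => derive_psi_tr u Uy)) _.
exact: derive_fopp dd.
Qed.

Lemma derive2_psi_comm x u v : U x -> 'D_v ('D_u psi) x = 'D_u ('D_v psi) x.
Proof.
move=> Ux; apply: derive_comm_mx; [|exact: differentiable_derive_psi..].
by apply: (near_on acU Ux) => y; exact: differentiable_psi.
Qed.

Lemma differentiable_omega_entry x k : U x -> differentiable (fun y => omega y k 0) x.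
Proof.
move=> Ux; have [dm ddm] := ac_dmet acU Ux.
have -> : (fun y => omega y k 0) = (fun y => 2^-1 * \tr (imet y *m A y (e_ k))).
  by apply/funext => y; rewrite mxE.
apply: differentiableM; first exact: differentiable_cst.
apply: differentiable_mxtrace; apply: differentiable_mulmx (differentiable_imet Ux) _.
exact: ddm.
Qed.

Lemma derive_omega_entry x u k : U x -> 'D_u (fun y => omega y k 0) x
  = 2^-1 * (\tr (imet x *m 'D_u ('D_(e_ k) (dmet S)) x)
            - \tr (imet x *m A x u *m imet x *m A x (e_ k))).
Proof.
move=> Ux; have [dm ddm] := ac_dmet acU Ux.
have -> : (fun y => omega y k 0) = (fun y => 2^-1 * \tr (imet y *m A y (e_ k))).
  by apply/funext => y; rewrite mxE.
have dM := differentiable_mulmx (differentiable_imet Ux) (ddm (e_ k)).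
have dT := differentiable_mxtrace dM.
apply: etrans (deriveZ (2^-1) (diff_derivable dT)) _.
apply: (congr1 (fun a => 2^-1 * a)).
apply: etrans (derive_mxtrace u dM) _.
rewrite (derive_mulmx u (differentiable_imet Ux) (ddm (e_ k))) derive_imet //.
by rewrite mulNmx linearD linearN addrC.
Qed.

(** omega is the differential of log sqrt (det g), hence closed. Concretely, one term is symmetric
    by the symmetry of second derivatives of the metric, the other by cyclicity of the trace. *)
Lemma derive_omega_sym x i k : U x ->
  'D_(e_ i) (fun y => omega y k 0) x = 'D_(e_ k) (fun y => omega y i 0) x.
Proof.
move=> Ux; have [dm ddm] := ac_dmet acU Ux.
apply: etrans (derive_omega_entry _ k Ux) (etrans _ (esym (derive_omega_entry _ i Ux))).
have H : 'D_(e_ i) ('D_(e_ k) (dmet S)) x = 'D_(e_ k) ('D_(e_ i) (dmet S)) x.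
  apply: derive_comm_mx; [|exact: ddm|exact: ddm].
  by apply: (near_on acU Ux) => y Uy; have [] := ac_dmet acU Uy.
apply: (congr2 (fun a b => 2^-1 * (\tr (imet x *m a) - b)) H).
exact: mxtrace_swap.
Qed.

Definition codiff x : E := \sum_k ('D_(e_ k) psi x *m e_ k) + psi x *m omega x.

Lemma codiffE x i : codiff x i 0
  = \sum_k 'D_(e_ k) psi x i k + \sum_k psi x i k * omega x k 0.
Proof.
rewrite mxE summxE [X in _ + X]mxE; congr (_ + _); apply: eq_bigr => k _.
by rewrite -colE mxE.
Qed.

(** With r = sqrt (det g) the sum is r^-1 d_i d_k (r psi^ik), the coordinate form of delta^2 = 0.
    Once expanded, three double sums pair an antisymmetric factor with a symmetric one, and the two
    mixed sums of omega with derivatives of psi cancel each other. *)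
Lemma div_codiff x : U x ->
  \sum_i 'D_(e_ i) (fun y => codiff y i 0) x + \sum_i omega x i 0 * codiff x i 0 = 0.
Proof.
move=> Ux.
have E1 i : 'D_(e_ i) (fun y => codiff y i 0) x
   = \sum_k 'D_(e_ i) ('D_(e_ k) psi) x i k
     + \sum_k ('D_(e_ i) psi x i k * omega x k 0
               + psi x i k * 'D_(e_ i) (fun y => omega y k 0) x).
  have -> : (fun y => codiff y i 0) = (fun y => \sum_k 'D_(e_ k) psi y i k)
       + (fun y => \sum_k psi y i k * omega y k 0).
    by apply/funext => y; rewrite codiffE.
  have d1 k : differentiable (fun y => 'D_(e_ k) psi y i k) x.
    exact: differentiable_entry (differentiable_derive_psi _ Ux).
  have d2 k := differentiable_entry i k (differentiable_psi Ux).
  have d3 k := differentiable_omega_entry k Ux.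
  have d4 k : differentiable (fun y => psi y i k * omega y k 0) x.
    exact: differentiableM.
  apply: etrans (deriveD (diff_derivable (differentiable_fsum d1))
                         (diff_derivable (differentiable_fsum d4))) _.
  congr (_ + _).
    apply: etrans (derive_fsum _ d1) _; apply: eq_bigr => k _.
    exact: derive_entry (differentiable_derive_psi _ Ux).
  apply: etrans (derive_fsum _ d4) _; apply: eq_bigr => k _.
  apply: etrans (deriveM (diff_derivable (d2 k)) (diff_derivable (d3 k))) _.
  rewrite addrC (derive_entry _ i k (differentiable_psi Ux)).
  by rewrite [X in X + _]/(_ *: _) mulrC.
rewrite (eq_bigr _ (fun i _ => E1 i)).
have z1 : \sum_i \sum_k 'D_(e_ i) ('D_(e_ k) psi) x i k = 0.
  apply: sum_antisym => i k.
  apply: etrans (antisym_entry i k (derive2_psi_tr (e_ k) (e_ i) Ux)) _.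
  apply: (congr1 (fun M : 'M[R]_d.+1 => - M k i)).
  exact: derive2_psi_comm.
have pa i k := antisym_entry i k (psi_tr Ux).
have z2 : \sum_i \sum_k psi x i k * 'D_(e_ i) (fun y => omega y k 0) x = 0.
  apply: sum_antisym => i k; apply: etrans (mulNr _ _).
  exact: (congr2 *%R (pa i k) (derive_omega_sym i k Ux)).
have z3 : \sum_i \sum_k psi x i k * (omega x i 0 * omega x k 0) = 0.
  apply: sum_antisym => i k; apply: etrans (mulNr _ _).
  exact: (congr2 *%R (pa i k) (mulrC _ _)).
have z4 : \sum_i \sum_k 'D_(e_ i) psi x i k * omega x k 0
        + \sum_i \sum_k omega x i 0 * 'D_(e_ k) psi x i k = 0.
  rewrite [X in _ + X]exchange_big -big_split big1 //= => i _.
  rewrite -big_split big1 //= => k _.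
  have /= := antisym_entry i k (derive_psi_tr (e_ i) Ux).
  by move: ('D_(e_ i) psi x i k) ('D_(e_ i) psi x k i) => a b ->; ring.
rewrite big_split /= z1 add0r.
under eq_bigr do rewrite big_split /=.
rewrite big_split /= z2 addr0.
under [X in _ + X]eq_bigr do rewrite codiffE mulrDr !mulr_sumr.
rewrite big_split /= addrA z4 add0r -[RHS]z3; apply: eq_bigr => i _.
by apply: eq_bigr => k _; rewrite mulrCA.
Qed.

End Codifferential.

(** * Frame traces of the covariant derivatives of eta and phi *)

Section FrameTraces.
Context {R : realType} {d : nat} (S : acdata R d) (U : set 'cV[R]_d.+1).
Hypothesis acU : almost_contact_on S U.
Variables (x : 'cV[R]_d.+1) (Ux : U x) (I : finType) (h : I -> 'cV[R]_d.+1).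
Local Notation E := 'cV[R]_d.+1.
Local Notation G := (bform (dmet S x)).
Local Notation J := (mulmx (dphi S x)).
Local Notation e_ k := (delta_mx k 0 : E).
Local Notation gi := (imet S x).
Local Notation A u := ('D_u (dmet S) x).
Local Notation Gam := (christoffel S x).
Hypothesis h_orthonormal : forall i j, G (h i) (h j) = (i == j)%:R.
Hypothesis card_I : #|I| = d.+1.
Implicit Types u v w : E.

Lemma christoffelP u v w :
  G (Gam u v) w = 2^-1 * (bform (A u) v w + bform (A v) u w - bform (A w) u v).
Proof.
apply: (koszulP (ac_unit acU Ux) (ac_met_trmx acU Ux)) => *.
exact: (dmet_linear acU).
Qed.

Lemma imet_tr : gi^T = gi.
Proof. by rewrite /imet trmx_inv (ac_met_trmx acU Ux). Qed.

Lemma met_imet w v : G w (gi *m v) = bform 1%:M w v.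
Proof. by rewrite bform_mulmxr mulmxV // (ac_unit acU Ux). Qed.

Lemma imet_met w v : G (gi *m w) v = bform 1%:M w v.
Proof. by rewrite bform_mulmxl imet_tr mulVmx // (ac_unit acU Ux). Qed.

Lemma bform1_delta w k : bform 1%:M w (e_ k) = w k 0.
Proof. by rewrite bform_mxE mulmx1 -colE !mxE. Qed.

Lemma bform1E w v : bform 1%:M w v = \sum_i w i 0 * v i 0.
Proof. by rewrite bform_mxE mulmx1 mxE; apply: eq_bigr => i _; rewrite mxE. Qed.

Lemma sum_frame (W : lmodType R) (b : E -> E -> W) :
  (forall u v w, b (u + v) w = b u w + b v w) ->
  (forall u v w, b w (u + v) = b w u + b w v) ->
  (forall (c : R) u v, b (c *: u) v = c *: b u v) ->
  (forall (c : R) u v, b v (c *: u) = c *: b v u) ->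
  \sum_a b (h a) (h a) = \sum_k b (e_ k) (gi *m e_ k).
Proof.
move=> bDl bDr bZl bZr.
rewrite -(trace_orthonormal h_orthonormal card_I (ac_unit acU Ux) (ac_met_trmx acU Ux)) //.
apply: eq_bigr => k _.
have -> : gi *m e_ k = \sum_l gi k l *: e_ l.
  rewrite -colE [LHS]cV_delta_sum; apply: eq_bigr => l _.
  by rewrite -[in RHS]imet_tr !mxE.
have b0 v : b v 0 = 0 by rewrite -(scale0r 0) bZr scale0r.
rewrite (big_morph (b (e_ k)) (fun u v => bDr u v _) (b0 _)).
by apply: eq_bigr => l _; rewrite bZr.
Qed.

Lemma bform_frame (B : 'M[R]_d.+1) : \sum_a bform B (h a) (h a) = \tr (gi *m B).
Proof.
rewrite (@sum_frame R^o (bform B)) => [|*|*|*|*]; last first.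
- exact: bformZr.
- exact: bformZl.
- exact: bformDr.
- exact: bformDl.
rewrite mxtrace_mulC; apply: eq_bigr => k _.
rewrite bform_mulmxr bform_mxE trmx_delta -rowE -colE !mxE.
by [].
Qed.

Lemma omega_dot w : bform 1%:M (omega S x) w = 2^-1 * \tr (gi *m A w).
Proof.
have [dm _] := ac_dmet acU Ux.
have -> : \tr (gi *m A w) = \sum_i w i 0 * \tr (gi *m A (e_ i)).
  rewrite {1}[w]cV_delta_sum (derive_sumv _ _ _ dm) mulmx_sumr raddf_sum; apply: eq_bigr => i _.
  by rewrite /= (deriveZv _ _ dm) -scalemxAr -mxtraceZ.
rewrite bform1E mulr_sumr; apply: eq_bigr => i _; rewrite mxE.
by rewrite -mulrA; congr (_ * _); exact: mulrC.
Qed.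

(** Both sides are div xi, in a frame and in coordinates. In the Koszul formula for g (Gamma (h_a,
    xi), h_a) two terms cancel, leaving half the trace of the derivative of g along xi. *)
Lemma nabla_eta_frame : \sum_a nabla_eta S x (h a) (h a)
  = \sum_i 'D_(e_ i) (fun y => dxi S y i 0) x + \sum_i omega S x i 0 * dxi S x i 0.
Proof.
have P := ac_point_at acU Ux; have [dk _] := ac_dxi acU Ux.
have -> : \sum_i omega S x i 0 * dxi S x i 0 = \sum_k Gam (e_ k) (dxi S x) k 0.
  rewrite -bform1E omega_dot -bform_frame mulr_sumr.
  transitivity (\sum_a G (Gam (h a) (dxi S x)) (h a)).
    by apply: eq_bigr => a _; rewrite christoffelP (ac_dmet_sym acU (h a) (h a) _ Ux) addrAC subrr add0r.
  rewrite (@sum_frame R^o (fun u v => G (Gam u (dxi S x)) v)) => [|u v w|u v w|c u v|c u v].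
  - by apply: eq_bigr => k _; rewrite met_imet bform1_delta.
  - by rewrite (christoffelDl acU) // bformDl.
  - exact: bformDr.
  - by rewrite (christoffelZl acU) // bformZl.
  - exact: bformZr.
rewrite -big_split /= (@sum_frame R^o (nabla_eta S x)).
- apply: eq_bigr => k _; rewrite (pt_NX P) met_imet bform1_delta mxE.
  by rewrite (derive_entry _ _ _ dk).
- by move=> u v w; exact: (pt_NDl P).
- by move=> u v w; exact: (pt_NDr P).
- by move=> c u v; exact: (pt_NZl P).
- by move=> c u v; exact: (pt_NZr P).
Qed.

Lemma christoffel_frame : \sum_a Gam (h a) (h a)
  = gi *m (\sum_k A (e_ k) *m (gi *m e_ k) - omega S x).
Proof.
have [dm _] := ac_dmet acU Ux.
apply: (ac_met_ext acU Ux) => w; rewrite imet_met bform_suml bformDl bformNl.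
rewrite omega_dot -bform_frame bform_suml mulr_sumr.
transitivity (\sum_a (bform (A (h a)) (h a) w - 2^-1 * bform (A w) (h a) (h a))).
  by apply: eq_bigr => a _; rewrite christoffelP; scalars; field.
rewrite sumrB; congr (_ - _).
rewrite (@sum_frame R^o (fun u v => bform (A u) v w)) => [|u v z|u v z|c u v|c u v].
- apply: eq_bigr => k _; rewrite [RHS]bform_mulmxl mulmx1 bform_tr.
  exact: (ac_dmet_sym acU).
- by rewrite (deriveDv _ _ dm) bform_addmx.
- exact: bformDl.
- by rewrite (deriveZv _ _ dm) bform_scalemx.
- exact: bformZl.
Qed.

(** The term phi Gamma (h_a, h_a) supplies both the derivative of the inverse metric contained in
    that of [psi] and the [omega] term of [codiff]. *)
Lemma nabla_tphi_frame : \sum_a Gam (h a) (J (h a)) = 0 ->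
  \sum_a nabla_tphi S x (h a) (h a) = codiff S x.
Proof.
move=> GJ0; have [dp _] := ac_dphi acU Ux.
rewrite sumrB big_split /= GJ0 addr0 -mulmx_sumr christoffel_frame.
rewrite (@sum_frame _ (fun u v => 'D_u (dphi S) x *m v)) => [|u v z|u v z|c u v|c u v].
- rewrite /codiff !mulmxDr !mulmxN opprB addrCA addrC; congr (_ + _); last by rewrite mulmxA.
  rewrite !mulmx_sumr -sumrB; apply: eq_bigr => k _.
  rewrite (derive_psi acU _ Ux) mulmxBl; congr (_ - _); first by rewrite mulmxA.
  by rewrite /psi !mulmxA.
- by rewrite (deriveDv _ _ dp) mulmxDl.
- by rewrite mulmxDr.
- by rewrite (deriveZv _ _ dp) scalemxAl.
- by rewrite scalemxAr.
Qed.

End FrameTraces.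

Section CodifferentialParallelXi.
Context {R : realType} {d : nat} (S : acdata R d) (U : set 'cV[R]_d.+1).
Hypothesis acU : almost_contact_on S U.
Variables (m : nat) (dm : d = m.*2).

(** phi exchanges f_i and phi f_i up to sign while Gamma is symmetric, so the terms cancel in pairs;
    phi xi = 0 handles xi. *)
Lemma christoffel_phi_frame x (f : 'I_m -> 'cV[R]_d.+1) : U x -> adapted S x f ->
  \sum_a christoffel S x (full_frame S x f a) (dphi S x *m full_frame S x f a) = 0.
Proof.
move=> Ux [ef _ _]; rewrite !big_sumType big_ord1 /= (ac_phi_xi acU Ux).
rewrite (christoffel0 acU) // add0r.
apply/eqP; rewrite addr_eq0 -sumrN; apply/eqP/eq_bigr => i _.
rewrite (ac_sqr acU) // ef scale0r addr0 (christoffel_sym acU (dphi S x *m f i) _) //.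
by rewrite -(scaleN1r (f i)) (christoffelZl acU) // scaleN1r opprK.
Qed.

(** The hypothesis holds at every point, hence [codiff] = c xi on U. As c is constant, [div_codiff]
    reads c div xi = 0. *)
Lemma coclosed_of_codiff (c : R) : c != 0 ->
  (forall y (f : 'I_m -> 'cV[R]_d.+1), U y -> adapted S y f ->
    nabla_tphi S y (dxi S y) (dxi S y) + \sum_i (nabla_tphi S y (f i) (f i)
      + nabla_tphi S y (dphi S y *m f i) (dphi S y *m f i)) = c *: dxi S y) ->
  forall x (f : 'I_m -> 'cV[R]_d.+1), U x -> adapted S x f ->
  \sum_i (nabla_eta S x (f i) (f i)
     + nabla_eta S x (dphi S x *m f i) (dphi S x *m f i)) = 0.
Proof.
move=> c0 H x f Ux af.
have card : #|{: 'I_1 + ('I_m + 'I_m)}| = d.+1 by rewrite card_full_frame dm.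
have V y : U y -> codiff S y = c *: dxi S y.
  move=> Uy; have [f' af'] := adapted_exists acU Uy dm.
  rewrite -(H _ f') // -(nabla_tphi_frame acU Uy (full_frame_orthonormal acU Uy af') card).
    by rewrite !big_sumType big_ord1; congr (_ + _); rewrite [RHS]big_split.
  exact: christoffel_phi_frame.
have P := ac_point_at acU Ux; have [dk _] := ac_dxi acU Ux.
have E1 := nabla_eta_frame acU Ux (full_frame_orthonormal acU Ux af) card.
rewrite !big_sumType big_ord1 /= (pt_Nk P) add0r in E1.
rewrite big_split /= E1; apply/eqP; rewrite -(mulrI_eq0 _ (mulfI c0)) mulrDr !mulr_sumr.
have E2 i y : U y -> codiff S y i 0 = c * dxi S y i 0 by move=> Uy; rewrite V // mxE.
apply/eqP; rewrite -[RHS](div_codiff acU Ux); congr (_ + _); apply: eq_bigr => i _.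
  rewrite (derive_on acU _ Ux (E2 i)).
  exact: esym (deriveZ c (diff_derivable (differentiable_entry i 0 dk))).
by rewrite E2 // mulrCA.
Qed.

End CodifferentialParallelXi.

(** * The classes *)

Section ContactForm.
Context {R : realType} {d : nat} (S : acdata R d) (U : set 'cV[R]_d.+1).
Hypothesis acU : almost_contact_on S U.
Local Notation E := 'cV[R]_d.+1.
Implicit Types (x y u v w : E).
Local Notation G x := (bform (dmet S x)).
Local Notation J x := (mulmx (dphi S x)).
Local Notation T x := (nabla_tphi S x).

Lemma derive_Omega x w u v : U x ->
  'D_w (Omega S (fun=> u) (fun=> v)) x = G x u (T x w v)
   + G x (christoffel S x w u) (J x v) + G x u (J x (christoffel S x w v)).
Proof.
move=> Ux; have := nabla_OmegaE acU w u v Ux; rewrite /nabla_Omega.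
have -> : Omega S (nabla S (fun=> w) (fun=> u)) (fun=> v) x
  = G x (christoffel S x w u) (J x v).
  by rewrite /Omega /met /nabla derive_cst add0r.
have -> : Omega S (fun=> u) (nabla S (fun=> w) (fun=> v)) x
  = G x u (J x (christoffel S x w v)).
  by rewrite /Omega /met /phi /nabla derive_cst add0r.
by move=> <-; rewrite [X in X + _]addrAC !subrK.
Qed.

Lemma derive2_eta x w u v : U x ->
  'D_w (fun y => ('D_u (deta S) y *m v) 0 0) x = ('D_w ('D_u (deta S)) x *m v) 0 0.
Proof.
move=> Ux; have [de dde] := ac_deta acU Ux.
have dv := differentiable_mulmx (dde u) (differentiable_cst v x).
apply: etrans (derive_entry w 0 0 dv) _.
by rewrite (derive_mulmx w (dde u) (differentiable_cst v x)) derive_cst mulmx0 addr0.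
Qed.

(** d (d eta) = 0 in coordinates: the cyclic sum of the derivatives of 2 d eta = 2 a Omega vanishes
    by symmetry of the second derivatives of eta. Dividing by 2 a, the Christoffel terms then cancel
    by symmetry of Gamma and skewness of phi. *)
Lemma contact_Omega_closed (a : R) : a != 0 ->
  (forall x u v, U x -> d_eta S (fun=> u) (fun=> v) x = a * Omega S (fun=> u) (fun=> v) x) ->
  forall x u v w, U x ->
    G x v (T x u w) + G x w (T x v u) + G x u (T x w v) = 0.
Proof.
move=> a0 H x u v w Ux; have [de dde] := ac_deta acU Ux.
have H2 (z1 z2 : E) y : U y -> ('D_z1 (deta S) y *m z2) 0 0 - ('D_z2 (deta S) y *m z1) 0 0
    = (2 * a) * Omega S (fun=> z1) (fun=> z2) y.
  move=> Uy; have := H y z1 z2 Uy.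
  rewrite (d_etaE acU) // /nabla_eta (christoffel_sym acU z2 z1 Uy).
  by move: (Omega _ _ _ _) => o; scalars; lra.
have dentry (z1 z2 : E) : differentiable (fun y => ('D_z1 (deta S) y *m z2) 0 0) x.
  apply: (differentiable_entry 0 0).
  exact: differentiable_mulmx (dde z1) (differentiable_cst z2 x).
have dOmega z1 z2 : differentiable (Omega S (fun=> z1) (fun=> z2)) x.
  have [dm _] := ac_dmet acU Ux; have [dp _] := ac_dphi acU Ux.
  apply: (differentiable_entry 0 0); apply: differentiable_mulmx.
    exact: differentiable_mulmx (differentiable_cst _ x) dm.
  exact: differentiable_mulmx dp (differentiable_cst _ x).
have D (z z1 z2 : E) : ('D_z ('D_z1 (deta S)) x *m z2) 0 0 - ('D_z ('D_z2 (deta S)) x *m z1) 0 0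
    = (2 * a) * 'D_z (Omega S (fun=> z1) (fun=> z2)) x.
  apply: etrans (esym (congr2 (fun b c => b - c) (derive2_eta z z1 z2 Ux)
    (derive2_eta z z2 z1 Ux))) _.
  apply: etrans (esym (deriveB (diff_derivable (dentry z1 z2))
    (diff_derivable (dentry z2 z1)))) _.
  apply: etrans (derive_on acU z Ux (H2 z1 z2)) _.
  exact: (deriveZ (2 * a) (diff_derivable (dOmega z1 z2))).
have C (z1 z2 : E) : 'D_z1 ('D_z2 (deta S)) x = 'D_z2 ('D_z1 (deta S)) x.
  apply: derive_comm_mx; [|exact: dde|exact: dde].
  by apply: (near_on acU Ux) => y Uy; have [] := ac_deta acU Uy.
have D1 := D w u v; have D2 := D u v w; have D3 := D v w u.
have a20 : 2 * a != 0 by rewrite mulf_neq0 // pnatr_eq0.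
have : (2 * a) * ('D_w (Omega S (fun=> u) (fun=> v)) x
   + 'D_u (Omega S (fun=> v) (fun=> w)) x + 'D_v (Omega S (fun=> w) (fun=> u)) x) = 0.
  rewrite !mulrDr -D1 -D2 -D3.
  have C' (z1 z2 z3 : E) := congr1 (fun B : 'rV[R]_d.+1 => (B *m z3) 0 0) (C z1 z2).
  have aux (p1 p2 p3 p4 p5 p6 : R) : p1 = p4 -> p2 = p5 -> p6 = p3 ->
    p1 - p2 + (p3 - p4) + (p5 - p6) = 0 by move=> -> -> ->; ring.
  exact: aux (C' w u v) (C' w v u) (C' v u w).
move/eqP; rewrite mulf_eq0 (negPf a20) /= !derive_Omega // => /eqP.
rewrite (christoffel_sym acU u w Ux) (christoffel_sym acU v w Ux) (christoffel_sym acU v u Ux).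
have sk (z1 z2 : E) : G x z1 (J x z2) = - G x z2 (J x z1).
  by rewrite -(ac_skew acU) // (ac_sym acU).
rewrite (sk u (christoffel S x w v)) (sk v (christoffel S x w u)) (sk w (christoffel S x u v)).
have aux (t1 t2 t3 b1 b2 b3 : R) :
    (t1 + b1 - b2) + (t2 + b3 - b1) + (t3 + b2 - b3) = 0 -> t2 + t3 + t1 = 0.
  by move=> <-; ring.
exact: aux.
Qed.

End ContactForm.

Lemma eq_half (R : realType) (a b c : R) : b + b = a * (2 * c * 1) -> b = a * c.
Proof.
move=> H; have -> : b = 2^-1 * (b + b) by field.
by rewrite H; field.
Qed.

(* [d eta] is not zero on the contact distribution. *)
Definition twisted (R : realType) d (S : acdata R d) (x : 'cV[R]_d.+1) :=
  exists u v, [/\ (deta S x *m u) 0 0 = 0, (deta S x *m v) 0 0 = 0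
    & nabla_eta S x u v != nabla_eta S x v u].

Section SourceClasses.
Context {R : realType} {m : nat} {M : acmanifold R m}.
Local Notation E := 'cV[R]_(m.*2).+1.
Implicit Types (i : chart M) (x u v : E).

Lemma ac_chart i : almost_contact_on (acs i) (cimg i).
Proof.
have [s1 s2 s3 s4] := acs_smooth i.
split; [exact: cimg_open|exact: smooth_on_twice..| | | | |].
- by move=> x u v Ux; exact: met_sym.
- by move=> x u Ux; exact: met_pos.
- by move=> x u Ux; exact: phi_sqr.
- by move=> x Ux; exact: eta_xi.
- by move=> x u v Ux; exact: met_phi.
Qed.

Definition contact_pt i x := @contact_at R E (bform (dmet (acs i) x))
  (mulmx (dphi (acs i) x)) (fun u => (deta (acs i) x *m u) 0 0) (nabla_eta (acs i) x).

Definition coclosed_pt i x := @coclosed_at R E (mulmx (dphi (acs i) x))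
  (fun u => (deta (acs i) x *m u) 0 0) (dxi (acs i) x) (nabla_eta (acs i) x).

Lemma for_cst A i x u v : @for_fields R m M A -> cimg i x ->
  A (acs i) (fun=> u) (fun=> v) (param i x) x.
Proof. by move=> H Ux; apply: H => //; exact: smooth_on_cst. Qed.

Lemma alpha_contact_pt (a : R) : alpha_contact_metric M a ->
  forall i x, cimg i x -> contact_pt i x /\ coclosed_pt i x.
Proof.
move=> [a0 H] i x Ux; have P := ac_point_at (ac_chart i) Ux.
have E u v : nabla_eta (acs i) x u v - nabla_eta (acs i) x v u
    = 2 * (a * bform (dmet (acs i) x) u (dphi (acs i) x *m v)).
  have := for_cst u v H Ux; rewrite /= (d_etaE (ac_chart i)) //.
  rewrite -[X in _ = _ * X -> _]/(bform (dmet (acs i) x) u (dphi (acs i) x *m v)).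
  move: (nabla_eta _ x u v) (nabla_eta _ x v u) => b c; scalars; lra.
split; first exact: (contact_at_contact P a0 E).
apply: (coclosed_at_contact P E) => u v w.
apply: (contact_Omega_closed (ac_chart i) a0) => // y u' v' Uy.
exact: (for_cst u' v' H Uy).
Qed.

Lemma quasi_contact_pt : quasi_contact_metric M ->
  forall i x, cimg i x -> contact_pt i x /\ coclosed_pt i x.
Proof.
move=> H i x Ux; have P := ac_point_at (ac_chart i) Ux.
have E u v := etrans (esym (opPE (ac_chart i) u v Ux)) (for_cst u v H Ux).
split.
  apply: (contact_at_opP P) => u eu.
  by apply: etrans (E u u) _; rewrite /eta eu scale0r subr0.
exact: (coclosed_at_quasi_contact P (fun u => hhE (ac_chart i) u Ux) E).
Qed.

Lemma quasi_K_pt : quasi_K_Sasakian M ->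
  forall i x, cimg i x -> contact_pt i x /\ coclosed_pt i x.
Proof.
move=> H i x Ux; have P := ac_point_at (ac_chart i) Ux.
have E u v := etrans (esym (opPE (ac_chart i) u v Ux)) (for_cst u v H Ux).
split.
  apply: (contact_at_opP P) => u eu.
  by apply: etrans (E u u) _; rewrite /eta eu mulr0 !scale0r subr0 addr0.
exact: (coclosed_at_quasi_K P E).
Qed.

Lemma nearly_Sasakian_pt (a : R) : nearly_alpha_Sasakian M a ->
  forall i x, cimg i x -> contact_pt i x /\ coclosed_pt i x.
Proof.
move=> [a0 H] i x Ux; have P := ac_point_at (ac_chart i) Ux.
have E u v := etrans (esym (opQE (ac_chart i) u v Ux)) (for_cst u v H Ux).
split; last exact: (coclosed_at_nearly_Sasakian P E).
apply: (contact_at_etT P a0) => u eu.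
have := congr1 (fun w => (deta (acs i) x *m w) 0 0) (E u u).
rewrite /= /eta eu !scale0r !subr0 pairD !pairZ (pt_etk P) /met.
exact: eq_half.
Qed.

Lemma class_A1_pt : class_A1 M ->
  forall i x, cimg i x -> contact_pt i x /\ coclosed_pt i x.
Proof.
case=> [[a]|[|[|[[H _]|[a [H _]]]]]].
- exact: alpha_contact_pt.
- exact: quasi_contact_pt.
- exact: quasi_K_pt.
- apply: (@alpha_contact_pt 1); split; first exact: oner_neq0.
  by move=> i X Y x sX sY Ux; rewrite mul1r; exact: H.
- exact: alpha_contact_pt H.
Qed.

(** On D the theta terms carry a factor eta (u), so the eta-component of Q (u, u) is 2 wp |u|^2. *)
Lemma class_A2_pt : class_A2 M -> forall i x, cimg i x -> contact_pt i x.
Proof.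
move=> [wp [th [_ _ nz H]]] i x Ux; have P := ac_point_at (ac_chart i) Ux.
have E u v := etrans (esym (opQE (ac_chart i) u v Ux)) (for_cst u v H Ux).
apply: (contact_at_etT P (nz (param i x)).1) => u eu.
have := congr1 (fun w => (deta (acs i) x *m w) 0 0) (E u u).
rewrite /= /eta eu !scale0r !subr0 addr0 scaler0 subr0 pairD !pairZ (pt_etk P) /met.
exact: eq_half.
Qed.

(** The theta term contributes g (phi u, u) = 0 on D, leaving wp |u|^2. *)
Lemma class_A3_pt : class_A3 M -> forall i x, cimg i x -> contact_pt i x.
Proof.
move=> [wp [th [_ _ nz [_ H _ _]]]] i x Ux; have P := ac_point_at (ac_chart i) Ux.
have E u v := etrans (esym (nabla_phiE (ac_chart i) (fun=> u) Ux (differentiable_cst v x)))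
  (for_cst u v H Ux).
apply: (contact_at_etT P (nz (param i x)).1) => u eu.
have := congr1 (fun w => (deta (acs i) x *m w) 0 0) (E u u).
rewrite /= /eta /cst eu !scale0r !subr0 => E'; apply: etrans E' _.
rewrite pairD !pairZ (pt_etk P).
rewrite /met /phi (pt_skew P) (pt_GJ0 P).
by move: (wp _) (th _) => c e; scalars; ring.
Qed.

(** nabla_xi xi = 0 and div xi = 0, in the shape needed by the trace of the second fundamental form.
    Only the whole sum is asked to vanish, since delta^2 Omega = 0 says nothing about the individual
    planes. *)
Definition balanced_pt i x := (forall u, nabla_eta (acs i) x (dxi (acs i) x) u = 0) /\
  forall f : 'I_m -> E, adapted (acs i) x f ->
  \sum_j (nabla_eta (acs i) x (f j) (f j)
    + nabla_eta (acs i) x (dphi (acs i) x *m f j) (dphi (acs i) x *m f j)) = 0.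

Lemma coclosed_balanced i x : coclosed_pt i x -> balanced_pt i x.
Proof.
by move=> [H1 H2]; split=> // f [ef _ _]; rewrite big1 // => j _; exact: H2.
Qed.

(** For m > 0 an adapted frame has a vector u in D, and the pair phi u, u is a witness. *)
Lemma contact_twisted i x : (0 < m)%N -> cimg i x -> contact_pt i x -> twisted (acs i) x.
Proof.
move=> m0 Ux cx; have P := ac_point_at (ac_chart i) Ux.
have [f [ef ff _]] := adapted_exists (ac_chart i) Ux erefl.
pose u := f (Ordinal m0).
exists (dphi (acs i) x *m u), u; split; [exact: (pt_etJ P)|exact: ef|].
apply: (contact_atP P cx); first exact: ef.
apply/eqP => u0; have := ff (Ordinal m0) (Ordinal m0).
by rewrite -/u u0 bform0l eqxx => /eqP; rewrite eq_sym oner_eq0.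
Qed.

Lemma adapted_frame i x (f : 'I_m -> E) : cimg i x -> adapted (acs i) x f ->
  adapted_frame_at (acs i) (fun j => fun=> f j) x.
Proof.
move=> Ux [ef ff fJ]; have P := ac_point_at (ac_chart i) Ux.
split; rewrite /met /phi /xi.
- by rewrite (pt_Gk P) (pt_etk P).
- by move=> j; rewrite !(pt_Gk P) ef (pt_etJ P).
- exact: ff.
- by move=> j k; rewrite (pt_GJJ P) ff ef mul0r subr0.
- exact: fJ.
Qed.

(** As (nabla_xi phi) xi = - phi (nabla_xi xi), delta Omega is dual to the full trace of nabla phi;
    nondegeneracy of g turns the identity of 1-forms into one of vectors. *)
Lemma semi_Sasakian_codiff : semi_Sasakian M -> forall i x (f : 'I_m -> E),
  cimg i x -> adapted (acs i) x f ->
  nabla_tphi (acs i) x (dxi (acs i) x) (dxi (acs i) x)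
  + \sum_j (nabla_tphi (acs i) x (f j) (f j)
    + nabla_tphi (acs i) x (dphi (acs i) x *m f j) (dphi (acs i) x *m f j))
  = (2 * m)%:R *: dxi (acs i) x.
Proof.
move=> [_ H] i x f Ux af; have P := ac_point_at (ac_chart i) Ux.
apply: (ac_met_ext (ac_chart i) Ux) => w.
have := H i (fun j => fun=> f j) (fun=> w) x
  (fun j => smooth_on_cst _ (f j)) (smooth_on_cst _ w) Ux (adapted_frame Ux af).
rewrite bformZl (pt_Gsym P (dxi _ _)) (pt_Gk P) => <-.
rewrite /delta_Omega; apply: (congr1 (fun z => bform (dmet (acs i) x) z w)).
apply: (congr2 +%R (pt_Tk P _)); apply: eq_bigr => j _.
exact: esym (opPE (ac_chart i) _ _ Ux).
Qed.

(** The eta-component of the trace identity reads sum_j 2 d eta (phi f_j, f_j) = 2 m, so some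
    summand is nonzero. Normality evaluated on (xi, v) and paired with eta gives d eta (xi, v) = 0,
    that is nabla_xi xi = 0. *)
Lemma class_A7_pt : (0 < m)%N -> class_A7 M ->
  forall i x, cimg i x -> twisted (acs i) x /\ balanced_pt i x.
Proof.
move=> m0 sM i x Ux; have P := ac_point_at (ac_chart i) Ux.
have cM := semi_Sasakian_codiff sM.
have m20 : (2 * m)%:R != 0 :> R by rewrite pnatr_eq0 muln_eq0 /= -lt0n.
split.
  have [f af] := adapted_exists (ac_chart i) Ux erefl.
  have := congr1 (fun w => (deta (acs i) x *m w) 0 0) (cM i x f Ux af).
  rewrite /= pairZ (pt_etk P) mulr1 pairD (pt_etT P) (pt_Jk P).
  have -> : nabla_eta (acs i) x (dxi (acs i) x) 0 = 0.
    by rewrite (pt_NX P) bform0r.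
  rewrite oppr0 add0r mulmx_sumr summxE.
  rewrite (eq_bigr _ (fun j _ => pt_etP P (f j))) => sE.
  have [/existsP[j Hj]|/existsPn Hn] := boolP [exists j : 'I_m,
    nabla_eta (acs i) x (dphi (acs i) x *m f j) (f j)
    != nabla_eta (acs i) x (f j) (dphi (acs i) x *m f j)].
    exists (dphi (acs i) x *m f j), (f j).
    by split=> //; [exact: (pt_etJ P)|have [ef _ _] := af; exact: ef].
  move: m20; rewrite -sE big1 ?eqxx // => j _.
  by have := Hn j; rewrite negbK => /eqP ->; rewrite subrr.
split; last first.
  move=> f; apply: (coclosed_of_codiff (ac_chart i) erefl m20) => // y f' Uy.
  exact: cM.
move=> v; have [nM _] := sM.
have := for_cst (dxi (acs i) x) v nM Ux => /(congr1 (fun w => (deta (acs i) x *m w) 0 0)).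
rewrite /= pairD (eta_nijenhuis_xi (ac_chart i)) // add0r pairZ (pt_etk P) pair0.
rewrite (d_etaE (ac_chart i)) // (pt_Nk P) subr0 mulr1.
by move: (nabla_eta _ _ _ _) => a; lra.
Qed.

End SourceClasses.

(** * The derivative of the 1-form on the target *)

Section TargetClasses.
Context {R : realType} {n : nat} {N : acmanifold R n}.
Local Notation E := 'cV[R]_(n.*2).+1.
Implicit Types (j : chart N) (y u v : E).

(** d Omega = 2 beta eta /\ Omega is evaluated on (v, phi v, xi): the left side is minus the wanted
    sum by [pt_dOmega], the right side is 2 beta Omega (v, phi v) = - 2 beta |v|^2. Hence b = 2
    beta. *)
Lemma class_B3_pt : class_B3 N -> forall j y, cimg j y ->
  (forall u v, nabla_eta (acs j) y u v = nabla_eta (acs j) y v u) /\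
  exists2 b : R, b != 0 & forall v, (deta (acs j) y *m v) 0 0 = 0 ->
    nabla_eta (acs j) y v v
    + nabla_eta (acs j) y (dphi (acs j) y *m v) (dphi (acs j) y *m v)
    = b * bform (dmet (acs j) y) v v.
Proof.
move=> [beta [_ nz HO He _]] j y Uy; have acU := ac_chart j.
have P := ac_point_at acU Uy.
split=> [u v|].
  have := for_cst u v He Uy; rewrite /= (d_etaE acU) // => /eqP.
  by rewrite mulf_eq0 invr_eq0 pnatr_eq0 /= subr_eq0 => /eqP.
exists (2 * beta (param j y)); first by rewrite mulf_neq0 // pnatr_eq0.
move=> v ev.
have := HO j (fun=> v) (fun=> dphi (acs j) y *m v) (fun=> dxi (acs j) y) y
  (smooth_on_cst _ _) (smooth_on_cst _ _) (smooth_on_cst _ _) Uy.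
rewrite (d_OmegaE acU) // (pt_dOmega P) // /eta_wedge_Omega /eta /Omega /met /phi.
rewrite ev (pt_etJ P) (pt_etk P) (pt_JJ P) ev !mul0r mul1r scale0r !add0r.
rewrite addr0 (pt_GNr P) mulrN => /eqP; rewrite eqr_opp => /eqP; exact.
Qed.

(** Taking Y = xi in the formula for nabla phi gives - phi (nabla_u xi). Applying phi loses nothing
    because nabla_u xi is orthogonal to xi. The pair [c] is (wp, theta). *)
Lemma class_A3_eta : class_A3 N -> forall j y, cimg j y ->
  exists2 c : R * R, c.2 != 0 & forall u v, nabla_eta (acs j) y u v
   = - c.1 * bform (dmet (acs j) y) (dphi (acs j) y *m u) v
     + c.2 * (bform (dmet (acs j) y) u v
              - (deta (acs j) y *m u) 0 0 * (deta (acs j) y *m v) 0 0).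
Proof.
move=> [wp [th [_ _ nz [_ H _ _]]]] j y Uy; have acU := ac_chart j.
have P := ac_point_at acU Uy; have [_ th0] := nz (param j y).
exists (wp (param j y), th (param j y)) => //= u v.
have Tk : nabla_tphi (acs j) y u (dxi (acs j) y) = _ :=
  etrans (esym (nabla_phiE acU (fun=> u) Uy (differentiable_cst (dxi (acs j) y) y)))
  (for_cst u (dxi (acs j) y) H Uy).
have E1 : nabla_eta (acs j) y u v
   = bform (dmet (acs j) y) (dphi (acs j) y *m nabla_xi (acs j) y u) (dphi (acs j) y *m v).
  by rewrite (pt_GJJ P) (pt_etX P) mul0r subr0 (pt_NX P).
have E2 : nabla_eta (acs j) y u v
   = - bform (dmet (acs j) y) (nabla_tphi (acs j) y u (dxi (acs j) y)) (dphi (acs j) y *m v).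
  by rewrite E1 (pt_Tk P) (pt_GNl P) opprK.
rewrite E2 Tk /met /eta /phi (pt_etk P) !scale1r (pt_Gk P) (pt_Gk P) (pt_etJ P).
rewrite scale0r sub0r (pt_GDl P) !(pt_GZl P) (pt_GDl P) !(pt_GNl P) (pt_GZl P).
rewrite (pt_Gsym P (dxi _ _)) (pt_Gk P) (pt_etJ P) (pt_GJJ P).
rewrite (pt_skew P u v).
move: (wp _) (th _) (bform _ u v) (bform _ u (dphi (acs j) y *m v)) => c e p q.
by move: ((deta (acs j) y *m u) 0 0) ((deta (acs j) y *m v) 0 0) => r t; ring.
Qed.

End TargetClasses.

(** * Holomorphic maps *)

Section TwiceDifferentiable.
Context {R : realType} {d : nat} (W : set 'cV[R]_d.+1) (W_open : open W).
Local Notation E := 'cV[R]_d.+1.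
Implicit Types (x u v w : E).

Lemma twice_ext (Z : normedModType R) (f g : E -> Z) :
  (forall y, W y -> f y = g y) ->
  twice_differentiable_on W f -> twice_differentiable_on W g.
Proof.
move=> fg df x Wx; have [d1 d2] := df x Wx; split.
  exact: near_eq_differentiable (nbhs_open_on W_open Wx fg) d1.
move=> v; apply: near_eq_differentiable (nbhs_open_on W_open Wx _) (d2 v) => y Wy.
by apply: near_eq_derive; exact: nbhs_open_on W_open Wy fg.
Qed.

Lemma twice_mul (f g : E -> R) : twice_differentiable_on W f ->
  twice_differentiable_on W g -> twice_differentiable_on W (fun y => f y * g y).
Proof.
move=> df dg x Wx; have [f1 f2] := df x Wx; have [g1 g2] := dg x Wx.
split=> [|v]; first exact: differentiableM.
have E1 y : W y -> f y * 'D_v g y + g y * 'D_v f y = 'D_v (fun y => f y * g y) y.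
  move=> Wy; have [f1y _] := df y Wy; have [g1y _] := dg y Wy.
  exact: esym (deriveM (diff_derivable f1y) (diff_derivable g1y)).
apply: near_eq_differentiable (nbhs_open_on W_open Wx E1) _.
by apply: differentiableD; apply: differentiableM.
Qed.

Lemma twice_fsum (I : finType) (f : I -> E -> R) :
  (forall i, twice_differentiable_on W (f i)) ->
  twice_differentiable_on W (fun y => \sum_i f i y).
Proof.
move=> df x Wx; split=> [|v].
  by apply: differentiable_fsum => i; have [] := df i x Wx.
have E1 y : W y -> \sum_i 'D_v (f i) y = 'D_v (fun y => \sum_i f i y) y.
  by move=> Wy; apply/esym/derive_fsum => i; have [] := df i y Wy.
apply: near_eq_differentiable (nbhs_open_on W_open Wx E1) _.
by apply: differentiable_fsum => i; have [_ H] := df i x Wx; exact: H.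
Qed.

Lemma twice_entry m n (A : E -> 'M[R]_(m, n)) i j : twice_differentiable_on W A ->
  twice_differentiable_on W (fun y => A y i j).
Proof.
move=> dA x Wx; have [A1 A2] := dA x Wx; split=> [|v]; first exact: differentiable_entry.
have E1 y : W y -> 'D_v A y i j = 'D_v (fun y => A y i j) y.
  by move=> Wy; have [A1y _] := dA y Wy; exact: esym (derive_entry v i j A1y).
apply: near_eq_differentiable (nbhs_open_on W_open Wx E1) _.
exact: differentiable_entry (A2 v).
Qed.

Lemma twice_comp d' (U' : set 'cV[R]_d'.+1) (h : 'cV[R]_d'.+1 -> R)
    (F : E -> 'cV[R]_d'.+1) :
  twice_differentiable_on U' h -> twice_differentiable_on W F ->
  (forall y, W y -> U' (F y)) -> twice_differentiable_on W (fun y => h (F y)).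
Proof.
move=> dh dF FU x Wx; have [F1 F2] := dF x Wx; have [h1 h2] := dh _ (FU x Wx).
split=> [|v]; first exact: differentiable_comp.
have E1 y : W y -> \sum_l 'D_v F y l 0 * 'D_(delta_mx l 0) h (F y) = 'D_v (fun y => h (F y)) y.
  move=> Wy; have [F1y _] := dF y Wy; have [h1y _] := dh _ (FU y Wy).
  apply: etrans (esym (derive_chain v F1y h1y)).
  rewrite [in RHS](cV_delta_sum ('D_v F y)) (derive_sumv _ _ _ h1y).
  by apply: eq_bigr => l _; rewrite (deriveZv _ _ h1y).
apply: near_eq_differentiable (nbhs_open_on W_open Wx E1) _.
apply: differentiable_fsum => l; apply: differentiableM.
  exact: differentiable_entry (F2 v).
exact: differentiable_comp F1 (h2 _).
Qed.

(* Stands for the bracket argument [[X, Y] a = 0]: the identity [D_v a = b (eta v)]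
   is differentiated once more. *)
Lemma derive_proportional (a : E -> R) (eta : E -> 'rV[R]_d.+1) (b : E -> R) x u w :
  W x -> twice_differentiable_on W a -> differentiable eta x -> differentiable b x ->
  (forall y v, W y -> 'D_v a y = b y * (eta y *m v) 0 0) ->
  (eta x *m u) 0 0 = 0 -> (eta x *m w) 0 0 = 0 ->
  b x * (('D_w eta x *m u) 0 0 - ('D_u eta x *m w) 0 0) = 0.
Proof.
move=> Wx da de db H eu ew; have [_ da2] := da x Wx.
have D z v : (eta x *m v) 0 0 = 0 -> 'D_z ('D_v a) x = b x * ('D_z eta x *m v) 0 0.
  move=> ev.
  have E1 : \near x, 'D_v a x = b x * (eta x *m v) 0 0.
    by apply: (nbhs_open_on W_open Wx) => y Wy; exact: H.
  apply: etrans (near_eq_derive z E1) _.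
  have dev := differentiable_mulmx de (differentiable_cst v x).
  apply: etrans (deriveM (diff_derivable db)
    (diff_derivable (differentiable_entry 0 0 dev))) _.
  rewrite (derive_entry z 0 0 dev) (derive_mulmx z de (differentiable_cst v x)).
  by rewrite derive_cst mulmx0 addr0 ev scale0r addr0.
have C : 'D_w ('D_u a) x = 'D_u ('D_w a) x.
  apply: derive_comm_real => //.
  by apply: (nbhs_open_on W_open Wx) => y Wy; have [] := da y Wy.
by rewrite mulrBr -(D _ _ eu) -(D _ _ ew) C subrr.
Qed.

End TwiceDifferentiable.

(* The pullback of the 1-form of the target is [a eta] with [a = scale]. *)
Section HolomorphicMap.
Context {R : realType} {d d' : nat} (S : acdata R d) (S' : acdata R d').
Context (U : set 'cV[R]_d.+1) (U' : set 'cV[R]_d'.+1).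
Hypotheses (acU : almost_contact_on S U) (acU' : almost_contact_on S' U').
Local Notation E := 'cV[R]_d.+1.
Local Notation E' := 'cV[R]_d'.+1.
Variables (F : E -> E') (W : set E) (s : R).
Hypotheses (W_open : open W) (WU : forall x, W x -> U x).
Hypothesis FU : forall x, W x -> U' (F x).
Hypothesis F_twice : twice_differentiable_on W F.
Hypothesis F_thrice : forall u, twice_differentiable_on W ('D_u F).
Hypothesis s_sqr : s * s = 1.
Hypothesis F_hol : forall x v, W x ->
  'D_(dphi S x *m v) F x = s *: (dphi S' (F x) *m 'D_v F x).
Implicit Types (x u v w : E).

Local Notation J x := (mulmx (dphi S x)).
Local Notation J' x := (mulmx (dphi S' (F x))).
Local Notation et x u := ((deta S x *m u) 0 0).
Local Notation et' x u := ((deta S' (F x) *m u) 0 0).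
Local Notation N x := (nabla_eta S x).
Local Notation N' x := (nabla_eta S' (F x)).
Local Notation G' x := (bform (dmet S' (F x))).
Local Notation k x := (dxi S x).
Local Notation k' x := (dxi S' (F x)).

Definition scale x : R := et' x ('D_(k x) F x).

(** Write u = eta (u) xi - phi (phi u); by holomorphy the last term is sent into the image of J,
    where sigma vanishes. *)
Lemma map_eta x u : W x -> et' x ('D_u F x) = scale x * et x u.
Proof.
move=> Wx; have [dF _] := F_twice Wx; have Ux := WU Wx; have Ux' := FU Wx.
have -> : 'D_u F x = et x u *: 'D_(k x) F x - s *: (J' x ('D_(J x u) F x)).
  rewrite -F_hol // (ac_sqr acU) // (deriveDv _ _ dF) (deriveZv _ _ dF) (deriveNv _ dF).
  by rewrite opprD opprK addrCA subrr addr0.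
by rewrite pairD pairN !pairZ (ac_eta_phi acU') // mulr0 subr0 mulrC.
Qed.

Lemma map_xi x : W x -> 'D_(k x) F x = scale x *: k' x.
Proof.
move=> Wx; have Ux := WU Wx; have Ux' := FU Wx.
have J0 : J' x ('D_(k x) F x) = 0.
  have := F_hol (k x) Wx; rewrite (ac_phi_xi acU Ux) derive0 => /esym/(congr1 (fun z => s *: z)).
  by rewrite scalerA s_sqr scale1r scaler0.
have := ac_sqr acU' ('D_(k x) F x) Ux'; rewrite J0 mulmx0 => /esym/eqP.
by rewrite addrC subr_eq0 => /eqP.
Qed.

Let alpha u x := et' x ('D_u F x).

Lemma twice_alpha u : twice_differentiable_on W (alpha u).
Proof.
apply: (@twice_ext _ _ _ W_open _ (fun y => \sum_l deta S' (F y) 0 l * 'D_u F y l 0)).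
  by move=> y Wy; rewrite /alpha mxE.
apply: (twice_fsum W_open) => l; apply: (twice_mul W_open).
  exact: (twice_comp W_open (twice_entry (ac_open acU') 0 l (ac_deta acU')) F_twice FU).
exact: (twice_entry W_open l 0 (F_thrice u)).
Qed.

(** The direction xi varies, so it is expanded in the coordinate basis. As [scale] already contains
    one derivative of [F], its second derivatives call for [F_thrice]. *)
Lemma twice_scale : twice_differentiable_on W scale.
Proof.
apply: (@twice_ext _ _ _ W_open _ (fun y => \sum_l k y l 0 * alpha (delta_mx l 0) y)).
  move=> y Wy; have [dF _] := F_twice Wy.
  rewrite /scale [in RHS](cV_delta_sum (k y)) (derive_sumv _ _ _ dF) mulmx_sumr summxE.
  by apply: eq_bigr => l _; rewrite (deriveZv _ _ dF) pairZ.
apply: (twice_fsum W_open) => l; apply: (twice_mul W_open); last exact: twice_alpha.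
apply: (twice_entry W_open l 0) => y Wy; exact: (ac_dxi acU (WU Wy)).
Qed.

Lemma eta_second_derivative x w u : W x -> et' x ('D_w ('D_u F) x)
  = 'D_w scale x * et x u + scale x * ('D_w (deta S) x *m u) 0 0
    - ('D_('D_w F x) (deta S') (F x) *m 'D_u F x) 0 0.
Proof.
move=> Wx; have [dF d2F] := F_twice Wx; have Ux := WU Wx; have Ux' := FU Wx.
have [de _] := ac_deta acU Ux; have [de' _] := ac_deta acU' Ux'.
have [da _] := twice_scale Wx.
have deF : differentiable (deta S' \o F) x by exact: differentiable_comp.
have E1 := derive_mulmx w deF (d2F u).
rewrite (derive_chain w dF de') in E1.
have dm := differentiable_mulmx deF (d2F u).
have E2 : 'D_w (alpha u) x = 'D_w (fun y => scale y * et y u) x.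
  by apply: near_eq_derive; apply: (nbhs_open_on W_open Wx) => y; exact: map_eta.
have dv := differentiable_mulmx de (differentiable_cst u x).
have E3 : 'D_w (fun y => scale y * et y u) x
    = scale x * ('D_w (deta S) x *m u) 0 0 + et x u * 'D_w scale x.
  apply: etrans (deriveM (diff_derivable da) (diff_derivable (differentiable_entry 0 0 dv))) _.
  rewrite (derive_entry w 0 0 dv) (derive_mulmx w de (differentiable_cst u x)).
  by rewrite derive_cst mulmx0 addr0.
have E4 : 'D_w (alpha u) x = ('D_('D_w F x) (deta S') (F x) *m 'D_u F x) 0 0
    + et' x ('D_w ('D_u F) x).
  by apply: etrans (derive_entry w 0 0 dm) _; rewrite E1 mxE.
have : et' x ('D_w ('D_u F) x) = 'D_w (alpha u) x
   - ('D_('D_w F x) (deta S') (F x) *m 'D_u F x) 0 0 by rewrite E4 addrAC subrr add0r.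
move=> H; apply: etrans H (congr1 (fun z => z - _) (etrans E2 (etrans E3 _))).
exact: etrans (addrC _ _) (congr2 +%R (mulrC _ _) erefl).
Qed.

Definition second_fundamental x w u : E' :=
  'D_w ('D_u F) x - 'D_(christoffel S x w u) F x
  + christoffel S' (F x) ('D_w F x) ('D_u F x).

Definition eta_second_fundamental x w u : R :=
  'D_w scale x * et x u + scale x * N x w u - N' x ('D_w F x) ('D_u F x).

Lemma eta_second_fundamentalE x w u : W x ->
  et' x (second_fundamental x w u) = eta_second_fundamental x w u.
Proof.
move=> Wx; rewrite /second_fundamental !pairD pairN map_eta // eta_second_derivative //.
rewrite /eta_second_fundamental /nabla_eta.
move: ('D_w scale x) (scale x) => p q; scalars; ring.
Qed.

Lemma eta_second_fundamental_sym x w u : W x ->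
  eta_second_fundamental x w u = eta_second_fundamental x u w.
Proof.
move=> Wx; have [dF d2F] := F_twice Wx; have Ux := WU Wx; have Ux' := FU Wx.
have C : 'D_w ('D_u F) x = 'D_u ('D_w F) x.
  apply: derive_comm_mx; [|exact: d2F|exact: d2F].
  by apply: (nbhs_open_on W_open Wx) => y Wy; have [] := F_twice Wy.
apply: etrans (esym (eta_second_fundamentalE w u Wx)) (etrans _ (eta_second_fundamentalE u w Wx)).
apply: (congr1 (fun z => et' x z)).
have H (p p' : E') (q q' : E) (r r' : E') : p = p' -> q = q' -> r = r' ->
  p - 'D_q F x + r = p' - 'D_q' F x + r' by move=> -> -> ->.
exact: H C (christoffel_sym acU w u Ux) (christoffel_sym acU' _ _ Ux').
Qed.

Lemma eta_trace x m (f : 'I_m -> E) : d = m.*2 -> W x -> adapted S x f ->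
  et' x (\sum_k \sum_l invmx (dmet S x) k l *: second_fundamental x (dbase k) (dbase l))
  = 'D_(k x) scale x
    + scale x * (\sum_i (N x (f i) (f i) + N x (J x (f i)) (J x (f i))))
    - scale x ^+ 2 * N' x (k' x) (k' x)
    - \sum_i (N' x ('D_(f i) F x) ('D_(f i) F x)
              + N' x (J' x ('D_(f i) F x)) (J' x ('D_(f i) F x))).
Proof.
move=> dm Wx af; have [dF _] := F_twice Wx; have [da _] := twice_scale Wx.
have Ux := WU Wx; have P := ac_point_at acU Ux; have P' := ac_point_at acU' (FU Wx).
have -> : et' x (\sum_k \sum_l invmx (dmet S x) k l *: second_fundamental x (dbase k) (dbase l))
   = \sum_k \sum_l (invmx (dmet S x) k l *: eta_second_fundamental x (dbase k) (dbase l) : R^o).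
  rewrite mulmx_sumr summxE; apply: eq_bigr => a _.
  rewrite mulmx_sumr summxE; apply: eq_bigr => b _.
  by rewrite pairZ eta_second_fundamentalE.
have [ef _ _] := af.
have Ek : eta_second_fundamental x (k x) (k x)
    = 'D_(k x) scale x - scale x ^+ 2 * N' x (k' x) (k' x).
  rewrite /eta_second_fundamental (map_xi Wx) (pt_Nk P) (pt_etk P) (pt_NZl P') (pt_NZr P').
  have aux (p a q : R) : p * 1 + a * 0 - a * (a * q) = p - a ^+ 2 * q by ring.
  exact: aux.
(* The image of phi f_i is s J applied to that of f_i and enters quadratically, so only s^2 = 1
   matters. *)
have Ef i : eta_second_fundamental x (f i) (f i) + eta_second_fundamental x (J x (f i)) (J x (f i))
    = scale x * (N x (f i) (f i) + N x (J x (f i)) (J x (f i)))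
      - (N' x ('D_(f i) F x) ('D_(f i) F x)
         + N' x (J' x ('D_(f i) F x)) (J' x ('D_(f i) F x))).
  rewrite /eta_second_fundamental ef (pt_etJ P) (F_hol _ Wx) (pt_NZl P') (pt_NZr P').
  have aux (p p' a n1 n2 q1 q2 : R) : (p * 0 + a * n1 - q1) + (p' * 0 + a * n2 - s * (s * q2))
     = a * (n1 + n2) - (q1 + q2).
    by rewrite mulrA s_sqr; ring.
  exact: aux.
rewrite (trace_frame acU Ux dm af) => [|u v w|u v w|c u v|c u v].
- rewrite Ek (eq_bigr _ (fun i _ => Ef i)) sumrB -mulr_sumr.
  have aux (p q r t : R) : p - q + (r - t) = p + r - q - t by ring.
  exact: aux.
- rewrite /eta_second_fundamental (deriveDv _ _ da) (deriveDv _ _ dF) (pt_NDl P) (pt_NDl P').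
  have aux (p1 p2 e a n1 n2 q1 q2 : R) : (p1 + p2) * e + a * (n1 + n2) - (q1 + q2)
    = (p1 * e + a * n1 - q1) + (p2 * e + a * n2 - q2) by ring.
  exact: aux.
- rewrite /eta_second_fundamental (deriveDv _ _ dF) (pt_NDr P) (pt_NDr P') pairD.
  have aux (p e1 e2 a n1 n2 q1 q2 : R) : p * (e1 + e2) + a * (n1 + n2) - (q1 + q2)
    = (p * e1 + a * n1 - q1) + (p * e2 + a * n2 - q2) by ring.
  exact: aux.
- rewrite /eta_second_fundamental (deriveZv _ _ da) (deriveZv _ _ dF) (pt_NZl P) (pt_NZl P').
  have aux (p e a n q : R) : (c * p) * e + a * (c * n) - c * q = c * (p * e + a * n - q).
    by ring.
  exact: aux.
- rewrite /eta_second_fundamental (deriveZv _ _ dF) (pt_NZr P) (pt_NZr P') pairZ.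
  have aux (p e a n q : R) : p * (c * e) + a * (c * n) - c * q = c * (p * e + a * n - q).
    by ring.
  exact: aux.
Qed.

Lemma scale_twist x u w : W x -> et x u = 0 -> et x w = 0 ->
  scale x * (N x w u - N x u w)
  = N' x ('D_w F x) ('D_u F x) - N' x ('D_u F x) ('D_w F x).
Proof.
move=> Wx eu ew.
have aux (p e p' e' a n n' q q' : R) : p * e + a * n - q = p' * e' + a * n' - q' ->
    e = 0 -> e' = 0 -> a * (n - n') = q - q'.
  move=> H e0 e0'; move: H; rewrite e0 e0' !mulr0 !add0r mulrBr => /eqP.
  by rewrite subr_eq => /eqP ->; ring.
exact: aux (eta_second_fundamental_sym w u Wx) eu ew.
Qed.

Lemma scale_eq0 x : W x -> twisted S x ->
  (forall u v, et x u = 0 -> et x v = 0 ->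
    N' x ('D_u F x) ('D_v F x) = N' x ('D_v F x) ('D_u F x)) -> scale x = 0.
Proof.
move=> Wx [u [v [eu ev uv]]] H; have := scale_twist Wx ev eu.
move=> E1; have := etrans E1 (etrans (congr1 (fun z => z - _) (H u v eu ev)) (subrr _)).
by move/eqP; rewrite mulf_eq0 subr_eq0 (negPf uv) orbF => /eqP.
Qed.

Lemma map_eq0 x : W x -> twisted S x ->
  (forall u, et x u = 0 -> 'D_u F x = 0) -> forall u, 'D_u F x = 0.
Proof.
move=> Wx tx H u; have [dF _] := F_twice Wx; have Ux := WU Wx.
have a0 : scale x = 0 by apply: (scale_eq0 Wx tx) => w v ew ev; rewrite (H w ew) (H v ev).
have -> : u = (u - et x u *: k x) + et x u *: k x by rewrite subrK.
rewrite (deriveDv _ _ dF) (deriveZv _ _ dF) map_xi // a0 scale0r scaler0 addr0.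
by apply: H; rewrite pairD pairN pairZ (ac_eta_xi acU) // mulr1 subrr.
Qed.

(** The vanishing sum of squares kills the images of the f_i, and holomorphy those of the phi
    f_i. *)
Lemma map_frame_eq0 x m (f : 'I_m -> E) : d = m.*2 -> W x -> twisted S x ->
  adapted S x f -> \sum_i G' x ('D_(f i) F x) ('D_(f i) F x) = 0 ->
  forall u, 'D_u F x = 0.
Proof.
move=> dm Wx tx af /eqP; have [dF _] := F_twice Wx.
have Ux := WU Wx; have Ux' := FU Wx.
rewrite psumr_eq0 => [/allP H|i _]; last exact: (ac_met_ge0 acU').
have f0 i : 'D_(f i) F x = 0.
  by apply: (ac_met_eq0 acU' Ux'); apply/eqP/H; rewrite mem_index_enum.
have Jf0 i : 'D_(J x (f i)) F x = 0 by rewrite F_hol // f0 mulmx0 scaler0.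
(* The differential composed with the projection onto D along xi: it vanishes at xi, so it can be
   tested on the full frame before anything is known about [scale x]. *)
pose L u := 'D_(u - et x u *: k x) F x.
have LD u v : L (u + v) = L u + L v.
  by rewrite /L pairD scalerDl opprD addrACA (deriveDv _ _ dF).
have LZ (c : R) u : L (c *: u) = c *: L u.
  by rewrite /L pairZ -scalerA -scalerBr (deriveZv _ _ dF).
have L0 v : et x v = 0 -> L v = 'D_v F x.
  move=> ev; apply: (congr1 (fun z => 'D_z F x)).
  by rewrite ev scale0r subr0.
have Lk : L (k x) = 0 by rewrite /L (ac_eta_xi acU Ux) scale1r subrr; exact: derive0.
have [ef _ _] := af.
have Lf i : L (f i) = 0 /\ L (J x (f i)) = 0.
  split; [exact: etrans (L0 _ (ef i)) (f0 i)|].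
  exact: etrans (L0 _ (ac_eta_phi acU (f i) Ux)) (Jf0 i).
apply: (map_eq0 Wx tx) => u eu; apply: etrans (esym (L0 u eu)) _.
exact: (linear_frame_eq0 acU Ux dm af LD LZ Lk Lf).
Qed.

(** [scale] must vanish on all of [W], not merely at [x], for its derivative along xi to disappear
    from the trace. *)
Lemma harmonic_closed_target x m (f : 'I_m -> E) (b : R) : d = m.*2 -> W x ->
  adapted S x f -> (forall y, W y -> twisted S y) ->
  (forall y (u v : E'), W y -> N' y u v = N' y v u) -> b != 0 ->
  (forall v : E', et' x v = 0 -> N' x v v + N' x (J' x v) (J' x v) = b * G' x v v) ->
  \sum_k \sum_l invmx (dmet S x) k l *: second_fundamental x (dbase k) (dbase l) = 0 ->
  forall u, 'D_u F x = 0.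
Proof.
move=> dm Wx af tW symW b0 bP tau0.
have a0 y : W y -> scale y = 0.
  move=> Wy; apply: (scale_eq0 Wy (tW y Wy)) => u v _ _; exact: symW.
have Da : 'D_(k x) scale x = 0.
  apply: etrans _ (derive_cst (0 : R) x (k x)).
  by apply: near_eq_derive; exact: (nbhs_open_on W_open Wx a0).
have aux (p a q r t : R) : 0 = p + a * q - a ^+ 2 * r - t -> p = 0 -> a = 0 -> t = 0.
  by move=> H p0 a00; move: H; rewrite p0 a00 expr2 !mul0r addr0 subr0 sub0r => /esym/eqP;
    rewrite oppr_eq0 => /eqP.
have S0 := aux _ _ _ _ _ (etrans (esym (etrans (congr1 (fun z => et' x z) tau0) (pair0 _)))
  (eta_trace dm Wx af)) Da (a0 x Wx).
have [ef _ _] := af.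
have S1 : b * \sum_i G' x ('D_(f i) F x) ('D_(f i) F x) = 0.
  apply: etrans _ S0; rewrite mulr_sumr; apply: eq_bigr => i _; apply/esym/bP.
  by rewrite map_eta // ef mulr0.
apply: (map_frame_eq0 dm Wx (tW _ Wx) af); apply/eqP.
by move/eqP: S1; rewrite mulf_eq0 (negPf b0).
Qed.

(** Compare B (xi, u) with B (u, xi) for u in D. The former vanishes, since nabla_xi eta = 0 and the
    given form of nabla sigma yields nabla_gamma sigma = 0; the latter reduces to u(a). *)
Lemma derive_scale_D x u (c : R * R) : W x ->
  (forall v, N x (k x) v = 0) ->
  (forall v w : E', N' x v w = - c.1 * G' x (J' x v) w
     + c.2 * (G' x v w - et' x v * et' x w)) ->
  et x u = 0 -> 'D_u scale x = 0.
Proof.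
move=> Wx Nk NE eu; have P := ac_point_at acU (WU Wx); have P' := ac_point_at acU' (FU Wx).
have aux (p e p' e' a n n' q q' : R) : p * e + a * n - q = p' * e' + a * n' - q' ->
    e = 0 -> e' = 1 -> n = 0 -> n' = 0 -> q = 0 -> q' = 0 -> p' = 0.
  move=> H e0 e1 n0 n0' q0 q0'; move: H.
  by rewrite e0 e1 n0 n0' q0 q0' !mulr0 mulr1 !addr0 !subr0 => <-.
apply: aux (eta_second_fundamental_sym (k x) u Wx) eu (pt_etk P) (Nk u) (pt_Nk P u) _ _.
  rewrite (map_xi Wx) (pt_NZl P') NE (pt_Jk P') (pt_G0l P') (pt_Gsym P') (pt_Gk P').
  by rewrite (pt_etk P') mul1r subrr !mulr0 addr0 mulr0.
by rewrite (map_xi Wx) (pt_NZr P') (pt_Nk P') mulr0.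
Qed.

(** The hypothesis gives da = xi(a) eta on [W]. Differentiating again gives xi(a) d eta = 0 on D,
    and the twisted pair forces xi(a) = 0. *)
Lemma derive_scale_eq0 x : W x -> twisted S x ->
  (forall y u, W y -> et y u = 0 -> 'D_u scale y = 0) -> forall u, 'D_u scale x = 0.
Proof.
move=> Wx [u [v [eu ev uv]]] H w.
have [de _] := ac_deta acU (WU Wx); have Ux := WU Wx.
(* xi moves with the point: xi(a) is rewritten through coordinate derivatives of a, which are known
   to be differentiable. *)
have Db : differentiable (fun y => 'D_(k y) scale y) x.
  apply: (@near_eq_differentiable _ _ _
    (fun y => \sum_l k y l 0 * 'D_(delta_mx l 0) scale y)).
    apply: (nbhs_open_on W_open Wx) => y Wy; have [da _] := twice_scale Wy.
    rewrite [in RHS](cV_delta_sum (k y)) (derive_sumv _ _ _ da).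
    by apply: eq_bigr => l _; rewrite (deriveZv _ _ da).
  have [_ d2a] := twice_scale Wx; have [dk _] := ac_dxi acU Ux.
  apply: differentiable_fsum => l; apply: differentiableM; last exact: d2a.
  exact: differentiable_entry dk.
have E1 y z : W y -> 'D_z scale y = 'D_(k y) scale y * et y z.
  move=> Wy; have [da _] := twice_scale Wy.
  have zE : z = (z - et y z *: k y) + et y z *: k y by rewrite subrK.
  rewrite {1}zE.
  rewrite (deriveDv _ _ da) (deriveZv _ _ da) H // ?add0r; first exact: mulrC.
  by rewrite pairD pairN pairZ (ac_eta_xi acU (WU Wy)) mulr1 subrr.
have := derive_proportional W_open Wx twice_scale de Db E1 ev eu.
rewrite (_ : _ - _ = N x u v - N x v u); last first.
  by rewrite /nabla_eta (christoffel_sym acU u v Ux); scalars; ring.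
move=> /eqP; rewrite mulf_eq0 subr_eq0 (negPf uv) orbF => /eqP b0.
by rewrite E1 // b0 mul0r.
Qed.

(** For v orthogonal to gamma the first coefficient multiplies a skew form and drops out; the second
    counts |v|^2 once for v and once for Jv, whence the factor 2. *)
Lemma harmonic_trans_Sasakian_target x m (f : 'I_m -> E) (c : E -> R * R) :
  d = m.*2 -> W x -> adapted S x f -> (forall y, W y -> twisted S y) ->
  (forall y v, W y -> N y (k y) v = 0) ->
  \sum_i (N x (f i) (f i) + N x (J x (f i)) (J x (f i))) = 0 ->
  (c x).2 != 0 ->
  (forall y (v w : E'), W y -> N' y v w = - (c y).1 * G' y (J' y v) w
     + (c y).2 * (G' y v w - et' y v * et' y w)) ->
  \sum_k \sum_l invmx (dmet S x) k l *: second_fundamental x (dbase k) (dbase l) = 0 ->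
  forall u, 'D_u F x = 0.
Proof.
move=> dm Wx af tW Nk bal c0 NE tau0; have P' := ac_point_at acU' (FU Wx).
have Da : 'D_(k x) scale x = 0.
  apply: (derive_scale_eq0 Wx (tW x Wx)) => y u Wy.
  apply: (@derive_scale_D y u (c y) Wy) => [v|v w]; [exact: Nk|exact: NE].
have aux (p a q r t : R) : 0 = p + a * q - a ^+ 2 * r - t -> p = 0 -> q = 0 ->
    r = 0 -> t = 0.
  by move=> H p0 q0 r0; move: H; rewrite p0 q0 r0 !mulr0 addr0 subr0 sub0r => /esym/eqP;
    rewrite oppr_eq0 => /eqP.
have S0 := aux _ _ _ _ _ (etrans (esym (etrans (congr1 (fun z => et' x z) tau0) (pair0 _)))
  (eta_trace dm Wx af)) Da bal (pt_Nk P' _).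
have [ef _ _] := af.
have S1 : (2 * (c x).2) * \sum_i G' x ('D_(f i) F x) ('D_(f i) F x) = 0.
  apply: etrans _ S0; rewrite mulr_sumr; apply: eq_bigr => i _.
  have ev : et' x ('D_(f i) F x) = 0 by rewrite map_eta // ef mulr0.
  move: ('D_(f i) F x) ev => v ev.
  rewrite !NE // (pt_JJ P') (pt_etJ P') ev scale0r addr0 (pt_GJJ P') ev.
  rewrite (pt_GNl P') (pt_Gsym P' (dphi S' (F x) *m v)) (pt_GJ0 P').
  by move: (G' x v v) (c x).1 (c x).2 => p q r; ring.
apply: (map_frame_eq0 dm Wx (tW _ Wx) af); apply/eqP.
by move/eqP: S1; rewrite !mulf_eq0 pnatr_eq0 (negPf c0).
Qed.

End HolomorphicMap.

(** * Globalization *)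

Section SmoothExtensionality.
Context {R : realType} {V W : normedModType R} (U : set V) (U_open : open U).

Lemma smooth_upto_ext q (f g : V -> W) : (forall y, U y -> f y = g y) ->
  smooth_upto q U f -> smooth_upto q U g.
Proof.
elim: q f g => [|q IH] f g fg [df ddf].
  by split=> // x Ux; exact: near_eq_differentiable (nbhs_open_on U_open Ux fg) (df x Ux).
split=> [x Ux|v]; first exact: near_eq_differentiable (nbhs_open_on U_open Ux fg) (df x Ux).
apply: IH (ddf v) => y Uy; apply: near_eq_derive; exact: nbhs_open_on fg.
Qed.

End SmoothExtensionality.

Lemma smooth_on_mulmx_cst (R : realType) (V : normedModType R) (U : set V) m n p
  (A : V -> 'M[R]_(m, n)) (u : 'M[R]_(n, p)) : open U ->
  smooth_on U A -> smooth_on U (fun y => A y *m u).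
Proof.
move=> Uo sA q; have {sA} := sA q; elim: q A => [|q IH] A [dA ddA]; split=> //.
- by move=> x Ux; exact: differentiable_mulmx (dA x Ux) (differentiable_cst u x).
- by move=> x Ux; exact: differentiable_mulmx (dA x Ux) (differentiable_cst u x).
move=> v; apply: (smooth_upto_ext Uo _ (IH _ (ddA v))) => y Uy.
have := derive_mulmx v (dA y Uy) (differentiable_cst u y).
by rewrite derive_cst mulmx0 addr0 => ->.
Qed.

(** The mean value theorem concerns real functions, so it is applied to each entry along the
    segment. *)
Lemma derive_segment0 (R : realType) d m n (F : 'cV[R]_d.+1 -> 'M[R]_(m, n)) x h :
  (forall t : R, 0 <= t <= 1 -> differentiable F (x + t *: h)
     /\ 'D_h F (x + t *: h) = 0) -> F (x + h) = F x.
Proof.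
move=> H; apply/matrixP => a b.
pose c := fun t : R => F (x + t *: h) a b.
pose l := fun t : R => x + t *: h.
have dc (t : R) : t \in `[0, 1] -> is_derive t 1 c (0 : R).
  rewrite in_itv /= => /H [dF D0].
  have dl : is_diff t l (0 + *:%R^~ h).
    by have -> : l = cst x + *:%R^~ h by []; apply: is_diffD.
  have Dl : 'D_1 l t = h by rewrite deriveE // diff_val !fctE /= scale1r add0r.
  have dFl : differentiable (F \o l) t by exact: differentiable_comp.
  apply: DeriveDef.
    exact: diff_derivable (differentiable_entry a b dFl).
  have E1 : 'D_1 c t = 'D_1 (F \o l) t a b by exact: (derive_entry _ a b dFl).
  have dlt : differentiable l t by [].
  have E2 : 'D_1 (F \o l) t = 0.
    by apply: etrans (derive_chain _ dlt dF) _; rewrite Dl.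
  by rewrite E1 E2 mxE.
have cc : {within `[0 : R, 1], continuous c}.
  by apply: derivable_within_continuous => t ht; have [] := dc t ht.
have dco (t : R) : t \in `]0, 1[ -> is_derive t 1 c ((fun=> 0 : R) t).
  by move=> /subset_itv_oo_cc; exact: dc.
have [z _] := MVT_segment ler01 dco cc.
by rewrite mul0r /c scale1r scale0r addr0 => /eqP; rewrite subr_eq0 => /eqP.
Qed.

Section GlobalMaps.
Context {R : realType} {m n : nat} {M : acmanifold R m} {N : acmanifold R n}.
Variable f : M -> N.
Hypothesis f_smooth : smooth_map f.
Implicit Types (i : chart M) (j : chart N).

Lemma rep_dom_open i j : open (rep_dom f i j).
Proof.
have [fc _] := f_smooth.
rewrite openE => x [ci cj]; apply: filterI.
  by apply: open_nbhs_nbhs; split=> //; exact: cimg_open.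
have pc := param_continuous ci.
have fpc : f (param i y) @[y --> x] --> f (param i x).
  exact: continuous_comp pc (fc _).
by apply: fpc; apply: open_nbhs_nbhs; split=> //; exact: cdom_open.
Qed.

Lemma rep_twice i j : twice_differentiable_on (rep_dom f i j) (rep f i j).
Proof. by have [_ H] := f_smooth; exact: smooth_on_twice (H i j). Qed.

Lemma rep_thrice i j u : twice_differentiable_on (rep_dom f i j) ('D_u (rep f i j)).
Proof.
have [_ H] := f_smooth; have [_ /(_ u) [d1 d2]] := H i j 2%N.
move=> x Wx; split; first exact: d1.
by move=> v; have [d3 _] := d2 v; exact: d3.
Qed.

(** Each level set is open, by integration along segments in a chart, and closed, because points of
    the Hausdorff target are closed. *)
Lemma locally_constant : connected [set: M] ->
  (forall i j x v, rep_dom f i j x -> 'D_v (rep f i j) x = 0) -> constant_map f.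
Proof.
have [fc _] := f_smooth; move=> cM D0.
suff H p0 : [set p | f p = f p0] = [set: M].
  by move=> p q; have : [set p | f p = f q] p by rewrite H.
apply: cM; first by exists p0.
- exists [set p | f p = f p0]; last by rewrite setTI.
  rewrite openE => p /= fp.
  have [i ip] := chart_cover p; have [j jp] := chart_cover (f p).
  pose x := Defs.coord i p.
  have Wx : rep_dom f i j x by split; [exact: coord_img|rewrite coordK].
  (* A ball contains the segments from its centre, so the straight path in coordinates stays where
     [rep f i j] is controlled. *)
  have /nbhs_ballP [r r0 rW] : nbhs x (rep_dom f i j).
    by apply: open_nbhs_nbhs; split=> //; exact: rep_dom_open.
  have nb : nbhs p (cdom i `&` Defs.coord i @^-1` ball x r).
    apply: filterI; first by apply: open_nbhs_nbhs; split=> //; exact: cdom_open.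
    by apply: (Defs.coord_continuous ip); exact: nbhsx_ballx.
  apply: filterS nb => q [iq /= bq].
  have E1 : rep f i j (Defs.coord i q) = rep f i j x.
    rewrite -[Defs.coord i q](subrK x) addrC.
    apply: derive_segment0 => t /andP[t0 t1].
    have Wt : rep_dom f i j (x + t *: (Defs.coord i q - x)).
      apply: rW; move: bq; rewrite -!ball_normE /= => bq.
      rewrite opprD addrA subrr add0r normrN normrZ ger0_norm //.
      rewrite distrC in bq; apply: le_lt_trans bq.
      by rewrite -[leRHS]mul1r ler_wpM2r.
    by split; [have [] := rep_twice Wt|exact: D0].
  have [_ jq] : rep_dom f i j (Defs.coord i q) by exact: rW.
  rewrite coordK // in jq.
  move: E1; rewrite /rep /x !coordK // => E1.
  by rewrite -(coordK jq) E1 coordK.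
- exists [set p | f p = f p0]; last by rewrite setTI.
  have cl : closed [set f p0].
    by apply: accessible_closed_set1; apply: hausdorff_accessible; exact: points_hausdorff.
  exact: (closed_comp (fun p _ => fc p) cl).
Qed.

Lemma constant_harmonic : constant_map f -> harmonic_map f.
Proof.
move=> cf i j x Wx; have Uy : cimg j (rep f i j x) by exact: coord_img Wx.2.
have repE : rep f i j = cst (rep f i j x).
  by apply/funext => y; rewrite /rep (cf (param i y) (param i x)).
have D y v : 'D_v (rep f i j) y = 0 by rewrite repE; exact: derive_cst.
have D2 v w : 'D_w ('D_v (rep f i j)) x = 0.
  have -> : 'D_v (rep f i j) = cst 0 by apply/funext => y; exact: D.
  exact: derive_cst.
rewrite /tension big1 // => k _; rewrite big1 // => l _.
rewrite D2 !D (christoffel0 (ac_chart j)) //.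
by rewrite subr0 addr0 scaler0.
Qed.

Lemma constant_constant_along_D : constant_map f -> constant_along_D f.
Proof.
move=> cf i j X _ _ x _.
have -> : rep f i j = cst (rep f i j x).
  by apply/funext => y; rewrite /rep (cf (param i y) (param i x)).
exact: derive_cst.
Qed.

Lemma pm_holomorphicP : pm_holomorphic f -> exists2 s : R, s * s = 1 & holomorphic_up_to s f.
Proof.
by case=> H; [exists 1|exists (-1)]; rewrite ?mulr1 ?mulrNN ?mulr1.
Qed.

Hypothesis M_connected : connected [set: M].
Hypothesis f_hol : pm_holomorphic f.
Hypothesis M_twisted : forall i x, cimg i x -> twisted (acs i) x.

Lemma harmonic_constant_B3 : class_B3 N -> harmonic_map f -> constant_map f.
Proof.
move=> cN hf; apply: locally_constant => // i j x v Wx.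
have [s ss hol] := pm_holomorphicP f_hol.
have Ux : cimg i x by exact: Wx.1.
have WU y : rep_dom f i j y -> cimg i y by move=> [].
have FU y : rep_dom f i j y -> cimg j (rep f i j y) by move=> [_]; exact: coord_img.
have [g ag] := adapted_exists (ac_chart i) Ux erefl.
have [_ [b b0 bP]] := class_B3_pt cN (FU x Wx).
apply: (harmonic_closed_target (ac_chart i) (ac_chart j) (@rep_dom_open i j) WU FU
  (@rep_twice i j) (@rep_thrice i j) ss (hol i j) erefl Wx ag _ _ b0 bP (hf i j x Wx)).
- by move=> y Wy; apply: M_twisted; exact: WU.
- by move=> y u w Wy; have [H _] := class_B3_pt cN (FU y Wy).
Qed.

Lemma harmonic_constant_A3 : (forall i x, cimg i x -> balanced_pt i x) ->
  class_A3 N -> harmonic_map f -> constant_map f.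
Proof.
move=> bM cN hf; apply: locally_constant => // i j x v Wx.
have [s ss hol] := pm_holomorphicP f_hol.
have Ux : cimg i x by exact: Wx.1.
have WU y : rep_dom f i j y -> cimg i y by move=> [].
have FU y : rep_dom f i j y -> cimg j (rep f i j y) by move=> [_]; exact: coord_img.
have [g ag] := adapted_exists (ac_chart i) Ux erefl.
have [_ bal] := bM i x Ux.
(* The coefficients of nabla sigma are known point by point and are gathered into a function; (0, 0)
   is a dummy value outside the domain of [rep f i j]. *)
have /choice [c cP] : forall y, exists c : R * R, rep_dom f i j y -> c.2 != 0 /\
    forall u w, nabla_eta (acs j) (rep f i j y) u w
     = - c.1 * bform (dmet (acs j) (rep f i j y)) (dphi (acs j) (rep f i j y) *m u) w
     + c.2 * (bform (dmet (acs j) (rep f i j y)) u w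
        - (deta (acs j) (rep f i j y) *m u) 0 0 * (deta (acs j) (rep f i j y) *m w) 0 0).
  move=> y; have [Wy|nWy] := pselect (rep_dom f i j y); last by exists (0, 0).
  by have [c c0 cE] := class_A3_eta cN (FU y Wy); exists c.
apply: (harmonic_trans_Sasakian_target (ac_chart i) (ac_chart j) (@rep_dom_open i j) WU FU
  (@rep_twice i j) (@rep_thrice i j) ss (hol i j) erefl Wx ag _ _ (bal g ag)
  (cP x Wx).1 _ (hf i j x Wx)).
- by move=> y Wy; apply: M_twisted; exact: WU.
- by move=> y u Wy; have [H _] := bM i y (WU y Wy); exact: H.
- by move=> y u w Wy; have [_ H] := cP y Wy; exact: H.
Qed.

(** The hypothesis tests smooth fields, not vectors. For u in D one has u = - phi (phi u), so - u is
    the value at [x] of the smooth field y |-> phi(y) w tangent to D, with w = phi(x) u fixed. *)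
Lemma constant_along_D_constant : constant_along_D f -> constant_map f.
Proof.
move=> cD; apply: locally_constant => // i j x v Wx.
have [s ss hol] := pm_holomorphicP f_hol.
have Ux : cimg i x by exact: Wx.1.
have WU y : rep_dom f i j y -> cimg i y by move=> [].
have FU y : rep_dom f i j y -> cimg j (rep f i j y) by move=> [_]; exact: coord_img.
have [dF _] := rep_twice Wx.
have [sphi _ _ _] := acs_smooth i.
have DJ u : 'D_(dphi (acs i) x *m u) (rep f i j) x = 0.
  apply: (cD i j (fun y => dphi (acs i) y *m u)) => //.
    by apply: smooth_on_mulmx_cst => //; exact: cimg_open.
  by move=> y Uy; exact: (ac_eta_phi (ac_chart i)).
apply: (map_eq0 (ac_chart i) (ac_chart j) (@rep_dom_open i j) WU FU
  (@rep_twice i j) (@rep_thrice i j) ss (hol i j) Wx (M_twisted Ux)) => u eu.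
have := ac_sqr (ac_chart i) u Ux; rewrite eu scale0r addr0 => JJ.
have := DJ (dphi (acs i) x *m u); rewrite JJ (deriveNv _ dF) => /eqP.
by rewrite oppr_eq0 => /eqP.
Qed.

End GlobalMaps.

Theorem theorem4p2 (R : realType) (m n : nat)
    (M : acmanifold R m) (N : acmanifold R n) (f : M -> N)
    (m_gt0 : (0 < m)%N) (M_connected : connected [set: M])
    (f_smooth : smooth_map f) (f_hol : pm_holomorphic f) :
  ((class_A1 M \/ class_A2 M \/ class_A3 M \/ class_A6 M) -> class_B3 N ->
     (harmonic_map f <-> constant_map f))
  /\
  ((class_A1 M \/ class_A6 M \/ class_A7 M) -> class_A3 N ->
     (harmonic_map f <-> constant_along_D f) /\
     (weakly_conformal f \/ horizontally_weakly_conformal f ->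
        (harmonic_map f <-> constant_map f))).
Proof.
split.
  move=> cM cN; split; last exact: constant_harmonic.
  apply: (harmonic_constant_B3 f_smooth M_connected f_hol) cN => i x Ux.
  apply: (contact_twisted m_gt0 Ux).
  case: cM => [/class_A1_pt|[/class_A2_pt|[/class_A3_pt|[a /nearly_Sasakian_pt]]]] H.
  - by have [] := H i x Ux.
  - exact: H.
  - exact: H.
  - by have [] := H i x Ux.
move=> cM cN.
have H (i : chart M) x : cimg i x -> twisted (acs i) x /\ balanced_pt i x.
  move=> Ux; case: cM => [/class_A1_pt|[[a /nearly_Sasakian_pt]|/(class_A7_pt m_gt0)]] H.
  - by have [c b] := H i x Ux; split; [exact: contact_twisted|exact: coclosed_balanced].
  - by have [c b] := H i x Ux; split; [exact: contact_twisted|exact: coclosed_balanced].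
  - exact: H.
have tM (i : chart M) x (Ux : cimg i x) := (H i x Ux).1.
have bM (i : chart M) x (Ux : cimg i x) := (H i x Ux).2.
have hc := harmonic_constant_A3 f_smooth M_connected f_hol tM bM cN.
split=> [|_]; last by split; [exact: hc|exact: constant_harmonic].
split=> [/hc|/(constant_along_D_constant f_smooth M_connected f_hol tM)].
  exact: constant_constant_along_D.
exact: constant_harmonic.
Qed.
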